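(* Let $N$ be an $(n-1)$-dimensional manifold, $K$ a Lie group acting on $N$, and let $G=S^1\times K$ act component-wise on $M=S^1\times N$, where $S^1$ acts on itself by rotations. Then the twisted $b$-cotangent lift of this action, i.e. the lifted action on $T^*M$ endowed with the $b$-symplectic form $\omega=-d\lambda$, $\lambda=\log|a|\,d\theta+\lambda_N$, is Hamiltonian with equivariant moment map $\mu$ given by $$\langle\mu(p),X\rangle:=\langle\lambda_p,X^\#|_p\rangle,\qquad p\in T^*M,\ X\in\mathfrak{g},$$ where $\mathfrak{g}$ is the Lie algebra of $G$ and $X^\#$ is the fundamental vector field of $X$ under the action on $T^*M$.
   Context: $(\theta,a)$ are the standard coordinates on $T^*S^1$ and $\lambda_N$ is the standard Liouville one-form on $T^*N$. Under $T^*M=T^*(S^1\times N)\cong T^*S^1\times T^*N$, the one-form $\lambda=\log|a|\,d\theta+\lambda_N$ is defined for $a\ne0$; in local coordinates $(x_i)$ on $N$ and corresponding coordinates $(x_i,y_i)$ on $T^*N$, $\lambda=\log|a|\,d\theta+\sum_{i=1}^{n-1}y_i\,dx_i$. Its negative differential $\omega=-d\lambda$ extends to a $b$-symplectic form on $T^*M$ with critical hypersurface $Z=\{a=0\}$. The lift of an action $\rho$ on $M$ to $T^*M$ is $\hat\rho_g=(\rho_{g^{-1}})^*$, covering $\rho_g$. $b$-notions: for a manifold $W$ with a hypersurface $Z$, ${}^bTW$ is the bundle whose sections are the vector fields tangent to $Z$ and ${}^bT^*W$ is its dual (locally generated by $\frac{dx_1}{x_1},dx_2,\dots,dx_m$ if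 $Z=\{x_1=0\}$). $b$-forms are sections of $\Lambda^k({}^bT^*W)$, and a $b$-symplectic form is a closed $b$-form of degree 2 of maximal rank at every point. A $b$-function is a function of the form $k\log|f|+g$ with $k\in\mathbb{R}$, $f$ a defining function of $Z$ and $g$ smooth (with values in $\mathbb{R}\cup\{\infty\}$); its differential is the $b$-one-form $k\frac{df}{f}+dg$. Hamiltonian with moment map $\mu$ means: for every $X\in\mathfrak{g}$, $\langle\mu,X\rangle$ is a $b$-function on $T^*M$ and $\iota_{X^\#}\omega=d\langle\mu,X\rangle$. Equivariant means $\mu\circ\hat\rho_g=\mathrm{Ad}^*_{g^{-1}}\circ\mu$ for all $g\in G$, where $\langle\mathrm{Ad}^*_{g^{-1}}\xi,X\rangle=\langle\xi,\mathrm{Ad}_{g^{-1}}X\rangle$. *)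

(* Defs.v *)
From HB Require Import structures.
From mathcomp Require Import all_boot all_order all_algebra.
From mathcomp Require Import complex.
From mathcomp Require Import all_classical all_reals all_analysis.

Set Implicit Arguments.
Unset Strict Implicit.
Unset Printing Implicit Defensive.
Import Order.TTheory GRing.Theory Num.Theory.
Import numFieldNormedType.Exports.

Local Open Scope classical_set_scope.
Local Open Scope ring_scope.

(* Functionals on functions; tangent vectors will be such functionals. *)
Notation functional R M := ((M -> R^o) -> R^o).

Section calculus.
Context {R : realType} {V W : normedModType R}.

Fixpoint Ck (k : nat) (U : set V) (f : V -> W) : Prop :=
  if k is k'.+1 then
    (forall x, U x -> differentiable f x) /\ (forall v, Ck k' U ('D_v f))
  else forall x, U x -> {for x, continuous f}.

Definition smooth_on (U : set V) (f : V -> W) : Prop := forall k, Ck k U f.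

End calculus.

(* A manifold is a type with an atlas; its topology is the one induced by the
   charts, see [mnbhs]. *)
Record chart (R : realType) (M : Type) (d : nat) := Chart {
  cdom : set M;
  coord :> M -> 'rV[R]_d }.

Definition atlas (R : realType) (M : Type) (d : nat) := set (chart R M d).

Section manifold.
Context {R : realType} {M : Type} {d : nat}.
Implicit Types (c : chart R M d) (A : atlas R M d).

(* [loc c g] is g \o c^-1 on the image of c (and 0 elsewhere). *)
Definition loc {W : normedModType R} c (g : M -> W) (x : 'rV[R]_d) : W :=
  xget 0 [set g q | q in [set q | cdom c q /\ c q = x]].

Definition mnbhs A (p : M) (P : set M) : Prop :=
  exists c (U : set 'rV[R]_d),
    [/\ A c, cdom c p, [/\ open U, U (c p) & U `<=` c @` cdom c] &
        forall q, cdom c q -> U (c q) -> P q].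

Definition smooth_near {W : normedModType R} A (p : M) (g : M -> W) : Prop :=
  exists c (U : set 'rV[R]_d),
    [/\ A c, cdom c p, [/\ open U, U (c p) & U `<=` c @` cdom c] &
        smooth_on U (loc c g)].

Definition is_manifold A : Prop :=
  [/\ (forall p, exists2 c, A c & cdom c p),
      (forall c, A c -> set_inj (cdom c) c /\ open (c @` cdom c)),
      (forall c c', A c -> A c' ->
         open (c @` (cdom c `&` cdom c')) /\
         smooth_on (c @` (cdom c `&` cdom c')) (loc c c')),
      (forall p q, p <> q ->
         exists P Q, [/\ mnbhs A p P, mnbhs A q Q & P `&` Q = set0]) &
      (exists B : nat -> set M,
         (forall n p, B n p -> mnbhs A p (B n)) /\
         (forall p P, mnbhs A p P -> exists n, B n p /\ B n `<=` P))].

(* Tangent vectors at p are directional derivatives; as functionals on all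
   functions they are 0 on the functions which are not smooth near p. *)
Definition coordvec A c (p : M) (u : 'rV[R]_d) : functional R M :=
  fun g => if `[< smooth_near A p g >] then 'D_u (loc c g) (c p) else 0.

Definition tangent A (p : M) : set (functional R M) :=
  [set v | exists c u, [/\ A c, cdom c p & v = coordvec A c p u]].

Definition dcoord A c (p : M) (i : 'I_d) : functional R M :=
  coordvec A c p (delta_mx 0 i).

(* If A is the atlas of a manifold, [tangent A p] is a vector space and the
   third premise is redundant. *)
Definition linear_on A (p : M) (phi : functional R M -> R^o) : Prop :=
  forall a v w, tangent A p v -> tangent A p w -> tangent A p (a *: v + w) ->
    phi (a *: v + w) = a *: phi v + phi w.

End manifold.

(* The differential of f at p, with values in the tangent space at f p. *)
Definition tmap {R : realType} {M M' : Type} {d' : nat} (B : atlas R M' d')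
    (f : M -> M') (p : M) (v : functional R M) : functional R M' :=
  fun g => if `[< smooth_near B (f p) g >] then v (g \o f) else 0.

Definition smooth_map {R : realType} {M M' : Type} {d d' : nat}
    (A : atlas R M d) (B : atlas R M' d') (f : M -> M') : Prop :=
  forall p, exists c',
    [/\ B c', cdom c' (f p), mnbhs A p (f @^-1` cdom c') &
        smooth_near A p (c' \o f)].

Definition prod_chart {R : realType} {M M' : Type} {d d' : nat}
    (c : chart R M d) (c' : chart R M' d') : chart R (M * M') (d + d') :=
  Chart (cdom c `*` cdom c') (fun p => row_mx (c p.1) (c' p.2)).

Definition prod_atlas {R : realType} {M M' : Type} {d d' : nat}
    (A : atlas R M d) (B : atlas R M' d') : atlas R (M * M') (d + d') :=
  [set c | exists a b, [/\ A a, B b & c = prod_chart a b]].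

Section cotangent_bundle.
Context {R : realType} {M : Type} {d : nat}.
Variable A : atlas R M d.

(* A covector at p is a linear functional on [tangent A p], extended by 0. *)
Definition covector (p : M) (phi : functional R M -> R^o) : Prop :=
  linear_on A p phi /\ forall v, ~ tangent A p v -> phi v = 0.

Record cotangent := Cotangent {
  cbase : M;
  cform : functional R M -> R^o;
  cformP : covector cbase cform }.

Definition restrict_covector (p : M) (phi : functional R M -> R^o) :
    functional R M -> R^o :=
  fun v => if `[< linear_on A p phi /\ tangent A p v >] then phi v else 0.

Lemma restrict_covectorP p phi : covector p (restrict_covector p phi).
Proof.
split=> [a v w Tv Tw Tavw|v nTv]; rewrite /restrict_covector; last first.
  by case: asboolP => // -[].
case: (pselect (linear_on A p phi)) => [lin|nlin].
  by do 3 (rewrite asboolT; last by []); exact: lin.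
by do 3 (rewrite asboolF; last by case); rewrite scaler0 addr0.
Qed.

(* The point of T*M over p given by a functional which is linear on
   [tangent A p]. *)
Definition mkcotangent (p : M) (phi : functional R M -> R^o) : cotangent :=
  Cotangent (restrict_covectorP p phi).

Definition cot_chart (c : chart R M d) : chart R cotangent (d + d) :=
  Chart (cbase @^-1` cdom c)
    (fun q => row_mx (c (cbase q))
                     (\row_i cform q (dcoord A c (cbase q) i))).

Definition cot_atlas : atlas R cotangent (d + d) := cot_chart @` A.

(* The standard Liouville one-form. *)
Definition liouville (q : cotangent)
    (v : functional R cotangent) : R^o :=
  cform q (tmap A cbase q v).

(* (rho_{g^-1})^* *)
Definition cot_lift {G : groupType} (rho : G -> M -> M) (g : G)
    (q : cotangent) : cotangent :=
  mkcotangent (rho g (cbase q))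
    (fun v => cform q (tmap A (rho g^-1%g) (rho g (cbase q)) v)).

End cotangent_bundle.

Arguments cot_atlas {R M d} A : rename.

Section cotangent_product.
Context {R : realType} {M N : Type} {d e : nat}.
Variables (A : atlas R M d) (B : atlas R N e).

(* The two components of T*(M x N) ~ T*M x T*N. *)
Definition cot_fst (q : cotangent (prod_atlas A B)) : cotangent A :=
  mkcotangent A (cbase q).1
    (fun v => cform q
       (tmap (prod_atlas A B) (fun z => (z, (cbase q).2)) (cbase q).1 v)).

Definition cot_snd (q : cotangent (prod_atlas A B)) : cotangent B :=
  mkcotangent B (cbase q).2
    (fun v => cform q
       (tmap (prod_atlas A B) (fun x => ((cbase q).1, x)) (cbase q).2 v)).

End cotangent_product.

Section forms.
Context {R : realType} {M : Type} {d : nat}.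
Variable A : atlas R M d.

(* Forms are given by their values on tangent vectors; d is computed in charts
   by (d alpha)_ij = d_i alpha_j - d_j alpha_i. *)
Definition ext_d (alpha : M -> functional R M -> R^o) (q : M)
    (v w : functional R M) : R^o :=
  xget 0 [set r | exists c u u',
    [/\ A c, cdom c q, v = coordvec A c q u, w = coordvec A c q u' &
      r = 'D_u (loc c (fun p => alpha p (coordvec A c p u'))) (c q)
        - 'D_u' (loc c (fun p => alpha p (coordvec A c p u))) (c q)]].

Definition alternating2_on (O : set M)
    (omega : M -> functional R M -> functional R M -> R^o) : Prop :=
  forall q, O q ->
    [/\ forall v, tangent A q v -> linear_on A q (omega q v),
        forall w, tangent A q w -> linear_on A q (fun v => omega q v w) &
        forall v, tangent A q v -> omega q v v = 0].

Definition closed2_on (O : set M)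
    (omega : M -> functional R M -> functional R M -> R^o) : Prop :=
  forall c q, A c -> cdom c q -> O q -> forall i j k : 'I_d,
    let D i j k := 'D_(delta_mx 0 i)
      (loc c (fun p => omega p (dcoord A c p j) (dcoord A c p k))) (c q) in
    D i j k + D j k i + D k i j = 0.

End forms.

Section b_geometry.
Context {R : realType} {M : Type} {d : nat}.
Variables (A : atlas R M d) (Z : set M).

Definition adapted (c : chart R M d) (i : 'I_d) : Prop :=
  A c /\ forall q, cdom c q -> (Z q <-> c q 0 i = 0).

(* The local frame x_i d/dx_i, d/dx_j (j <> i) of bTM, dual to
   dx_i / x_i, dx_j, mapped to TM. *)
Definition bframe (c : chart R M d) (i : 'I_d) (q : M) (j : 'I_d) :
    functional R M :=
  (if j == i then c q 0 i else 1) *: dcoord A c q j.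

(* Since the complement of Z is dense, a section of an exterior power of bT*M
   is a form on the complement of Z whose coefficients in the frame
   dx_i / x_i, dx_j extend smoothly across Z; values on Z of the functions
   alpha and omega below are ignored. *)
Definition bfield_coef (X : M -> functional R M) c i
    (xi : M -> 'rV[R]_d) : Prop :=
  forall q, cdom c q ->
    smooth_near A q xi /\ X q = \sum_j xi q 0 j *: bframe c i q j.

Definition bform1_coef (alpha : M -> functional R M -> R^o) c i
    (C : M -> 'rV[R]_d) : Prop :=
  forall q, cdom c q -> smooth_near A q C /\
    (~ Z q -> forall j, C q 0 j = alpha q (bframe c i q j)).

Definition bform2_coef
    (omega : M -> functional R M -> functional R M -> R^o) c i
    (B : M -> 'M[R]_d) : Prop :=
  forall q, cdom c q -> smooth_near A q B /\
    (~ Z q -> forall j k, B q j k = omega q (bframe c i q j) (bframe c i q k)).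

Definition b_symplectic
    (omega : M -> functional R M -> functional R M -> R^o) : Prop :=
  [/\ alternating2_on A (~` Z) omega, closed2_on A (~` Z) omega &
      forall q, exists c i B, [/\ adapted c i, cdom c q,
        bform2_coef omega c i B & B q \in unitmx]].

(* iota_X omega = alpha as b-forms, i.e. also along Z. *)
Definition b_contract (X : M -> functional R M)
    (omega : M -> functional R M -> functional R M -> R^o)
    (alpha : M -> functional R M -> R^o) : Prop :=
  forall q, exists c i xi B C, [/\ adapted c i /\ cdom c q,
    bfield_coef X c i xi, bform2_coef omega c i B, bform1_coef alpha c i C &
    xi q *m B q = C q].

Definition defining_function (f : M -> R^o) : Prop :=
  [/\ forall q, smooth_near A q f, Z = [set q | f q = 0] &
      forall q, Z q -> exists2 v, tangent A q v & v f != 0].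

(* h = k log |f| + g; here log 0 = -oo and 0 * -oo = 0. *)
Definition b_function_eq (h : M -> \bar R) (k : R) (f g : M -> R^o) : Prop :=
  [/\ defining_function f, forall q, smooth_near A q g &
      forall q, h q = (k%:E * lne `|f q|%:E + (g q)%:E)%E].

(* k df / f + dg *)
Definition b_differential (k : R) (f g : M -> R^o) (q : M)
    (v : functional R M) : R^o :=
  k * (v f / f q) + v g.

Section actions.
Context {G : groupType} {e : nat}.
Variables (AG : atlas R G e) (rho : G -> M -> M).

(* X^#; the Lie algebra of G is [tangent AG 1%g]. *)
Definition fundamental (X : functional R G) (q : M) : functional R M :=
  tmap A (fun g => rho g q) 1%g X.

Definition b_hamiltonian
    (omega : M -> functional R M -> functional R M -> R^o)
    (mu : M -> functional R G -> \bar R) : Prop :=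
  (forall q, ~ Z q -> linear_on AG 1%g (fun X => fine (mu q X))) /\
  forall X, tangent AG 1%g X -> exists k f g,
    b_function_eq (fun q => mu q X) k f g /\
    b_contract (fundamental X) omega (b_differential k f g).

Definition Ad (g : G) (X : functional R G) : functional R G :=
  tmap AG (fun h => (g * h * g^-1)%g) 1%g X.

Definition equivariant (mu : M -> functional R G -> \bar R) : Prop :=
  forall g q X, tangent AG 1%g X -> mu (rho g q) X = mu q (Ad g^-1%g X).

End actions.
End b_geometry.

Definition lie_group {R : realType} {K : groupType} {k : nat}
    (AK : atlas R K k) : Prop :=
  [/\ is_manifold AK,
      smooth_map (prod_atlas AK AK) AK (fun p => (p.1 * p.2)%g) &
      smooth_map AK AK (fun g => g^-1%g)].

Definition smooth_action {R : realType} {K : groupType} {N : Type} {k m : nat}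
    (AK : atlas R K k) (AN : atlas R N m) (act : K -> N -> N) : Prop :=
  [/\ forall x, act 1%g x = x,
      forall g h x, act (g * h)%g x = act g (act h x) &
      smooth_map (prod_atlas AK AN) AN (fun p => act p.1 p.2)].

Section circle.
Variable R : realType.

Definition circle := {z : R[i] | `|z| == 1}.
HB.instance Definition _ := Choice.on circle.

Definition circle_one : circle := exist _ 1 (introT eqP (normr1 _)).

Lemma circle_mul_subproof (z w : circle) : `|val z * val w| == 1.
Proof. by rewrite normrM (eqP (valP z)) (eqP (valP w)) mulr1. Qed.

Definition circle_mul (z w : circle) : circle :=
  exist _ (val z * val w) (circle_mul_subproof z w).

Lemma circle_inv_subproof (z : circle) : `|(val z)^-1| == 1.
Proof. by rewrite normfV (eqP (valP z)) invr1. Qed.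

Definition circle_inv (z : circle) : circle :=
  exist _ (val z)^-1 (circle_inv_subproof z).

Lemma circle_mulA : associative circle_mul.
Proof. by move=> x y z; apply/val_inj; rewrite /= mulrA. Qed.

Lemma circle_mul1 : left_id circle_one circle_mul.
Proof. by move=> x; apply/val_inj; rewrite /= mul1r. Qed.

Lemma circle_mulr1 : right_id circle_one circle_mul.
Proof. by move=> x; apply/val_inj; rewrite /= mulr1. Qed.

Lemma circle_neq0 (z : circle) : val z != 0.
Proof. by rewrite -normr_eq0 (eqP (valP z)) oner_neq0. Qed.

Lemma circle_mulV : left_inverse circle_one circle_inv circle_mul.
Proof. by move=> x; apply/val_inj; rewrite /= mulVf ?circle_neq0. Qed.

Lemma circle_mulrV : right_inverse circle_one circle_inv circle_mul.
Proof. by move=> x; apply/val_inj; rewrite /= mulfV ?circle_neq0. Qed.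

HB.instance Definition _ :=
  isGroup.Build circle circle_mulA circle_mul1 circle_mulr1
    circle_mulV circle_mulrV.

(* theta - theta(z0), in ]-pi, pi[, for z <> - z0 *)
Definition angle (z0 z : circle) : R :=
  xget 0 [set t | - pi < t < pi /\ val z = val z0 * (cos t +i* sin t)%C].

Definition angle_chart (z0 : circle) : chart R circle 1 :=
  Chart [set z : circle | val z <> - val z0] (fun z => const_mx (angle z0 z)).

Definition circle_atlas : atlas R circle 1 := range angle_chart.

Definition dtheta (z : circle) (v : functional R circle) : R^o :=
  v (angle z).

Definition fiber_a (q : cotangent circle_atlas) : R^o :=
  cform q (dcoord circle_atlas (angle_chart (cbase q)) (cbase q) 0).

End circle.

Arguments circle_atlas R : clear implicits.

Section twisted_lift.
Context {R : realType} {N : Type} {m : nat}.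
Variable AN : atlas R N m.

Let AM := prod_atlas (circle_atlas R) AN.

Definition a_coord (q : cotangent AM) : R^o := fiber_a (cot_fst q).

Definition critical_hypersurface : set (cotangent AM) :=
  [set q | a_coord q = 0].

(* log |a| dtheta + lambda_N; on {a = 0} the coefficient log |a| is -oo. *)
Definition twisted_liouville (q : cotangent AM)
    (v : functional R (cotangent AM)) : \bar R :=
  (lne `|a_coord q|%:E *
     (dtheta (cbase (cot_fst q))
       (tmap (circle_atlas R) (fun q => cbase (cot_fst q)) q v))%:E +
   (liouville (cot_snd q) (tmap (cot_atlas AN) (fun q => cot_snd q) q v))%:E)%E.

Definition twisted_form (q : cotangent AM)
    (v w : functional R (cotangent AM)) : R^o :=
  - ext_d (cot_atlas AM) (fun q v => fine (twisted_liouville q v)) q v w.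

Context {K : groupType}.
Variable act : K -> N -> N.

Definition component_action (g : circle R * K) (p : circle R * N) :
    circle R * N :=
  ((g.1 * p.1)%g, act g.2 p.2).

Definition lifted_action : circle R * K -> cotangent AM -> cotangent AM :=
  cot_lift component_action.

Definition moment_map (q : cotangent AM)
    (X : functional R (circle R * K)) : \bar R :=
  twisted_liouville q (fundamental (cot_atlas AM) lifted_action X q).

End twisted_lift.

Arguments critical_hypersurface {R N m} AN _.
Arguments twisted_form {R N m} AN q v w.
Arguments lifted_action {R N m} AN {K} act _ _.
Arguments moment_map {R N m} AN {K} act q X.

(* Main.v *)
(* Write M = S^1 x N. In a cotangent chart (x_0 = theta, x_1, .., y_0 = a,
   y_1, ..) one has lambda = log |y_0| dx_0 + sum_(i > 0) y_i dx_i, hence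
   omega = dx_0 /\ dy_0 / y_0 + sum_(i > 0) dx_i /\ dy_i, and the matrix of omega
   in the frame (d/dx_i, y_0 d/dy_0, d/dy_i) is the constant symplectic matrix.
   If xi is the fundamental vector field of X on M, the lifted one is
   (xi, - sum_j y_j d xi_j / dx_i): for the y-part, differentiate
   D(rho_(g^-1)) o D(rho_g) = id at g = 1. The action is component-wise, so xi_0
   is constant, equal to the S^1-component k of X, and xi_i does not depend on
   theta. Thus the a-component of the lifted field is 0,
   <mu, X> = k log |y_0| + sum_(i > 0) y_i xi_i, and the contraction of omega with
   the lifted field is d <mu, X>, also along Z. Equivariance is functoriality of
   the tangent map, as a is invariant and S^1 is commutative. *)
Require Import Defs.
From HB Require Import structures.
From mathcomp Require Import all_boot all_order all_algebra.
From mathcomp Require Import complex ring lra.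
From mathcomp Require Import all_classical all_reals all_analysis.

Set Implicit Arguments.
Unset Strict Implicit.
Unset Printing Implicit Defensive.
Import Order.TTheory GRing.Theory Num.Theory.
Import numFieldNormedType.Exports.

Local Open Scope classical_set_scope.
Local Open Scope ring_scope.

(** * Differential calculus *)

(** Two conventions shape the work. Tangent vectors are functionals on all functions, 0 on those not
    smooth near the point, so each chart computation first settles the smoothness of the function
    concerned. And [loc], [angle] and [ext_d] are chosen values ([xget]), so each needs a proof that
    the candidates agree. For [ext_d] this is the naturality of d under a change of charts, which
    rests on the symmetry of second derivatives. The same symmetry returns for the lifted field,
    where the derivative at g = 1 of the Jacobian of rho_g has to become the Jacobian of the field.
    Smoothness being iterated directional differentiability, the symmetry is derived from the mean
    value theorem. No limit is taken at Z: the coefficients of the forms off Z are given by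
    expressions (a constant matrix, entries of the lifted field) that make sense and are smooth on Z
    as well, and these serve as the extensions. As lambda vanishes on vertical vectors, the moment
    map is computed from the field on M, by functoriality of [tmap]; the vertical part of the lifted
    field enters in the contraction. *)

Lemma near_eq_differentiable {R : realType} {V W : normedModType R}
    (f g : V -> W) (x : V) :
  (\near x, f x = g x) -> differentiable f x -> differentiable g x.
Proof.
move=> fg dfx; have [dfc fE] := (diffP _ _).1 dfx.
(* The differential of [g] is itself a chosen value; it suffices to exhibit one candidate, the
   differential of [f]. *)
apply/diffP; apply: (@getPex _ (fun df : {linear V -> W} => continuous df /\
  forall y, g y = g (lim (nbhs x)) + df (y - lim (nbhs x))
              +o_(y \near x) (y - lim (nbhs x)))).
exists ('d f x); split => //.
have gx : f x = g x := nbhs_singleton fg.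
rewrite lim_id // in fE *.
have {fE}/eqaddoP fo : f = (fun y => f x + 'd f x (y - x)) +o_ (nbhs x) (fun y => y - x).
  by apply/funext => y; rewrite [LHS]fE.
suff E : g = (fun y => g x + 'd f x (y - x)) +o_ (nbhs x) (fun y => y - x).
  by move=> y; rewrite {1}E.
apply/eqaddoP => e e0; have := fo _ e0; apply: filterS2 fg => y fgy.
by rewrite !fctE -fgy -gx.
Qed.

Section Ck_theory.
Context {R : realType} {V : normedModType R}.

Lemma CkW {W : normedModType R} k (U : set V) (f : V -> W) :
  Ck k.+1 U f -> Ck k U f.
Proof.
elim: k f => [f [df _] x Ux|k IH f [df Df]].
  exact/differentiable_continuous/df.
by split=> // v; exact: IH.
Qed.

Lemma CkS {W : normedModType R} k (U U' : set V) (f : V -> W) :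
  U' `<=` U -> Ck k U f -> Ck k U' f.
Proof.
move=> U'U; elim: k f => [f cf x /U'U/cf//|k IH f [df Df]].
by split=> [x /U'U|v]; [exact: df|exact/IH/Df].
Qed.

Lemma Ck_eq {W : normedModType R} k (U : set V) (f g : V -> W) :
  open U -> (forall x, U x -> f x = g x) -> Ck k U f -> Ck k U g.
Proof.
move=> oU; elim: k f g => [|k IH] f g fg.
  move=> cf x Ux; suff : g @ x --> g x by []; rewrite -(fg x Ux).
  apply: cvg_trans (cf x Ux); apply: near_eq_cvg.
  by apply: filterS (open_nbhs_nbhs (conj oU Ux)) => y /fg.
move=> [df Df]; split=> [x Ux|v].
  apply: near_eq_differentiable (df x Ux).
  by apply: filterS (open_nbhs_nbhs (conj oU Ux)) => y /fg.
apply: IH (Df v) => x Ux; apply: near_eq_derive.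
by apply: filterS (open_nbhs_nbhs (conj oU Ux)) => y /fg.
Qed.

Lemma Ck_cst {W : normedModType R} k (U : set V) (c : W) : Ck k U (cst c).
Proof.
elim: k c => [c x _|k IH c]; first exact: cst_continuous.
split=> [x _|v]; first exact: differentiable_cst.
rewrite (_ : 'D_v (cst c) = cst 0); first exact: IH.
by apply/funext => x; rewrite derive_cst.
Qed.

Lemma Ck_linear {W : normedModType R} k (U : set V) (f : {linear V -> W}) :
  continuous f -> Ck k U f.
Proof.
move=> cf; case: k => [x _|k]; first exact: cf.
split=> [x _|v]; first exact: linear_differentiable.
rewrite (_ : 'D_v f = cst (f v)); first exact: Ck_cst.
apply/funext => x; rewrite deriveE; last exact: linear_differentiable.
by rewrite diff_lin.
Qed.

Lemma Ck_linear_comp {W W' : normedModType R} k (U : set V)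
    (L : {linear W -> W'}) (f : V -> W) :
  open U -> continuous L -> Ck k U f -> Ck k U (L \o f).
Proof.
move=> oU cL; elim: k f => [|k IH] f.
  by move=> cf x Ux; apply: continuous_comp; [exact: cf|exact: cL].
move=> [df Df]; split=> [x Ux|v].
  by apply: differentiable_comp; [exact: df|exact: linear_differentiable].
apply: Ck_eq (IH _ (Df v)) => // x Ux /=.
have dfx := df x Ux; have dL := linear_differentiable (f x) cL.
by rewrite (deriveE _ dfx) (deriveE _ (differentiable_comp dfx dL))
  (diff_comp dfx dL) /= (diff_lin _ cL).
Qed.

Lemma CkD {W : normedModType R} k (U : set V) (f g : V -> W) :
  open U -> Ck k U f -> Ck k U g -> Ck k U (f + g).
Proof.
move=> oU; elim: k f g => [|k IH] f g.
  by move=> cf cg x Ux; apply: continuousD; [exact: cf|exact: cg].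
move=> [df Df] [dg Dg]; split=> [x Ux|v].
  by apply: differentiableD; [exact: df|exact: dg].
apply: Ck_eq (IH _ _ (Df v) (Dg v)) => // x Ux.
by rewrite deriveD//; apply: diff_derivable; [exact: df|exact: dg].
Qed.

Lemma Ck_sum {W : normedModType R} k (U : set V) n (f : 'I_n -> V -> W) :
  open U -> (forall i, Ck k U (f i)) -> Ck k U (fun x => \sum_i f i x).
Proof.
move=> oU cf.
have E (r : seq 'I_n) : Ck k U (fun x => \sum_(i <- r) f i x).
  elim: r => [|i r IH].
    by apply: Ck_eq (Ck_cst k U 0) => // x _; rewrite big_nil.
  by apply: Ck_eq (CkD oU (cf i) IH) => // x _; rewrite big_cons.
exact: E.
Qed.

Lemma CkM k (U : set V) (f g : V -> R^o) :
  open U -> Ck k U f -> Ck k U g -> Ck k U (fun x => f x * g x : R^o).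
Proof.
move=> oU; elim: k f g => [|k IH] f g.
  by move=> cf cg x Ux; apply: continuousM; [exact: cf|exact: cg].
move=> fC gC; have [df Df] := fC; have [dg Dg] := gC; split=> [x Ux|v].
  by apply: differentiableM; [exact: df|exact: dg].
have {}fC := CkW fC; have {}gC := CkW gC.
apply: (Ck_eq oU _ (CkD oU (IH _ _ fC (Dg v)) (IH _ _ gC (Df v)))) => x Ux.
by rewrite [RHS]deriveM//; apply: diff_derivable; [exact: df|exact: dg].
Qed.

Definition coordf n (i : 'I_n) (x : 'rV[R]_n) : R^o := x 0 i.

Lemma coordf_is_linear n i : linear (@coordf n i).
Proof. by move=> a x y; rewrite /coordf !mxE. Qed.

HB.instance Definition _ n i :=
  GRing.isLinear.Build _ _ _ _ (@coordf n i) (@coordf_is_linear n i).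

Lemma continuous_coordf n i : continuous (@coordf n i).
Proof. exact: coord_continuous. Qed.

(** Packaged as a linear map from scalars to rows, so that [Ck_linear_comp] reassembles a row from
    its coordinates in [Ck_coord]. *)
Definition scale_basis n (i : 'I_n) (a : R^o) : 'rV[R]_n := a *: delta_mx 0 i.

Lemma scale_basis_is_linear n i : linear (@scale_basis n i).
Proof. by move=> a x y; rewrite /scale_basis scalerDl scalerA. Qed.

HB.instance Definition _ n i :=
  GRing.isLinear.Build _ _ _ _ (@scale_basis n i) (@scale_basis_is_linear n i).

Lemma continuous_scale_basis n i : continuous (@scale_basis n i).
Proof. exact: scalel_continuous. Qed.

Lemma Ck_coord k (U : set V) n (f : V -> 'rV[R]_n) :
  open U -> Ck k U f <-> forall i, Ck k U (coordf i \o f).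
Proof.
move=> oU; split=> [fC i|fC].
  by apply: Ck_linear_comp => //; exact: continuous_coordf.
have E x : \sum_i f x 0 i *: delta_mx 0 i = f x by rewrite -row_sum_delta.
apply: (Ck_eq oU (fun x _ => E x)); apply: Ck_sum => // i.
exact: (@Ck_linear_comp _ _ k U (@scale_basis n i)
  (coordf i \o f) oU (@continuous_scale_basis n i)).
Qed.

End Ck_theory.

Section smooth_at_theory.
Context {R : realType}.
Implicit Types V W : normedModType R.

Lemma derive_coord V n (f : V -> 'rV[R]_n) x v i :
  differentiable f x -> 'D_v f x 0 i = 'D_v (coordf i \o f) x.
Proof.
move=> df; have dL := linear_differentiable (f x) (@continuous_coordf R n i).
rewrite (deriveE _ df) (deriveE _ (differentiable_comp df dL)).
by rewrite (diff_comp df dL) /= (diff_lin _ (@continuous_coordf R n i)).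
Qed.

Lemma derive_sum_coord V n (f : 'rV[R]_n -> V) (x v : 'rV[R]_n) :
  differentiable f x -> 'D_v f x = \sum_i v 0 i *: 'D_(delta_mx 0 i) f x.
Proof.
move=> df; rewrite deriveE// {1}(row_sum_delta v) linear_sum.
by apply: eq_bigr => i _; rewrite linearZ deriveE.
Qed.

Lemma derive_comp V n W (f : V -> 'rV[R]_n) (g : 'rV[R]_n -> W) x v :
  differentiable f x -> differentiable g (f x) ->
  'D_v (g \o f) x = 'D_('D_v f x) g (f x).
Proof.
move=> df dg; rewrite (deriveE _ (differentiable_comp df dg)) (diff_comp df dg).
by rewrite (deriveE _ df) (deriveE _ dg).
Qed.

(** By the chain rule the derivative of [g \o f] along [v] is the sum over i of the i-th coordinate
    of ['D_v f] times the i-th partial of [g] composed with [f]. These are products of scalar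
    functions of order [k], covered by [CkM] and the induction hypothesis. *)
Lemma Ck_comp_scalar V n k (U : set V) (U' : set 'rV[R]_n)
    (f : V -> 'rV[R]_n) (g : 'rV[R]_n -> R^o) :
  open U -> (forall x, U x -> U' (f x)) ->
  Ck k U f -> Ck k U' g -> Ck k U (g \o f).
Proof.
move=> oU fU; elim: k g => [|k IH] g.
  by move=> cf cg x Ux; apply: continuous_comp; [exact: cf|exact/cg/fU].
move=> fC gC; have [df Df] := fC; have [dg Dg] := gC; split=> [x Ux|v].
  by apply: differentiable_comp; [exact: df|exact/dg/fU].
have {}fC := CkW fC.
apply: (@Ck_eq _ _ _ k U (fun x => \sum_i
   (((coordf i \o 'D_v f) x) * ('D_(delta_mx 0 i) g \o f) x : R^o))) => //.
  move=> x Ux; have dfx := df x Ux; have dgx := dg _ (fU _ Ux).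
  by rewrite derive_comp// derive_sum_coord.
apply: Ck_sum => // i; apply: CkM => //; last exact: (IH _ fC (Dg _)).
exact: ((Ck_coord k _ oU).1 (Df v) i).
Qed.

(** A single open set serves all orders, so the property passes to derivatives and to nearby
    points. *)
Definition smooth_at V W (f : V -> W) (x : V) : Prop :=
  exists U, [/\ open U, U x & smooth_on U f].

Lemma smooth_at_differentiable V W (f : V -> W) x :
  smooth_at f x -> differentiable f x.
Proof. by move=> [U [_ Ux /(_ 1%N)[df _]]]; exact: df. Qed.

Lemma smooth_at_continuous V W (f : V -> W) x :
  smooth_at f x -> {for x, continuous f}.
Proof. by move=> /smooth_at_differentiable/differentiable_continuous. Qed.

Lemma smooth_at_near V W (f : V -> W) x :
  smooth_at f x -> \forall y \near x, smooth_at f y.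
Proof.
move=> [U [oU Ux fU]]; apply: filterS (open_nbhs_nbhs (conj oU Ux)) => y Uy.
by exists U.
Qed.

Lemma smooth_at_eq V W (f g : V -> W) x :
  (\near x, f x = g x) -> smooth_at f x -> smooth_at g x.
Proof.
move=> fg; have : nbhs x [set y | f y = g y] by [].
rewrite nbhsE => -[U' [oU' U'x] {}fg] [U [oU Ux fU]].
exists (U `&` U'); split; [exact: openI|by []|] => k.
apply: (@Ck_eq _ _ _ k _ f); first exact: openI.
  by move=> y [_ /fg].
by apply: CkS (fU k) => y [].
Qed.

Lemma smooth_at_derive V W (f : V -> W) x v :
  smooth_at f x -> smooth_at ('D_v f) x.
Proof.
move=> [U [oU Ux fU]]; exists U; split=> // k.
by have [_] := fU k.+1; exact.
Qed.

Lemma smooth_at_cst V W (c : W) x : smooth_at (fun=> c : W) (x : V).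
Proof.
by exists setT; split=> [||k]; [exact: openT|by []|exact: Ck_cst].
Qed.

Lemma smooth_at_linear V W (f : {linear V -> W}) x :
  continuous f -> smooth_at f x.
Proof.
move=> cf; exists setT.
by split=> [||k]; [exact: openT|by []|exact: Ck_linear].
Qed.

Lemma smooth_atM V (f g : V -> R^o) x :
  smooth_at f x -> smooth_at g x -> smooth_at (fun x => f x * g x : R^o) x.
Proof.
move=> [U [oU Ux fU]] [U' [oU' U'x gU']]; exists (U `&` U').
split; [exact: openI|by []|] => k; apply: CkM; first exact: openI.
  by apply: CkS (fU k) => y [].
by apply: CkS (gU' k) => y [].
Qed.

Lemma smooth_atD V W (f g : V -> W) x :
  smooth_at f x -> smooth_at g x -> smooth_at (fun x => f x + g x) x.
Proof.
move=> [U [oU Ux fU]] [U' [oU' U'x gU']]; exists (U `&` U').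
split; [exact: openI|by []|] => k; apply: CkD; first exact: openI.
  by apply: CkS (fU k) => y [].
by apply: CkS (gU' k) => y [].
Qed.

Lemma smooth_at_sum V W n (f : 'I_n -> V -> W) x :
  (forall i, smooth_at (f i) x) -> smooth_at (fun x => \sum_i f i x) x.
Proof.
move=> sf.
have E (r : seq 'I_n) : smooth_at (fun x => \sum_(i <- r) f i x) x.
  elim: r => [|i r IH].
    by apply: smooth_at_eq (smooth_at_cst 0 x); near=> y; rewrite big_nil.
  by apply: smooth_at_eq (smooth_atD (sf i) IH); near=> y; rewrite big_cons.
exact: E.
Unshelve. all: by end_near. Qed.

Lemma smooth_at_coord V n (f : V -> 'rV[R]_n) x :
  smooth_at f x <-> forall i, smooth_at (fun y => f y 0 i : R^o) x.
Proof.
split=> [[U [oU Ux fU]] i|sf].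
  by exists U; split=> // k; move/(Ck_coord k f oU): (fU k); apply.
have /choice[U UP] := sf.
have : nbhs x [set y | forall i, U i y].
  apply: filter_forall => i; have [oU Ux _] := UP i.
  exact: open_nbhs_nbhs.
rewrite nbhsE => -[U' [oU' U'x] U'U]; exists U'; split=> // k.
apply/Ck_coord => // i; have [_ _ /(_ k)] := UP i.
by apply: CkS => y /U'U; exact.
Qed.

Lemma smooth_at_comp_scalar V n (f : V -> 'rV[R]_n) (g : 'rV[R]_n -> R^o) x :
  smooth_at f x -> smooth_at g (f x) -> smooth_at (g \o f) x.
Proof.
move=> [U [oU Ux fU]] [U' [oU' U'x gU']]; exists (U `&` f @^-1` U').
have o : open (U `&` f @^-1` U').
  rewrite openE => y [Uy U'y]; apply: filterI; first exact: open_nbhs_nbhs.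
  have /= cf := fU 0%N y Uy; apply: cf; exact: open_nbhs_nbhs.
split=> // k; apply: (@Ck_comp_scalar _ _ _ _ U') => //; first by move=> y [].
by apply: CkS (fU k) => y [].
Qed.

Lemma smooth_at_comp V n p (f : V -> 'rV[R]_n) (g : 'rV[R]_n -> 'rV[R]_p) x :
  smooth_at f x -> smooth_at g (f x) -> smooth_at (g \o f) x.
Proof.
move=> sf sg; apply/smooth_at_coord => i.
exact: (@smooth_at_comp_scalar _ _ f (fun z => g z 0 i) x sf
  ((smooth_at_coord g (f x)).1 sg i)).
Qed.

End smooth_at_theory.

Section derive_functions.
Context {R : realType} {V W : normedModType R}.
Implicit Types (x v : V).

Lemma differentiable_subf (f g : V -> W) x :
  differentiable f x -> differentiable g x ->
  differentiable (fun y => f y - g y) x.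
Proof. exact: differentiableB. Qed.

Lemma derive_addf (f g : V -> W) x v :
  differentiable f x -> differentiable g x ->
  'D_v (fun y => f y + g y) x = 'D_v f x + 'D_v g x.
Proof. by move=> df dg; apply: deriveD; exact: diff_derivable. Qed.

Lemma derive_subf (f g : V -> W) x v :
  differentiable f x -> differentiable g x ->
  'D_v (fun y => f y - g y) x = 'D_v f x - 'D_v g x.
Proof. by move=> df dg; apply: deriveB; exact: diff_derivable. Qed.

Lemma derive_mulf (f g : V -> R^o) x v :
  differentiable f x -> differentiable g x ->
  'D_v (fun y => f y * g y : R^o) x = f x * 'D_v g x + g x * 'D_v f x.
Proof. by move=> df dg; apply: deriveM; exact: diff_derivable. Qed.

Lemma differentiable_mulf (f g : V -> R^o) x :
  differentiable f x -> differentiable g x ->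
  differentiable (fun y => f y * g y : R^o) x.
Proof. exact: differentiableM. Qed.

Lemma derive_sumf n (f : 'I_n -> V -> W) x v :
  (forall i, differentiable (f i) x) ->
  'D_v (fun y => \sum_i f i y) x = \sum_i 'D_v (f i) x.
Proof.
move=> df.
have E : (fun y => \sum_i f i y) = \sum_i f i.
  by apply/funext => y; rewrite fct_sumE.
by rewrite E; apply: derive_sum => i; exact: diff_derivable.
Qed.

Lemma derive_translate (f : V -> W) (a x u : V) :
  'D_u (f \o +%R^~ a) x = 'D_u f (x + a).
Proof.
rewrite /derive (_ : (fun h : R => h^-1 *: ((f \o +%R^~ a) (h *: u + x) -
    (f \o +%R^~ a) x)) =
  (fun h : R => h^-1 *: (f (h *: u + (x + a)) - f (x + a))))//.
by apply/funext => h /=; rewrite addrA.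
Qed.

Lemma continuous_near_dist (f : V -> W) x (e : R) :
  {for x, continuous f} -> 0 < e -> \forall y \near x, `|f x - f y| < e.
Proof. by move=> /cvgrPdist_lt; apply. Qed.

(** Triangle inequality. In [derive_swap], [a] and [b] are the two mixed derivatives at a point and
    [c] a common value close to both. *)
Lemma dist_half_absurd (a b c : W) :
  `|a - c| < `|a - b| / 2 -> `|b - c| < `|a - b| / 2 -> False.
Proof.
move=> ac bc; have := ltrD ac bc; rewrite -splitr (distrC b) ltNge.
by rewrite (le_trans _ (ler_normD _ _))// addrA subrK.
Qed.

End derive_functions.

(** * Symmetry of second derivatives *)

Section schwarz.
Context {R : realType} {V : normedModType R}.

Lemma is_derive_line (f : V -> R^o) (x u : V) (t : R) :
  differentiable f (x + t *: u) ->
  is_derive t (1 : R) (fun s : R => f (x + s *: u) : R) ('D_u f (x + t *: u)).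
Proof.
move=> df; have E : (fun h : R => h^-1 *: (f (x + (h *: (1 : R) + t) *: u) - f (x + t *: u)))
   = (fun h : R => h^-1 *: (f (h *: u + (x + t *: u)) - f (x + t *: u))).
  apply/funext => h; congr (_ *: (f _ - _)).
  by rewrite scalerDl addrCA [h *: 1]mulr1.
have := @diff_derivable _ _ _ f _ u df; rewrite /derivable -E => cf.
by split; [exact: cf|rewrite /derive E].
Qed.

Lemma mean_value_line (f : V -> R^o) (x u : V) (s : R) : 0 < s ->
  (forall t, t \in `[0, s] -> differentiable f (x + t *: u)) ->
  exists2 c, c \in `[0, s] & f (x + s *: u) - f x = s * 'D_u f (x + c *: u).
Proof.
move=> s0 df; have := @MVT R (fun t => f (x + t *: u))
  (fun t => 'D_u f (x + t *: u)) 0 s s0.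
case=> [t t0s||c cs].
- apply: is_derive_line; apply: df.
  by move: t0s; rewrite !in_itv/= => /andP[/ltW-> /ltW->].
- apply: derivable_within_continuous => t t0s.
  by have [] := is_derive_line (df _ t0s).
rewrite scale0r addr0 subr0 mulrC => E; exists c => //.
by move: cs; rewrite !in_itv/= => /andP[/ltW-> /ltW->].
Qed.

(** The mean value theorem is used twice: along [u] for the increment [f (y + s v) - f y], then
    along [v] for ['D_u f]. The left side is symmetric in [u] and [v], while the right side names
    one order of differentiation. *)
Lemma second_difference (f : V -> R^o) (x u v : V) (s : R) : 0 < s ->
  (forall a b, a \in `[0, s] -> b \in `[0, s] ->
    differentiable f (x + a *: u + b *: v) /\
    differentiable ('D_u f) (x + a *: u + b *: v)) ->
  exists c d, [/\ c \in `[0, s], d \in `[0, s] &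
    f (x + s *: u + s *: v) - f (x + s *: u) - (f (x + s *: v) - f x) =
    s * (s * 'D_v ('D_u f) (x + c *: u + d *: v))].
Proof.
move=> s0 df; pose g y : R^o := (f \o +%R^~ (s *: v)) y - f y.
have sI : s \in `[0, s] by rewrite in_itv/= lexx ltW.
have zI : 0 \in `[0, s] by rewrite in_itv/= lexx ltW.
have d0 t : t \in `[0, s] -> differentiable f (x + t *: u).
  by move=> tI; have [] := df t 0 tI zI; rewrite scale0r addr0.
have ds t : t \in `[0, s] -> differentiable (f \o +%R^~ (s *: v)) (x + t *: u).
  move=> tI; apply: differentiable_comp; last by have [] := df t s tI sI.
  by apply: differentiableD => //; exact: differentiable_cst.
have dg t : t \in `[0, s] -> differentiable g (x + t *: u).
  by move=> tI; apply: differentiable_subf; [exact: ds|exact: d0].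
have [c cI cE] := mean_value_line s0 dg.
have Dg : 'D_u g (x + c *: u) =
    'D_u f (x + c *: u + s *: v) - 'D_u f (x + c *: u).
  rewrite -(derive_translate f (s *: v)).
  exact: derive_subf (ds _ cI) (d0 _ cI).
have [d dI dE] := @mean_value_line ('D_u f) (x + c *: u) v s s0
  (fun t tI => (df c t cI tI).2).
by exists c, d; split=> //; rewrite -dE -Dg -cE.
Qed.

(** If the two mixed derivatives differed at [x], they would stay apart near [x] by continuity; yet
    the second difference over a small parallelogram equates a value of one with a value of the
    other. *)
Lemma derive_swap (f : V -> R^o) (x u v : V) :
  smooth_at f x -> 'D_u ('D_v f) x = 'D_v ('D_u f) x.
Proof.
move=> sf; apply/eqP/negPn/negP => neq.
pose e := `|'D_u ('D_v f) x - 'D_v ('D_u f) x| / 2.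
have e0 : 0 < e by rewrite divr_gt0// normr_gt0 subr_eq0.
have near_u := smooth_at_continuous (smooth_at_derive u (smooth_at_derive v sf)).
have near_v := smooth_at_continuous (smooth_at_derive v (smooth_at_derive u sf)).
have : \forall y \near x, [/\ smooth_at f y,
   `|'D_u ('D_v f) x - 'D_u ('D_v f) y| < e &
   `|'D_v ('D_u f) x - 'D_v ('D_u f) y| < e].
  exact: filterS3 (fun y a b c => And3 a b c) (smooth_at_near sf)
    (continuous_near_dist near_u e0) (continuous_near_dist near_v e0).
move=> /nbhs_ballP[r /= r0 xr].
(* The side length is such that [s * (|u| + |v| + 1) = r / 2], which keeps the whole parallelogram
   in the ball; the summand 1 keeps the denominator positive. *)
pose s := r / 2 / (`|u| + `|v| + 1).
have n0 : 0 < `|u| + `|v| + 1 by rewrite ltr_wpDl// addr_ge0.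
have s0 : 0 < s by rewrite !divr_gt0.
have inb a b : a \in `[0, s] -> b \in `[0, s] -> ball x r (x + a *: u + b *: v).
  rewrite !in_itv/= => /andP[a0 aS] /andP[b0 bS].
  rewrite -ball_normE /ball_/= -addrA opprD addNKr normrN.
  apply: le_lt_trans (ler_normD _ _) _; rewrite !normrZ !ger0_norm//.
  apply: (@le_lt_trans _ _ (s * (`|u| + `|v| + 1))).
    rewrite mulrDr mulr1 mulrDr -[leLHS]addr0; apply: lerD; last exact: ltW.
    by apply: lerD; exact: ler_wpM2r.
  by rewrite divfK ?gt_eqF// ltr_pdivrMr// ltr_pMr// ltr1n.
have [|c [d [cI dI E1]]] := @second_difference f x u v s s0.
  move=> a b aI bI; have [sy _ _] := xr _ (inb _ _ aI bI).
  by split; apply: smooth_at_differentiable => //; exact: smooth_at_derive.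
have [|c' [d' [cI' dI' E2]]] := @second_difference f x v u s s0.
  move=> a b aI bI; have [sy _ _] := xr _ (inb _ _ bI aI).
  rewrite addrAC.
  by split; apply: smooth_at_differentiable => //; exact: smooth_at_derive.
have E : 'D_v ('D_u f) (x + c *: u + d *: v) =
         'D_u ('D_v f) (x + c' *: v + d' *: u).
  have sN0 := lt0r_neq0 s0.
  apply: (mulfI sN0); apply: (mulfI sN0).
  apply: etrans (esym E1) (etrans _ E2).
  rewrite [x + s *: v + _]addrAC.
  rewrite !opprB !addrA [LHS]addrAC [RHS]addrAC; congr (_ + _).
  exact: addrAC.
have [_ _ h2] := xr _ (inb _ _ cI dI).
have [_ h1 _] := xr _ (inb _ _ dI' cI').
by rewrite E addrAC in h2; exact: (dist_half_absurd h1 h2).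
Qed.

End schwarz.

(** * Atlases and tangent vectors *)

Section composable.
Context {R : realType}.

(* The composition rule is proved componentwise, hence only for the codomains
   below; [composable] lets one statement cover scalar and vector functions. *)
Definition composable (W : normedModType R) : Prop :=
  forall m n (f : 'rV[R]_m -> 'rV[R]_n) (g : 'rV[R]_n -> W) x,
    smooth_at f x -> smooth_at g (f x) -> smooth_at (g \o f) x.

Lemma composable_scalar : composable R^o.
Proof. by move=> m n f g x; exact: smooth_at_comp_scalar. Qed.

Lemma composable_row n : composable 'rV[R]_n.
Proof. by move=> m p f g x; exact: smooth_at_comp. Qed.

End composable.

Section compatible_atlas.
Context {R : realType} {M : Type} {d : nat}.
Implicit Types (A : atlas R M d) (c : chart R M d) (p q : M).

(* [is_manifold] without the separation and countability axioms. *)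
Definition compatible A : Prop :=
  [/\ (forall p, exists2 c, A c & cdom c p),
      (forall c, A c -> set_inj (cdom c) c /\ open (c @` cdom c)) &
      (forall c c', A c -> A c' ->
         open (c @` (cdom c `&` cdom c')) /\
         smooth_on (c @` (cdom c `&` cdom c')) (loc c c'))].

Lemma manifold_compatible A : is_manifold A -> compatible A.
Proof. by case. Qed.

Context {A : atlas R M d} (hA : compatible A).

Lemma loc_chart {W : normedModType R} c (g : M -> W) q :
  A c -> cdom c q -> loc c g (c q) = g q.
Proof.
move=> Ac cq; have [_ /(_ _ Ac)[inj _] _] := hA.
rewrite /loc; case: xgetP => [w _ [q' [cq' cE] <-]|nex].
  by congr g; apply: inj => //; exact/mem_set.
by case: (nex (g q)); exists q.
Qed.

Lemma chart_open c : A c -> open (c @` cdom c).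
Proof. by have [_ h _] := hA => /h[]. Qed.

Lemma chart_inj c p q : A c -> cdom c p -> cdom c q -> c p = c q -> p = q.
Proof.
move=> Ac cp cq; have [_ /(_ _ Ac)[inj _] _] := hA.
by apply: inj => //; exact/mem_set.
Qed.

Lemma transition_smooth c c' p : A c -> A c' -> cdom c p -> cdom c' p ->
  smooth_at (loc c c') (c p).
Proof.
move=> Ac Ac' cp c'p; have [_ _ /(_ _ _ Ac Ac')[opn smo]] := hA.
by exists (c @` (cdom c `&` cdom c')); split => //; exists p.
Qed.

(** Since the image of a chart is open, every point near [c p] has the form [c q], where [loc] can
    be evaluated by [loc_chart]. *)
Lemma chart_near c p (P : set 'rV[R]_d) : A c -> cdom c p ->
  (\forall x \near c p, P x) <->
  (\forall x \near c p, forall q, cdom c q -> c q = x -> P (c q)).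
Proof.
move=> Ac cp; split; first by apply: filterS => x Px q _ ->.
have := open_nbhs_nbhs (conj (chart_open Ac) (ex_intro2 _ _ p cp erefl)).
by apply: filterS2 => x [q cq <-]; exact.
Qed.

Lemma mnbhs_transition c c' p (P : set 'rV[R]_d) :
  A c -> A c' -> cdom c p -> cdom c' p -> (\forall x \near c' p, P x) ->
  \forall x \near c p, forall q, cdom c q -> c q = x -> cdom c' q /\ P (c' q).
Proof.
move=> Ac Ac' cp c'p nP; have [_ _ /(_ _ _ Ac Ac')[opn smo]] := hA.
have nI := open_nbhs_nbhs (conj opn (ex_intro2 _ _ p (conj cp c'p) erefl)).
have nL : \forall x \near c p, P (loc c c' x).
  apply: (smooth_at_continuous (transition_smooth Ac Ac' cp c'p)).
  by rewrite loc_chart.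
apply: filterS2 nL nI => x Px [q' [cq' c'q'] q'x] q cq qx.
have E : q = q' by apply: (chart_inj Ac) => //; rewrite qx.
by rewrite E; split=> //; move: Px; rewrite /= -q'x loc_chart.
Qed.

(** Neighbourhoods are defined through some chart; continuity of the transition maps allows any
    chart around [p] instead. *)
Lemma mnbhsP c p (P : set M) : A c -> cdom c p ->
  mnbhs A p P <-> \forall x \near c p, forall q, cdom c q -> c q = x -> P q.
Proof.
move=> Ac cp; split=> [[c' [U [Ac' c'p [oU Up UE] UP]]]|].
  have := mnbhs_transition Ac Ac' cp c'p (open_nbhs_nbhs (conj oU Up)).
  apply: filterS => x Px q cq qx; have [c'q Uq] := Px q cq qx; exact: UP.
move=> nP; have : nbhs (c p) [set x | forall q, cdom c q -> c q = x -> P q] by [].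
rewrite nbhsE => -[U [oU Up] UP].
exists c, (U `&` c @` cdom c); split => //.
  split; first exact/openI/chart_open.
    by split=> //; exists p.
  by move=> x [].
by move=> q cq [/UP/(_ q cq erefl)].
Qed.

Lemma mnbhs_near p (P Q : set M) : mnbhs A p P -> mnbhs A p Q ->
  mnbhs A p (P `&` Q).
Proof.
have [c Ac cp] : exists2 c, A c & cdom c p by case: hA.
move=> /(mnbhsP _ Ac cp) hP /(mnbhsP _ Ac cp) hQ; apply/(mnbhsP _ Ac cp).
by apply: filterS2 hP hQ => x Px Qx q cq qx; split; [exact: Px|exact: Qx].
Qed.

Lemma mnbhsS p (P Q : set M) : P `<=` Q -> mnbhs A p P -> mnbhs A p Q.
Proof.
move=> PQ [c [U [Ac cp UE UP]]]; exists c, U; split=> // q cq Uq.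
exact/PQ/UP.
Qed.

Lemma mnbhs_chart c p : A c -> cdom c p -> mnbhs A p (cdom c).
Proof. by move=> Ac cp; apply/(mnbhsP _ Ac cp); near=> x. Unshelve. all: by end_near. Qed.

Lemma mnbhs_self p (P : set M) : mnbhs A p P -> P p.
Proof. by move=> [c [U [Ac cp [_ Up _] UP]]]; exact: UP. Qed.

Lemma mnbhs_mnbhs p (P : set M) : mnbhs A p P -> mnbhs A p (fun q => mnbhs A q P).
Proof.
move=> [c [U [Ac cp [oU Up UE] UP]]]; exists c, U; split=> // q cq Uq.
by exists c, U.
Qed.

Lemma near_loc {W : normedModType R} c p (F : M -> W) (G : 'rV[R]_d -> W) :
  A c -> cdom c p -> mnbhs A p [set q | F q = G (c q)] ->
  \forall x \near c p, loc c F x = G x.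
Proof.
move=> Ac cp /(mnbhsP _ Ac cp) FG; apply/(chart_near _ Ac cp).
by apply: filterS FG => x FG q cq qx; rewrite /= loc_chart// (FG q).
Qed.

Lemma derive_loc {W : normedModType R} c p (F : M -> W) (G : 'rV[R]_d -> W) u :
  A c -> cdom c p -> mnbhs A p [set q | F q = G (c q)] ->
  'D_u (loc c F) (c p) = 'D_u G (c p).
Proof. by move=> Ac cp FG; apply: near_eq_derive; exact: near_loc. Qed.

Lemma loc_smooth {W : normedModType R} c p (F : M -> W) (G : 'rV[R]_d -> W) :
  A c -> cdom c p -> mnbhs A p [set q | F q = G (c q)] ->
  smooth_at G (c p) -> smooth_at (loc c F) (c p).
Proof.
move=> Ac cp FG; apply: smooth_at_eq; apply: filterS (near_loc Ac cp FG) => x.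
by move->.
Qed.

(** In a second chart the expression of [g] is the first one composed with a transition map; hence
    the assumption that smoothness into [W] is stable under composition. *)
Lemma smooth_nearP {W : normedModType R} (hW : composable W) c p (g : M -> W) :
  A c -> cdom c p -> smooth_near A p g <-> smooth_at (loc c g) (c p).
Proof.
move=> Ac cp; split=> [[c' [U [Ac' c'p [oU Up UE] sg]]]|].
  have s' : smooth_at (loc c' g) (c' p) by exists U.
  have st := transition_smooth Ac Ac' cp c'p.
  rewrite -(loc_chart c' Ac cp) in s'.
  apply: loc_smooth (Ac) (cp) _ (hW _ _ _ _ _ st s').
  apply: mnbhsS (mnbhs_near (mnbhs_chart Ac cp) (mnbhs_chart Ac' c'p)).
  by move=> q [cq c'q] /=; rewrite !loc_chart.
move=> [U [oU Up sU]]; exists c, (U `&` c @` cdom c); split=> //.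
  split; first exact/openI/chart_open.
    by split=> //; exists p.
  by move=> x [].
by move=> k; apply: CkS (sU k) => x [].
Qed.

Lemma smooth_near_chart c p : A c -> cdom c p -> smooth_near A p c.
Proof.
by move=> Ac cp; apply/(smooth_nearP (@composable_row _ _) _ Ac cp)/transition_smooth.
Qed.

Lemma coordvecE c p u (g : M -> R^o) :
  smooth_near A p g -> coordvec A c p u g = 'D_u (loc c g) (c p).
Proof. by move=> sg; rewrite /coordvec asboolT. Qed.

Lemma loc_differentiable c p (g : M -> R^o) : A c -> cdom c p ->
  smooth_near A p g -> differentiable (loc c g) (c p).
Proof.
by move=> Ac cp /(smooth_nearP composable_scalar _ Ac cp)/smooth_at_differentiable.
Qed.

(** The chain rule for a function that factors through [f] near [p]. With [f] a chart it gives the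
    change of charts and the values on coordinates; with [f] a smooth map read in a chart, the
    tangent map. *)
Lemma coordvec_comp c p u n (f : M -> 'rV[R]_n) (G : 'rV[R]_n -> R^o) g :
  A c -> cdom c p -> smooth_near A p f -> smooth_at G (f p) ->
  mnbhs A p [set q | g q = G (f q)] ->
  coordvec A c p u g = 'D_('D_u (loc c f) (c p)) G (f p).
Proof.
move=> Ac cp sf sG gG.
have {}sf := (smooth_nearP (@composable_row _ _) f Ac cp).1 sf.
have lf : loc c f (c p) = f p by rewrite loc_chart.
have gG' : mnbhs A p [set q | g q = (G \o loc c f) (c q)].
  apply: mnbhsS (mnbhs_near gG (mnbhs_chart Ac cp)) => q [/= -> cq].
  by rewrite loc_chart.
rewrite -lf in sG.
rewrite coordvecE; last first.
  apply/(smooth_nearP composable_scalar _ Ac cp).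
  by apply: loc_smooth gG' _ => //; exact: composable_scalar.
rewrite (derive_loc _ Ac cp gG') derive_comp ?lf//; rewrite -?lf;
  exact: smooth_at_differentiable.
Qed.

Lemma coordvec_change c c' p u : A c -> A c' -> cdom c p -> cdom c' p ->
  coordvec A c' p u = coordvec A c p ('D_u (loc c' c) (c' p)).
Proof.
move=> Ac Ac' cp c'p; apply/funext => g.
(* On functions not smooth near [p] both sides are 0 by the convention in [coordvec]. *)
have [sg|nsg] := pselect (smooth_near A p g); last first.
  by rewrite /coordvec !asboolF.
rewrite [RHS]coordvecE//; apply: coordvec_comp => //.
- exact: smooth_near_chart.
- exact/(smooth_nearP composable_scalar _ Ac cp).
- by apply: mnbhsS (mnbhs_chart Ac cp) => q cq; rewrite /= loc_chart.
Qed.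

Lemma coordvec_linear c p a u v : A c -> cdom c p ->
  coordvec A c p (a *: u + v) = a *: coordvec A c p u + coordvec A c p v.
Proof.
move=> Ac cp; apply/funext => g.
have [sg|nsg] := pselect (smooth_near A p g); last first.
  by rewrite !fctE /coordvec !asboolF// scaler0 addr0.
rewrite !fctE !coordvecE//; have dg := loc_differentiable Ac cp sg.
by rewrite !(deriveE _ dg) linearP.
Qed.

Lemma coordvec0 c p : A c -> cdom c p -> coordvec A c p 0 = 0.
Proof.
move=> Ac cp; have := coordvec_linear (-1) 0 0 Ac cp.
by rewrite scaler0 addr0 scaleN1r addNr.
Qed.

Lemma coordvec_sum c p u : A c -> cdom c p ->
  coordvec A c p u = \sum_i u 0 i *: dcoord A c p i.
Proof.
move=> Ac cp; rewrite {1}(row_sum_delta u); elim/big_rec2: _.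
  exact: coordvec0.
by move=> i _ v _ <-; rewrite -coordvec_linear.
Qed.

Lemma coordvec_coord c p u i : A c -> cdom c p ->
  coordvec A c p u (fun q => c q 0 i) = u 0 i.
Proof.
move=> Ac cp; rewrite (@coordvec_comp _ _ _ _ c (@coordf R d i))//.
- rewrite (derive_loc (G := id)) ?derive_id//; last first.
    by apply: mnbhsS (mnbhs_chart Ac cp) => q cq.
  rewrite deriveE ?(diff_lin _ (@continuous_coordf R d i))//.
  exact/linear_differentiable/continuous_coordf.
- exact: smooth_near_chart.
- exact/smooth_at_linear/continuous_coordf.
- exact: mnbhsS (mnbhs_chart Ac cp).
Qed.

Lemma coordvec_inj c p u v : A c -> cdom c p ->
  coordvec A c p u = coordvec A c p v -> u = v.
Proof.
move=> Ac cp uv; apply/rowP => i.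
by rewrite -(coordvec_coord u i Ac cp) uv coordvec_coord.
Qed.

Lemma tangentP c p v : A c -> cdom c p ->
  tangent A p v <-> exists u, v = coordvec A c p u.
Proof.
move=> Ac cp; split=> [[c' [u [Ac' c'p ->]]]|[u ->]]; last by exists c, u.
by eexists; exact: coordvec_change.
Qed.

Lemma tangent_linear p a v w :
  tangent A p v -> tangent A p w -> tangent A p (a *: v + w).
Proof.
have [c Ac cp] : exists2 c, A c & cdom c p by case: hA.
move=> /(tangentP _ Ac cp)[u ->] /(tangentP _ Ac cp)[u' ->].
by apply/(tangentP _ Ac cp); exists (a *: u + u'); rewrite coordvec_linear.
Qed.

Lemma tangent_coordvec c p u : A c -> cdom c p -> tangent A p (coordvec A c p u).
Proof. by move=> Ac cp; exists c, u. Qed.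

Lemma linear_on_sum c p (phi : functional R M -> R^o) u : A c -> cdom c p ->
  linear_on A p phi ->
  phi (coordvec A c p u) = \sum_i u 0 i * phi (dcoord A c p i).
Proof.
move=> Ac cp lphi.
have L a u1 u2 : phi (coordvec A c p (a *: u1 + u2)) =
    a *: phi (coordvec A c p u1) + phi (coordvec A c p u2).
  rewrite coordvec_linear// lphi//; try exact: tangent_coordvec.
  by apply: tangent_linear; exact: tangent_coordvec.
have phi0 : phi (coordvec A c p 0) = 0.
  have := L (-1) 0 0; rewrite scaler0 addr0 scaleN1r => E.
  by rewrite E addNr.
rewrite {1}(row_sum_delta u); elim/big_rec2: _ => // i _ v _ <-.
exact: L.
Qed.

Lemma linear_onP c p (phi : functional R M -> R^o) : A c -> cdom c p ->
  linear_on A p phi <->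
  exists L : 'rV[R]_d, forall u, phi (coordvec A c p u) = \sum_i u 0 i * L 0 i.
Proof.
move=> Ac cp; split=> [lphi|[L E]].
  exists (\row_i phi (dcoord A c p i)) => u; rewrite (linear_on_sum _ Ac cp)//.
  by apply: eq_bigr => i _; rewrite mxE.
move=> a _ _ /(tangentP _ Ac cp)[u ->] /(tangentP _ Ac cp)[v ->] _.
rewrite -(coordvec_linear a u v Ac cp) !E.
rewrite [a *: _](_ : _ = a * \sum_i u 0 i * L 0 i) // mulr_sumr -big_split/=.
by apply: eq_bigr => i _; rewrite !mxE mulrDl -mulrA.
Qed.

End compatible_atlas.

(** * Smooth maps and product atlases *)

Lemma smooth_on_local {R : realType} {V W : normedModType R} (U : set V)
    (f : V -> W) :
  (forall x, U x -> smooth_at f x) -> smooth_on U f.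
Proof.
move=> + k; elim: k f => [|k IH] f sf /=.
  by move=> x /sf/smooth_at_continuous.
split=> [x /sf/smooth_at_differentiable//|v].
by apply: IH => x /sf; exact: smooth_at_derive.
Qed.

Section row_blocks.
Context {R : realType}.

Lemma smooth_at_id n (x : 'rV[R]_n) : smooth_at id x.
Proof. by apply: (@smooth_at_linear _ _ _ (@idfun 'rV[R]_n)) => y; exact: cvg_id. Qed.

Lemma smooth_at_lsubmx m n (x : 'rV[R]_(m + n)) : smooth_at lsubmx x.
Proof. exact/smooth_at_linear/continuous_lsubmx. Qed.

Lemma smooth_at_rsubmx m n (x : 'rV[R]_(m + n)) : smooth_at rsubmx x.
Proof. exact/smooth_at_linear/continuous_rsubmx. Qed.

Lemma derive_lsubmx m n (x u : 'rV[R]_(m + n)) : 'D_u lsubmx x = lsubmx u.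
Proof.
by rewrite deriveE ?(diff_lin _ (@continuous_lsubmx _ _ _ _))//;
  exact: differentiable_lsubmx.
Qed.

Lemma derive_rsubmx m n (x u : 'rV[R]_(m + n)) : 'D_u rsubmx x = rsubmx u.
Proof.
by rewrite deriveE ?(diff_lin _ (@continuous_rsubmx _ _ _ _))//;
  exact: differentiable_rsubmx.
Qed.

Context {V : normedModType R}.

Lemma smooth_at_row_mx m n (f : V -> 'rV[R]_m) (g : V -> 'rV[R]_n) x :
  smooth_at f x -> smooth_at g x -> smooth_at (fun y => row_mx (f y) (g y)) x.
Proof.
move=> /smooth_at_coord sf /smooth_at_coord sg; apply/smooth_at_coord => i.
case: (split_ordP i) => j ->.
  apply: smooth_at_eq (sf j).
  by apply: nearW => y; rewrite row_mxEl.
apply: smooth_at_eq (sg j).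
by apply: nearW => y; rewrite row_mxEr.
Qed.

Lemma derive_row_mx m n (f : V -> 'rV[R]_m) (g : V -> 'rV[R]_n) x v :
  smooth_at f x -> smooth_at g x ->
  'D_v (fun y => row_mx (f y) (g y)) x = row_mx ('D_v f x) ('D_v g x).
Proof.
move=> sf sg; apply/rowP => i.
rewrite derive_coord; last exact/smooth_at_differentiable/smooth_at_row_mx.
case: (split_ordP i) => j ->.
  rewrite row_mxEl derive_coord; last exact/smooth_at_differentiable.
  by congr ('D_v _ x); apply/funext => y; rewrite /= /coordf row_mxEl.
rewrite row_mxEr derive_coord; last exact/smooth_at_differentiable.
by congr ('D_v _ x); apply/funext => y; rewrite /= /coordf row_mxEr.
Qed.

End row_blocks.

(** Smoothness of transition maps on a whole overlap is local, so it may be checked with a separate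
    neighbourhood at each point. *)
Lemma compatible_intro {R : realType} {M : Type} {d : nat} (A : atlas R M d) :
  (forall p, exists2 c, A c & cdom c p) ->
  (forall c p q, A c -> cdom c p -> cdom c q -> c p = c q -> p = q) ->
  (forall c, A c -> open (c @` cdom c)) ->
  (forall c c', A c -> A c' -> open (c @` (cdom c `&` cdom c'))) ->
  (forall c c' p, A c -> A c' -> cdom c p -> cdom c' p ->
    smooth_at (loc c c') (c p)) ->
  compatible A.
Proof.
move=> cov inj opn opn2 smo; split=> // [c Ac|c c' Ac Ac'].
  split; last exact: opn.
  by move=> p q /set_mem cp /set_mem cq; exact: inj.
by split; [exact: opn2|apply: smooth_on_local => _ [p [cp c'p] <-]; exact: smo].
Qed.

(** Takes the place of [loc_chart] while the compatibility of an atlas is still being established: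
    injectivity at the one point determines the chosen value. *)
Lemma loc_inj {R : realType} {M : Type} {d : nat} {W : normedModType R}
    (c : chart R M d) (g : M -> W) p :
  (forall q, cdom c q -> c q = c p -> q = p) -> cdom c p -> loc c g (c p) = g p.
Proof.
move=> inj cp; rewrite /loc; case: xgetP => [w _ [q [cq /(inj _ cq) ->] <-]//|nex].
by case: (nex (g p)); exists p.
Qed.

Section smooth_maps.
Context {R : realType} {M M' : Type} {d d' : nat}.
Context {A : atlas R M d} {B : atlas R M' d'}.
Hypotheses (hA : compatible A) (hB : compatible B).

Definition smooth_map_at (A : atlas R M d) (B : atlas R M' d')
    (f : M -> M') (p : M) : Prop :=
  exists c', [/\ B c', cdom c' (f p), mnbhs A p (f @^-1` cdom c') &
    smooth_near A p (c' \o f)].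

Implicit Types (f : M -> M').

Lemma smooth_map_loc f p c' : B c' -> mnbhs A p (f @^-1` cdom c') ->
  forall c, A c -> cdom c p ->
  mnbhs A p [set q | [/\ cdom c q, cdom c' (f q) & loc c (c' \o f) (c q) = c' (f q)]].
Proof.
move=> Bc' nf c Ac cp; apply: mnbhsS (mnbhs_near hA nf (mnbhs_chart hA Ac cp)).
by move=> q [/= c'q cq]; rewrite (loc_chart hA).
Qed.

Lemma smooth_map_nbhs f p P :
  smooth_map_at A B f p -> mnbhs B (f p) P -> mnbhs A p (f @^-1` P).
Proof.
move=> [c' [Bc' c'p nf sf]] /(mnbhsP hB _ Bc' c'p) nP.
have [c Ac cp] : exists2 c, A c & cdom c p by case: hA.
have /smooth_at_continuous cf :=
  (smooth_nearP hA (@composable_row _ _) _ Ac cp).1 sf.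
have {}nP : \forall x \near c p,
    forall q, cdom c' q -> c' q = loc c (c' \o f) x -> P q.
  apply: (cf [set y | forall q, cdom c' q -> c' q = y -> P q]).
  by rewrite (loc_chart hA).
have nP' : mnbhs A p [set q | forall q', cdom c' q' ->
    c' q' = loc c (c' \o f) (c q) -> P q'].
  apply/(mnbhsP hA _ Ac cp); apply: filterS nP => x xP q cq qx.
  by rewrite /= qx; exact: xP.
apply: mnbhsS (mnbhs_near hA nP' (smooth_map_loc Bc' nf Ac cp)) => q /=.
by move=> [qP [cq c'q E]]; exact: qP.
Qed.

Lemma smooth_near_comp {W : normedModType R} (hW : composable W) f p (g : M' -> W) :
  smooth_map_at A B f p -> smooth_near B (f p) g -> smooth_near A p (g \o f).
Proof.
move=> [c' [Bc' c'p nf sf]] /(smooth_nearP hB hW _ Bc' c'p) sg.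
have [c Ac cp] : exists2 c, A c & cdom c p by case: hA.
apply/(smooth_nearP hA hW _ Ac cp).
have {}sf := (smooth_nearP hA (@composable_row _ _) _ Ac cp).1 sf.
rewrite -[c' (f p)]/((c' \o f) p) -(loc_chart hA (c' \o f) Ac cp) in sg.
apply: (loc_smooth hA Ac cp _ (hW _ _ _ _ _ sf sg)).
apply: mnbhsS (smooth_map_loc Bc' nf Ac cp) => q [cq c'q E] /=.
by rewrite E (loc_chart hB).
Qed.

(** The chart in [smooth_map_at] is existentially quantified; this replaces it by any chart around
    [f p]. *)
Lemma smooth_map_chart f p c' : smooth_map_at A B f p -> B c' ->
  cdom c' (f p) -> mnbhs A p (f @^-1` cdom c') /\ smooth_near A p (c' \o f).
Proof.
move=> sf Bc' c'p; split.
  exact: smooth_map_nbhs sf (mnbhs_chart hB Bc' c'p).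
have h := smooth_near_comp (@composable_row R d') sf (smooth_near_chart hB Bc' c'p).
exact: h.
Qed.

(** [tmap] is precomposition with [f], cut off by a test that looks at [g] and not at the vector,
    hence linear on all functionals. *)
Lemma tmap_linear (f : M -> M') p a v w :
  tmap B f p (a *: v + w) = a *: tmap B f p v + tmap B f p w.
Proof.
apply/funext => g; rewrite !fctE /tmap; case: asboolP => // _.
by rewrite scaler0 addr0.
Qed.

Lemma tmap_coordvec f p c c' u : smooth_map_at A B f p ->
  A c -> cdom c p -> B c' -> cdom c' (f p) ->
  tmap B f p (coordvec A c p u) =
  coordvec B c' (f p) ('D_u (loc c (c' \o f)) (c p)).
Proof.
move=> sf Ac cp Bc' c'p; apply/funext => g; rewrite /tmap.
case: asboolP => sg; last by rewrite /coordvec asboolF.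
have [nf sf'] := smooth_map_chart sf Bc' c'p.
rewrite [RHS]coordvecE//; apply: (coordvec_comp hA _ Ac cp sf').
  exact/(smooth_nearP hB composable_scalar).
by apply: mnbhsS nf => q c'q /=; rewrite (loc_chart hB).
Qed.

Lemma tangent_tmap f p v : smooth_map_at A B f p -> tangent A p v ->
  tangent B (f p) (tmap B f p v).
Proof.
move=> sf [c [u [Ac cp ->]]].
have [c' Bc' c'p] : exists2 c', B c' & cdom c' (f p) by case: hB.
by rewrite (tmap_coordvec _ sf Ac cp Bc' c'p); exact: tangent_coordvec.
Qed.

Lemma tangent_smooth p v (g : M -> R^o) :
  tangent A p v -> ~ smooth_near A p g -> v g = 0.
Proof. by move=> [c [u [Ac cp ->]]] ng; rewrite /coordvec asboolF. Qed.

Lemma linear_on_tmap f p (phi : functional R M' -> R^o) :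
  smooth_map_at A B f p -> linear_on B (f p) phi ->
  linear_on A p (phi \o tmap B f p).
Proof.
move=> sf lphi a v w Tv Tw Tavw /=; rewrite tmap_linear lphi//;
  try exact: tangent_tmap.
by rewrite -tmap_linear; exact: tangent_tmap.
Qed.

End smooth_maps.

Section smooth_maps_category.
Context {R : realType} {M M' M'' : Type} {d d' d'' : nat}.
Context {A : atlas R M d} {B : atlas R M' d'} {C : atlas R M'' d''}.
Hypotheses (hA : compatible A) (hB : compatible B) (hC : compatible C).

Lemma smooth_map_at_comp (f : M -> M') (g : M' -> M'') p :
  smooth_map_at A B f p -> smooth_map_at B C g (f p) ->
  smooth_map_at A C (g \o f) p.
Proof.
move=> sf [c [Cc cgf ng sg]]; exists c; split=> //.
  exact: (smooth_map_nbhs hA hB sf ng).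
exact: (smooth_near_comp hA hB (@composable_row _ _) sf sg).
Qed.

Lemma smooth_map_at_id p : smooth_map_at A A id p.
Proof.
have [c Ac cp] : exists2 c, A c & cdom c p by case: hA.
by exists c; split=> //; [exact: mnbhs_chart|exact: smooth_near_chart].
Qed.

(** Stated for every [W], as it is applied to the matrix-valued constant [symplectic_mx]; the
    neighbourhood is therefore exhibited directly rather than through [smooth_nearP]. *)
Lemma smooth_near_cst {W : normedModType R} p (w : W) : smooth_near A p (fun=> w).
Proof.
have [c Ac cp] : exists2 c, A c & cdom c p by case: hA.
have [U [oU Up sU]] : smooth_at (loc c (fun=> w)) (c p).
  apply: (loc_smooth hA Ac cp _ (smooth_at_cst w _)).
  exact: mnbhsS (mnbhs_chart hA Ac cp).
exists c, (U `&` c @` cdom c); split=> //.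
  split; first exact/openI/(chart_open hA).
    by split=> //; exists p.
  by move=> x [].
by move=> k; apply: CkS (sU k) => x [].
Qed.

Lemma smooth_map_at_cst (x : M') p : smooth_map_at A B (fun=> x) p.
Proof.
have [c Ac cp] : exists2 c, A c & cdom c p by case: hA.
have [c' Bc' c'x] : exists2 c', B c' & cdom c' x by case: hB.
exists c'; split=> //; first by apply: mnbhsS (mnbhs_chart hA Ac cp).
exact: smooth_near_cst.
Qed.

Lemma tmap_id p v : tangent A p v -> tmap A id p v = v.
Proof.
move=> Tv; apply/funext => g; rewrite /tmap; case: asboolP => // ng.
by rewrite (tangent_smooth Tv).
Qed.

(** The inner [tmap] tests [h \o g] for smoothness; it passes the test when [h] does, since [g] is
    smooth. *)
Lemma tmap_comp (f : M -> M') (g : M' -> M'') p v :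
  smooth_map_at B C g (f p) ->
  tmap C (g \o f) p v = tmap C g (f p) (tmap B f p v).
Proof.
move=> sg; apply/funext => h; rewrite /tmap; case: asboolP => // sh.
by rewrite asboolT//; exact: (smooth_near_comp hB hC composable_scalar sg sh).
Qed.

End smooth_maps_category.

Section coordinate_expression.
Context {R : realType} {M M' : Type} {d d' : nat}.
Context {A : atlas R M d} {B : atlas R M' d'}.
Hypotheses (hA : compatible A) (hB : compatible B).

Lemma smooth_map_intro (f : M -> M') p c c' (G : 'rV[R]_d -> 'rV[R]_d') :
  A c -> cdom c p -> B c' ->
  mnbhs A p [set q | cdom c' (f q) /\ c' (f q) = G (c q)] ->
  smooth_at G (c p) -> smooth_map_at A B f p.
Proof.
move=> Ac cp Bc' nf sG; exists c'; split=> //.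
- by have [] := mnbhs_self nf.
- by apply: mnbhsS nf => q [].
- apply/(smooth_nearP hA (@composable_row _ _) _ Ac cp).
  by apply: (loc_smooth hA Ac cp _ sG); apply: mnbhsS nf => q [].
Qed.

Lemma tmap_expression (f : M -> M') p c c' (G : 'rV[R]_d -> 'rV[R]_d') u :
  smooth_map_at A B f p -> A c -> cdom c p -> B c' -> cdom c' (f p) ->
  mnbhs A p [set q | c' (f q) = G (c q)] ->
  tmap B f p (coordvec A c p u) = coordvec B c' (f p) ('D_u G (c p)).
Proof.
move=> sf Ac cp Bc' c'p nf.
by rewrite (tmap_coordvec hA hB u sf Ac cp Bc' c'p) (derive_loc hA u Ac cp nf).
Qed.

Lemma smooth_near_expression {W : normedModType R} (hW : composable W) p c
    (g : M -> W) (G : 'rV[R]_d -> W) :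
  A c -> cdom c p -> mnbhs A p [set q | g q = G (c q)] ->
  smooth_at G (c p) -> smooth_near A p g.
Proof.
move=> Ac cp ng sG; apply/(smooth_nearP hA hW _ Ac cp).
exact: (loc_smooth hA Ac cp ng sG).
Qed.

End coordinate_expression.

(** * Product atlases and their projections *)

Section product_atlas.
Context {R : realType} {M M' : Type} {d e : nat}.
Context {A : atlas R M d} {B : atlas R M' e}.
Hypotheses (hA : compatible A) (hB : compatible B).
Let AB := prod_atlas A B.

Lemma image_prod_chart (a : chart R M d) (b : chart R M' e) P Q :
  prod_chart a b @` (P `*` Q) = lsubmx @^-1` (a @` P) `&` rsubmx @^-1` (b @` Q).
Proof.
apply/seteqP; split=> [_ [[p q] [/= Pp Qq] <-]|x [/= [p Pp px] [q Qq qx]]].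
  by rewrite row_mxKl row_mxKr; split; [exists p|exists q].
by exists (p, q) => //=; rewrite px qx hsubmxK.
Qed.

Lemma open_prod (U : set 'rV[R]_d) (V : set 'rV[R]_e) : open U -> open V ->
  open (lsubmx @^-1` U `&` rsubmx @^-1` V : set 'rV[R]_(d + e)).
Proof.
move=> oU oV; apply: openI; apply: open_comp => // x _.
  exact: continuous_lsubmx.
exact: continuous_rsubmx.
Qed.


Lemma prod_compatible : compatible AB.
Proof.
apply: compatible_intro.
- move=> [p q]; have [[a Aa ap] [b Bb bq]] : (exists2 a, A a & cdom a p) /\
    (exists2 b, B b & cdom b q) by case: hA; case: hB.
  by exists (prod_chart a b) => //; exists a, b.
- move=> _ [p q] [p' q'] [a [b [Aa Bb ->]]] [/= ap bq] [/= ap' bq'].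
  move=> /eq_row_mx[] pp qq.
  by rewrite (chart_inj hA Aa ap ap' pp) (chart_inj hB Bb bq bq' qq).
- move=> _ [a [b [Aa Bb ->]]]; rewrite image_prod_chart.
  by apply: open_prod; [exact: (chart_open hA)|exact: (chart_open hB)].
- move=> _ _ [a [b [Aa Bb ->]]] [a' [b' [Aa' Bb' ->]]] /=.
  rewrite -setXI image_prod_chart.
  have [_ _ /(_ _ _ Aa Aa')[oa _]] := hA; have [_ _ /(_ _ _ Bb Bb')[ob _]] := hB.
  exact: open_prod.
- move=> _ _ [p q] [a [b [Aa Bb ->]]] [a' [b' [Aa' Bb' ->]]] [/= ap bq] [/= ap' bq'].
  pose G (x : 'rV[R]_(d + e)) := row_mx (loc a a' (lsubmx x)) (loc b b' (rsubmx x)).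
  have sG : smooth_at G (row_mx (a p) (b q)).
    apply: smooth_at_row_mx.
      apply: (smooth_at_comp (smooth_at_lsubmx _)).
      by rewrite row_mxKl; exact: (transition_smooth hA).
    apply: (smooth_at_comp (smooth_at_rsubmx _)).
    by rewrite row_mxKr; exact: (transition_smooth hB).
  apply: smooth_at_eq sG.
  have : nbhs (row_mx (a p) (b q))
     (lsubmx @^-1` (a @` (cdom a `&` cdom a')) `&` rsubmx @^-1` (b @` (cdom b `&` cdom b'))).
    have [_ _ /(_ _ _ Aa Aa')[oa _]] := hA; have [_ _ /(_ _ _ Bb Bb')[ob _]] := hB.
    apply: open_nbhs_nbhs; split; first exact: open_prod.
    by split; rewrite /= ?row_mxKl ?row_mxKr; [exists p|exists q].
  apply: filterS => x [[p1 [ap1 ap1'] px] [q1 [bq1 bq1'] qx]].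
  have -> : x = prod_chart a b (p1, q1) by rewrite /= px qx hsubmxK.
  rewrite loc_inj; last 2 first.
  - move=> [p2 q2] [/= ap2 bq2] /= /eq_row_mx[] pp qq.
    by rewrite (chart_inj hA Aa ap2 ap1 pp) (chart_inj hB Bb bq2 bq1 qq).
  - by [].
  by rewrite /G /= row_mxKl row_mxKr (loc_chart hA)// (loc_chart hB).
Qed.

Lemma prod_atlas_chart a b : A a -> B b -> AB (prod_chart a b).
Proof. by move=> Aa Bb; exists a, b. Qed.

Lemma smooth_fst p : smooth_map_at AB A fst p.
Proof.
have [a Aa ap] : exists2 a, A a & cdom a p.1 by case: hA.
have [b Bb bp] : exists2 b, B b & cdom b p.2 by case: hB.
have ABc := prod_atlas_chart Aa Bb.
apply: (smooth_map_intro prod_compatible (c := prod_chart a b) (c' := a)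
  (G := lsubmx)) => //; last exact: smooth_at_lsubmx.
apply: mnbhsS (mnbhs_chart prod_compatible ABc (conj ap bp)) => q [aq bq].
by split=> //=; rewrite row_mxKl.
Qed.

Lemma smooth_snd p : smooth_map_at AB B snd p.
Proof.
have [a Aa ap] : exists2 a, A a & cdom a p.1 by case: hA.
have [b Bb bp] : exists2 b, B b & cdom b p.2 by case: hB.
have ABc := prod_atlas_chart Aa Bb.
apply: (smooth_map_intro prod_compatible (c := prod_chart a b) (c' := b)
  (G := rsubmx)) => //; last exact: smooth_at_rsubmx.
apply: mnbhsS (mnbhs_chart prod_compatible ABc (conj ap bp)) => q [aq bq].
by split=> //=; rewrite row_mxKr.
Qed.

Lemma tmap_fst a b p u : A a -> B b -> cdom a p.1 -> cdom b p.2 ->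
  tmap A fst p (coordvec AB (prod_chart a b) p u) = coordvec A a p.1 (lsubmx u).
Proof.
move=> Aa Bb ap bp; have ABc := prod_atlas_chart Aa Bb.
rewrite (tmap_expression (G := lsubmx) prod_compatible hA u (smooth_fst p) ABc
  (conj ap bp) Aa ap) ?derive_lsubmx//.
by apply: mnbhsS (mnbhs_chart prod_compatible ABc (conj ap bp)) => q _ /=;
  rewrite row_mxKl.
Qed.

Lemma tmap_snd a b p u : A a -> B b -> cdom a p.1 -> cdom b p.2 ->
  tmap B snd p (coordvec AB (prod_chart a b) p u) = coordvec B b p.2 (rsubmx u).
Proof.
move=> Aa Bb ap bp; have ABc := prod_atlas_chart Aa Bb.
rewrite (tmap_expression (G := rsubmx) prod_compatible hB u (smooth_snd p) ABc
  (conj ap bp) Bb bp) ?derive_rsubmx//.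
by apply: mnbhsS (mnbhs_chart prod_compatible ABc (conj ap bp)) => q _ /=;
  rewrite row_mxKr.
Qed.

End product_atlas.

Section pairing.
Context {R : realType} {L M M' : Type} {l d e : nat}.
Context {C : atlas R L l} {A : atlas R M d} {B : atlas R M' e}.
Hypotheses (hC : compatible C) (hA : compatible A) (hB : compatible B).

Lemma smooth_pair (f : L -> M) (g : L -> M') p :
  smooth_map_at C A f p -> smooth_map_at C B g p ->
  smooth_map_at C (prod_atlas A B) (fun z => (f z, g z)) p.
Proof.
move=> [a [Aa ap nf sf]] [b [Bb bp ng sg]].
exists (prod_chart a b); split=> //; first exact: prod_atlas_chart.
  by apply: mnbhsS (mnbhs_near hC nf ng).
have [c Cc cp] : exists2 c, C c & cdom c p by case: hC.
apply/(smooth_nearP hC (@composable_row _ _) _ Cc cp).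
have {}sf := (smooth_nearP hC (@composable_row _ _) _ Cc cp).1 sf.
have {}sg := (smooth_nearP hC (@composable_row _ _) _ Cc cp).1 sg.
apply: (loc_smooth hC Cc cp _ (smooth_at_row_mx sf sg)).
by apply: mnbhsS (mnbhs_chart hC Cc cp) => q cq /=; rewrite !(loc_chart hC).
Qed.

End pairing.

(** * The circle *)

Lemma mnbhs_prod {R : realType} {M M' : Type} {d e : nat}
    {A : atlas R M d} {B : atlas R M' e} p q (P : set M) (Q : set M') :
  compatible A -> compatible B -> mnbhs A p P -> mnbhs B q Q ->
  mnbhs (prod_atlas A B) (p, q) (P `*` Q).
Proof.
move=> hA hB nP nQ; have hAB := prod_compatible hA hB.
have nP' := smooth_map_nbhs hAB hA (smooth_fst hA hB (p, q)) nP.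
have nQ' := smooth_map_nbhs hAB hB (smooth_snd hA hB (p, q)) nQ.
exact: mnbhsS (mnbhs_near hAB nP' nQ').
Qed.

Section circle_atlas.
Context {R : realType}.
Implicit Types (z w : circle R) (s t : R).

Lemma cexp_subproof t : `|(cos t +i* sin t)%C| == 1 :> R[i].
Proof. by rewrite normc_def /= cos2Dsin2 sqrtr1. Qed.

Definition cexp t : circle R :=
  exist (fun z : R[i] => `|z| == 1) (cos t +i* sin t)%C (cexp_subproof t).

Lemma cexpD s t : cexp (s + t) = (cexp s * cexp t)%g.
Proof.
apply: val_inj; rewrite /= cosD sinD; apply/eqP; rewrite eq_complex /=.
by rewrite eqxx/= addrC.
Qed.

Lemma cexp0 : cexp 0 = 1%g.
Proof. by apply: val_inj; rewrite /= cos0 sin0. Qed.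

Lemma cexpN t : cexp (- t) = (cexp t)^-1%g.
Proof. by apply: (mulIg (cexp t)); rewrite mulVg -cexpD addNr cexp0. Qed.

Lemma cexp_inj s t : - pi < s < pi -> - pi < t < pi -> cexp s = cexp t -> s = t.
Proof.
(* The difference of two angles in the range lies in [0, 2 pi[ once they are ordered. On [0, pi] the
   cosine is injective; beyond pi the sine is nonzero, contrary to [sin a = 0]. *)
have key (a : R) : 0 <= a < pi + pi -> cexp a = 1%g -> a = 0.
  move=> /andP[a0 a2] /(congr1 val)/= [ca sa].
  have [api|pia] := leP a pi.
    apply: (@cos_inj R); rewrite ?cos0// in_itv/= ?lexx ?pi_ge0//.
    by rewrite a0.
  have b0 : 0 < a - pi < pi by rewrite subr_gt0 pia/= ltrBlDr.
  have := sin_gt0_pi b0; rewrite sinB sinpi cospi sa mul0r mulr0 subr0.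
  by rewrite ltxx.
move=> /andP[s1 s2] /andP[t1 t2] st.
wlog : s t s1 s2 t1 t2 st / s <= t.
  move=> H; have [/H//|/ltW/H E] := leP s t; first exact.
  by apply/esym; apply: E.
move=> le_st; apply/esym/eqP; rewrite -subr_eq0; apply/eqP/key.
  by rewrite subr_ge0 le_st/= ltrD// ltrNl.
by rewrite cexpD cexpN st mulgV.
Qed.

Lemma cexp_neqN1 t : - pi < t < pi -> val (cexp t) <> - 1.
Proof.
move=> /andP[t1 t2] /eqP; rewrite eq_complex /= => /andP[/eqP ct _].
have : `|t| = pi.
  apply: (@cos_inj R); rewrite ?in_itv/= ?normr_ge0 ?lexx ?pi_ge0//.
    by rewrite ler_norml !ltW.
  by rewrite cos_norm ct cospi.
by move/eqP; rewrite lt_eqF// ltr_norml t1.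
Qed.

(** The angle is [acos] of the real part, with the sign of the imaginary part; excluding -1 keeps it
    strictly below pi in absolute value. *)
Lemma cexp_surj z : val z <> - 1 -> exists2 t, - pi < t < pi & z = cexp t.
Proof.
case: z => [[a b] nz] /= ne; have := nz; rewrite normc_def /= => nab.
have ab : a ^+ 2 + b ^+ 2 = 1.
  move: nab; rewrite eq_complex/= => /andP[/eqP sq _].
  by rewrite -[LHS]sqr_sqrtr ?sq ?expr1n// addr_ge0 ?sqr_ge0.
have a1 : -1 <= a <= 1.
  by have b2 := sqr_ge0 b; apply/andP; split; nra.
have cosa : cos (acos a) = a by rewrite acosK// in_itv.
have sina : sin (acos a) = `|b|.
  by rewrite sin_acos// -ab addrAC subrr add0r sqrtr_sqr.
have aN1 : a != -1.
  apply/eqP => aE; apply: ne; move/eqP: ab; rewrite aE sqrrN expr1n.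
  rewrite -subr_eq0 addrAC subrr add0r sqrf_eq0 => /eqP ->.
  by apply/eqP; rewrite eq_complex/= oppr0 !eqxx.
have acospi : 0 <= acos a < pi.
  rewrite acos_ge0//= acos_ltpi//; move/andP: a1 => [a1 ->].
  by rewrite lt_neqAle eq_sym aN1 a1.
have [b0|b0] := leP 0 b.
  exists (acos a).
    move/andP: acospi => [p1 ->]; rewrite andbT (lt_le_trans _ p1)//.
    by rewrite oppr_lt0 pi_gt0.
  by apply: val_inj; rewrite /= cosa sina ger0_norm.
exists (- acos a).
  move/andP: acospi => [p1 p2]; rewrite ltrN2 p2/= (le_lt_trans _ (pi_gt0 _))//.
  by rewrite oppr_le0.
by apply: val_inj; rewrite /= cosN sinN cosa sina ltr0_norm// opprK.
Qed.

Lemma angleK z0 t : - pi < t < pi -> angle z0 (z0 * cexp t)%g = t.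
Proof.
move=> tpi; rewrite /angle; case: xgetP => [s _ [spi E]|/(_ t) H]; last by case: H; split.
apply: cexp_inj => //; apply: val_inj; apply: (mulfI (circle_neq0 z0)).
by rewrite -E.
Qed.

Lemma angle_chart_dom z0 z : cdom (angle_chart z0) z ->
  - pi < angle z0 z < pi /\ z = (z0 * cexp (angle z0 z))%g.
Proof.
move=> ne; have [|t tpi E] := @cexp_surj (z0^-1 * z)%g.
  move=> E; apply: ne; move/(congr1 ( *%R (val z0))): E => /=.
  by rewrite mulrA mulfV ?circle_neq0// mul1r mulrN1.
have -> : z = (z0 * cexp t)%g by rewrite -E mulVKg.
by rewrite angleK.
Qed.

Lemma angle_chart_cexp z0 t : - pi < t < pi -> cdom (angle_chart z0) (z0 * cexp t)%g.
Proof.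
move=> tpi /= /eqP; rewrite -[- _]mulrN1 => /eqP/(mulfI (circle_neq0 z0)).
exact: cexp_neqN1.
Qed.

Lemma angle_chart_self z : cdom (angle_chart z) z.
Proof.
have := @angle_chart_cexp z 0; rewrite cexp0 mulg1; apply.
by rewrite oppr_lt0 pi_gt0.
Qed.

Arguments angle_chart_self z : clear implicits.

Lemma near_ball (a : R) (P : set R) : (\forall s \near a, P s) <->
  exists2 e, 0 < e & forall s, `|s - a| < e -> P s.
Proof.
split=> [/nbhs_ballP[e /= e0 He]|[e e0 He]].
  by exists e => // s se; apply: He; rewrite -ball_normE /= distrC.
apply/nbhs_ballP; exists e => // s; rewrite -ball_normE /= distrC.
exact: He.
Qed.

(** The curve [s |-> z * cexp s] parametrizes the circle near [z] and has unit speed in every angle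
    chart. All local computations on the circle are made along it. *)
Lemma angle_near z0 z : cdom (angle_chart z0) z -> \forall s \near (0 : R),
  cdom (angle_chart z0) (z * cexp s)%g /\
  angle z0 (z * cexp s)%g = angle z0 z + s.
Proof.
move=> /angle_chart_dom[zpi zE].
have E s : (z * cexp s = z0 * cexp (angle z0 z + s))%g.
  by rewrite {1}zE -mulgA -cexpD.
have : \forall s \near (0 : R), - pi < angle z0 z + s < pi.
  have : (fun s => angle z0 z + s) @ (0 : R) --> angle z0 z + 0.
    by apply: cvgD; [exact: cvg_cst|exact: cvg_id].
  rewrite addr0 => /(_ [set t | - pi < t < pi]); apply.
  have : nbhs (angle z0 z) `] - pi, pi[%classic.
    by apply: open_nbhs_nbhs; split; [exact: interval_open|rewrite /= in_itv].
  by apply: filterS => t; rewrite /= in_itv.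
apply: filterS => s spi; rewrite E.
by split; [exact: angle_chart_cexp|rewrite angleK].
Qed.

Lemma image_angle_chart z0 :
  angle_chart z0 @` cdom (angle_chart z0) = [set x | - pi < x 0 0 < pi].
Proof.
apply/seteqP; split=> [_ [z /angle_chart_dom[zpi _] <-]|x xpi]/=.
  by rewrite mxE.
exists (z0 * cexp (x 0 0))%g; first exact: angle_chart_cexp.
by apply/rowP => i; rewrite mxE angleK// ord1.
Qed.

Lemma near_row1 (P : set R) (x : 'rV[R]_1) :
  (\forall t \near x 0 0, P t) -> nbhs x [set y : 'rV[R]_1 | P (y 0 0)].
Proof. by move=> nP; exact: (@coord_continuous _ _ _ 0 0 x). Qed.

Lemma angle_chart_near z0 z (P : set R) : cdom (angle_chart z0) z ->
  (\forall s \near (0 : R), P s) ->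
  \forall x \near angle_chart z0 z, exists s,
    [/\ cdom (angle_chart z0) (z * cexp s)%g, angle_chart z0 (z * cexp s)%g = x,
        x = angle_chart z0 z + const_mx s & P s].
Proof.
move=> zz0 nP.
have nQ : \forall s \near (0 : R), (cdom (angle_chart z0) (z * cexp s)%g /\
    angle z0 (z * cexp s)%g = angle z0 z + s) /\ P s.
  exact: filterI (angle_near zz0) nP.
have H : \forall t \near (angle z0 z : R),
    [set s | (cdom (angle_chart z0) (z * cexp s)%g /\
      angle z0 (z * cexp s)%g = angle z0 z + s) /\ P s] (t - angle z0 z).
  have [e e0 He] := (near_ball _ _).1 nQ; apply/near_ball; exists e => // t te.
  by apply: He; rewrite subr0.
have := @near_row1 _ (angle_chart z0 z); rewrite mxE => /(_ _ H).
apply: filterS => x [[dz' E] Ps]; exists (x 0 0 - angle z0 z); split=> //.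
  by apply/rowP => i; rewrite mxE E ord1 addrC subrK.
by apply/rowP => i; rewrite !mxE ord1 addrC subrK.
Qed.

Lemma circle_compatible : compatible (circle_atlas R).
Proof.
apply: compatible_intro.
- by move=> z; exists (angle_chart z); [exists z|exact: angle_chart_self].
- move=> _ z w [z0 _ <-] /angle_chart_dom[_ zE] /angle_chart_dom[_ wE].
  by move=> /rowP/(_ 0); rewrite !mxE => E; rewrite zE wE E.
- move=> _ [z0 _ <-]; rewrite image_angle_chart.
  rewrite openE => x /= xpi; apply: (@near_row1 [set t | - pi < t < pi] x).
  have : nbhs (x 0 0) `] - pi, pi[%classic.
    by apply: open_nbhs_nbhs; split; [exact: interval_open|rewrite /= in_itv].
  by apply: filterS => t; rewrite /= in_itv.
- move=> _ _ [z0 _ <-] [z1 _ <-]; rewrite openE => _ [z [zz0 zz1] <-].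
  have := angle_chart_near zz0 (angle_near zz1).
  by apply: filterS => x [s [dz' <- _ [dz1' _]]]; exists (z * cexp s)%g.
- move=> _ _ z [z0 _ <-] [z1 _ <-] zz0 zz1.
  (* Two angles differ by a locally constant amount, so transition maps are local translations; the
     constant is the difference at [z]. *)
  pose G (x : 'rV[R]_1) := x + const_mx (angle z1 z - angle z0 z).
  have sG : smooth_at G (angle_chart z0 z).
    by apply: smooth_atD; [exact: smooth_at_id|exact: smooth_at_cst].
  apply: smooth_at_eq sG; have := angle_chart_near zz0 (angle_near zz1).
  apply: filterS => x [s [dz' <- xE [dz1' E1]]].
  rewrite loc_inj//; last first.
    move=> w /angle_chart_dom[_ wE]; have [_ z'E] := angle_chart_dom dz'.
    by move/rowP/(_ 0); rewrite !mxE => E; rewrite wE z'E E.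
  rewrite /G xE; apply/rowP => i; rewrite !mxE E1.
  by rewrite addrC addrA subrK addrC.
Qed.

Lemma mnbhs_circle z (P : set R) : (\forall s \near (0 : R), P s) ->
  mnbhs (circle_atlas R) z [set z' | exists2 s, z' = (z * cexp s)%g & P s].
Proof.
move=> nP; have Ac : circle_atlas R (angle_chart z) by exists z.
have zz := angle_chart_self z.
apply/(mnbhsP circle_compatible _ Ac zz).
apply: filterS (angle_chart_near zz nP) => x [s [ds sx _ Ps]] z' dz' z'x.
exists s => //; apply: (chart_inj circle_compatible Ac) => //.
by rewrite z'x sx.
Qed.

Lemma smooth_circle_inv z :
  smooth_map_at (circle_atlas R) (circle_atlas R) (fun z => z^-1)%g z.
Proof.
pose G (x : 'rV[R]_1) := - x + const_mx (angle (z^-1)%g (z^-1)%g + angle z z).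
apply: (smooth_map_intro circle_compatible (c := angle_chart z)
  (c' := angle_chart (z^-1)%g) (G := G)) => //.
- by exists z.
- exact: angle_chart_self.
- by exists (z^-1)%g.
- have n1 := angle_near (angle_chart_self z).
  have n2 : \forall s \near (0 : R),
      cdom (angle_chart z^-1%g) (z^-1 * cexp (- s))%g /\
      angle z^-1%g (z^-1 * cexp (- s))%g = angle z^-1%g z^-1%g - s.
    have [e e0 He] := (near_ball _ _).1 (angle_near (angle_chart_self z^-1%g)).
    apply/near_ball; exists e => // t; rewrite subr0 => te; apply: He.
    by rewrite subr0 normrN.
  apply: mnbhsS (mnbhs_circle z (filterI n1 n2)) => z' [s ->] [[d1 E1] [d2 E2]].
  have E : ((z * cexp s)^-1 = z^-1 * cexp (- s))%g.
    rewrite cexpN; apply: val_inj; rewrite /= invfM.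
    by [].
  rewrite /mkset E; split; first exact: d2.
  by apply/rowP => i; rewrite !mxE E1 E2; ring.
- apply: smooth_atD; last exact: smooth_at_cst.
  apply: (@smooth_at_linear _ _ _ (@GRing.opp 'rV[R]_1)).
  exact: opp_continuous.
Qed.

Lemma circle_mul_near z w z0 w0 v0 : cdom (angle_chart z0) z ->
  cdom (angle_chart w0) w -> cdom (angle_chart v0) (z * w)%g ->
  mnbhs (prod_atlas (circle_atlas R) (circle_atlas R)) (z, w)
   [set p | cdom (angle_chart v0) (p.1 * p.2)%g /\
     angle v0 (p.1 * p.2)%g =
       angle z0 p.1 + angle w0 p.2 + (angle v0 (z * w)%g - angle z0 z - angle w0 w)].
Proof.
move=> zz0 ww0 zwv0; have [e e0 He] := (near_ball _ _).1 (angle_near zwv0).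
(* Each factor may move by at most [e / 2], so that the product moves by an angle [s + t] below
   [e]. *)
have He2 : \forall s \near (0 : R), `|s| < e / 2.
  apply/near_ball; exists (e / 2); first by rewrite divr_gt0.
  by move=> s; rewrite subr0.
have near_dist x x0 : cdom (angle_chart x0) x -> \forall s \near (0 : R),
    (cdom (angle_chart x0) (x * cexp s)%g /\
    angle x0 (x * cexp s)%g = angle x0 x + s) /\ `|s| < e / 2.
  by move=> dx; exact: filterI (angle_near dx) He2.
have nz := mnbhs_circle z (near_dist _ _ zz0).
have nw := mnbhs_circle w (near_dist _ _ ww0).
have nzw := mnbhs_prod circle_compatible circle_compatible nz nw.
apply: mnbhsS nzw => p [[s p1 [[_ E1] s1]] [t p2 [[_ E2] t1]]].
rewrite /mkset p1 p2.
have -> : (z * cexp s * (w * cexp t) = z * w * cexp (s + t))%g.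
  by rewrite cexpD; apply: val_inj; rewrite /= mulrACA.
have [|d ->] := He (s + t).
  rewrite subr0 (le_lt_trans (ler_normD _ _))//.
  by rewrite [e]splitr ltrD.
by split; [exact: d|rewrite E1 E2; ring].
Qed.

End circle_atlas.

Arguments angle_chart_self {R} z.

Lemma smooth_at_ext {R : realType} {V W : normedModType R} (f g : V -> W) x :
  f =1 g -> smooth_at f x -> smooth_at g x.
Proof. by move=> /funext ->. Qed.

Section circle_maps.
Context {R : realType}.
Let C := circle_atlas R.

Lemma smooth_circle_mul p : smooth_map_at (prod_atlas C C) C (fun p => p.1 * p.2)%g p.
Proof.
case: p => z w; have hC := @circle_compatible R.
pose G (x : 'rV[R]_(1 + 1)) : 'rV[R]_1 := lsubmx x + (rsubmx x +
  const_mx (angle (z * w)%g (z * w)%g - angle z z - angle w w)).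
apply: (smooth_map_intro (prod_compatible hC hC)
  (c := prod_chart (angle_chart z) (angle_chart w))
  (c' := angle_chart (z * w)%g) (G := G)) => //.
- by apply: prod_atlas_chart; [exists z|exists w].
- by split; exact: angle_chart_self.
- by exists (z * w)%g.
- have := circle_mul_near (angle_chart_self z) (angle_chart_self w)
    (angle_chart_self (z * w)%g).
  apply: mnbhsS => p [d E]; split; first exact: d.
  rewrite /G [prod_chart _ _ p]/(row_mx _ _) row_mxKl row_mxKr.
  by apply/rowP => i; rewrite !mxE E; ring.
- apply: smooth_atD; first exact: smooth_at_lsubmx.
  by apply: smooth_atD; [exact: smooth_at_rsubmx|exact: smooth_at_cst].
Qed.

Lemma angle_transition (z0 z1 z : circle R) :
  cdom (angle_chart z0) z -> cdom (angle_chart z1) z ->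
  mnbhs C z [set z' | angle z1 z' = angle z0 z' + (angle z1 z - angle z0 z)].
Proof.
move=> d0 d1.
have n : \forall s \near (0 : R),
   (cdom (angle_chart z0) (z * cexp s)%g /\
    angle z0 (z * cexp s)%g = angle z0 z + s) /\
   (cdom (angle_chart z1) (z * cexp s)%g /\
    angle z1 (z * cexp s)%g = angle z1 z + s).
  exact: filterI (angle_near d0) (angle_near d1).
apply: mnbhsS (mnbhs_circle z n) => z' [s zs [[_ E0] [_ E1]]].
rewrite /mkset zs E0 E1; ring.
Qed.

Lemma derive_addcst {V : normedModType R} n (f : V -> 'rV[R]_n) (a : 'rV[R]_n) x u :
  differentiable f x -> 'D_u (fun y => f y + a) x = 'D_u f x.
Proof.
move=> df; rewrite (derive_addf _ df); last exact/smooth_at_differentiable/smooth_at_cst.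
by rewrite (derive_cst a) addr0.
Qed.

(** All angle charts define the same vector field d/dtheta, because angles differ by local
    constants. Hence [dtheta] and [fiber_a], defined with the chart centred at the base point, may
    be computed in any angle chart. *)
Lemma circle_coordvec (z0 z1 z : circle R) u :
  cdom (angle_chart z0) z -> cdom (angle_chart z1) z ->
  coordvec C (angle_chart z1) z u = coordvec C (angle_chart z0) z u.
Proof.
move=> d0 d1; have hC := @circle_compatible R.
have C0 : C (angle_chart z0) by exists z0.
have C1 : C (angle_chart z1) by exists z1.
rewrite (coordvec_change hC u C0 C1 d0 d1).
rewrite (derive_loc hC (G := fun x => x + const_mx (angle z0 z - angle z1 z)) _ C1 d1).
  by rewrite derive_addcst ?derive_id//; exact/smooth_at_differentiable/smooth_at_id.
apply: mnbhsS (angle_transition d1 d0) => z' E.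
by apply/rowP => i; rewrite !mxE E.
Qed.

Lemma circle_coordvec_angle (z0 z : circle R) u : cdom (angle_chart z0) z ->
  coordvec C (angle_chart z0) z u (angle z) = u 0 0.
Proof.
move=> d0; have C1 : C (angle_chart z) by exists z.
rewrite (circle_coordvec u (angle_chart_self z) d0).
rewrite -(coordvec_coord (@circle_compatible R) u 0 C1 (angle_chart_self z)).
by congr coordvec; apply/funext => w; rewrite mxE.
Qed.

End circle_maps.

(** * Cotangent bundles *)

Section cotangent_atlas.
Context {R : realType} {M : Type} {d : nat} {A : atlas R M d}.
Hypothesis hA : compatible A.
Implicit Types (q : cotangent A) (c : chart R M d).
Let TA := cot_atlas A.

(** Covectors are extended by 0 outside the tangent space, so agreement on tangent vectors gives
    equality of the functionals; the proof components agree by irrelevance. *)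
Lemma cot_ext q q' : cbase q = cbase q' ->
  (forall v, tangent A (cbase q) v -> cform q v = cform q' v) -> q = q'.
Proof.
case: q q' => [p phi [lphi phi0]] [p' phi' [lphi' phi0']] /= pp'.
subst p' => E; have EE : phi = phi'.
  apply/funext => v; have [Tv|nTv] := pselect (tangent A p v); first exact: E.
  by rewrite phi0// phi0'.
by subst phi'; congr Cotangent; exact: Prop_irrelevance.
Qed.

Lemma cform_linear q : linear_on A (cbase q) (cform q).
Proof. by case: q => p phi []. Qed.

Lemma cform_mkcotangent p phi v : linear_on A p phi -> tangent A p v ->
  cform (mkcotangent A p phi) v = phi v.
Proof. by move=> lphi Tv; rewrite /= /restrict_covector asboolT. Qed.

Lemma cform_coordvec q c u : A c -> cdom c (cbase q) ->
  cform q (coordvec A c (cbase q) u) =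
  \sum_i u 0 i * rsubmx (cot_chart A c q) 0 i.
Proof.
move=> Ac cq; rewrite (linear_on_sum hA u Ac cq (@cform_linear q)).
by apply: eq_bigr => i _; rewrite /= row_mxKr mxE.
Qed.

(** The covector with components [y]: a tangent vector evaluated at the i-th coordinate function
    gives its i-th component. This inverts [cot_chart] and shows that each fibre is a full copy of
    the row space. *)
Definition cot_point c (p : M) (y : 'rV[R]_d) : cotangent A :=
  mkcotangent A p (fun v => \sum_i y 0 i * v (fun z => c z 0 i)).

Lemma cot_chart_point c p y : A c -> cdom c p ->
  cot_chart A c (cot_point c p y) = row_mx (c p) y.
Proof.
move=> Ac cp; rewrite /=; congr row_mx; apply/rowP => i; rewrite mxE.
rewrite -[LHS]/(cform (cot_point c p y) (dcoord A c p i)) cform_mkcotangent.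
- rewrite (bigD1 i)//= /dcoord coordvec_coord// mxE !eqxx mulr1 big1 ?addr0//.
  by move=> j ji; rewrite coordvec_coord// mxE eqxx (negPf ji) mulr0.
- apply/(linear_onP hA _ Ac cp); exists y => u.
  by apply: eq_bigr => j _; rewrite coordvec_coord// mulrC.
- exact: tangent_coordvec.
Qed.

Lemma cot_chart_inj c q q' : A c -> cdom c (cbase q) -> cdom c (cbase q') ->
  cot_chart A c q = cot_chart A c q' -> q = q'.
Proof.
move=> Ac cq cq' E; have [b y] := eq_row_mx E.
have bb := chart_inj hA Ac cq cq' b; apply: cot_ext => // v.
move=> /(tangentP hA _ Ac cq)[u ->]; rewrite (cform_coordvec u Ac cq).
by rewrite bb (cform_coordvec u Ac cq') E.
Qed.

Lemma image_cot_chart c (P : set M) : A c -> P `<=` cdom c ->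
   cot_chart A c @` (@cbase R M d A @^-1` P) = lsubmx @^-1` (c @` P).
Proof.
move=> Ac Pc; apply/seteqP; split=> [_ [q Pq <-]|x [p Pp px]].
  by exists (cbase q) => //=; rewrite row_mxKl.
exists (cot_point c p (rsubmx x)) => //; rewrite cot_chart_point//; last exact: Pc.
by rewrite px hsubmxK.
Qed.

(** Momenta change by the Jacobian of the inverse coordinate change, taken at the new coordinates:
    y'_i is the sum over j of (dx_j / dx'_i) y_j. *)
Definition cot_transition c c' (x : 'rV[R]_(d + d)) : 'rV[R]_(d + d) :=
  row_mx (loc c c' (lsubmx x))
    (\row_i \sum_j 'D_(delta_mx 0 i) (loc c' c) (loc c c' (lsubmx x)) 0 j *
       rsubmx x 0 j).

Lemma cot_transitionE c c' q : A c -> A c' -> cdom c (cbase q) ->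
  cdom c' (cbase q) -> cot_transition c c' (cot_chart A c q) = cot_chart A c' q.
Proof.
move=> Ac Ac' cq c'q; rewrite /cot_transition row_mxKl (loc_chart hA)//=.
congr row_mx; apply/rowP => i; rewrite !mxE.
by rewrite /dcoord (coordvec_change hA _ Ac Ac' cq c'q) (cform_coordvec _ Ac cq).
Qed.

Lemma smooth_cot_transition c c' p x : A c -> A c' -> cdom c p -> cdom c' p ->
  lsubmx x = c p -> smooth_at (cot_transition c c') x.
Proof.
move=> Ac Ac' cp c'p xE.
have s1 : smooth_at (loc c c' \o lsubmx) x.
  apply: smooth_at_comp; first exact: smooth_at_lsubmx.
  by rewrite xE; exact: (transition_smooth hA).
apply: smooth_at_row_mx => //; apply/smooth_at_coord => i.
apply: (@smooth_at_ext _ _ _ (fun x : 'rV[R]_(d + d) => \sum_j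
   (('D_(delta_mx 0 i) (loc c' c) (loc c c' (lsubmx x)) 0 j : R^o) *
       (rsubmx x 0 j : R^o) : R^o))).
  by move=> y; rewrite mxE.
apply: smooth_at_sum => j; apply: smooth_atM; last first.
  exact: ((smooth_at_coord (@rsubmx R 1 d d) x).1 (smooth_at_rsubmx x) j).
apply: ((smooth_at_coord ('D_(delta_mx 0 i) (loc c' c) \o (loc c c' \o lsubmx)) _).1 _ j).
apply: smooth_at_comp => //=; rewrite xE (loc_chart hA)//.
exact/smooth_at_derive/(transition_smooth hA).
Qed.

Lemma cot_compatible : compatible TA.
Proof.
apply: compatible_intro.
- move=> q; have [c Ac cq] : exists2 c, A c & cdom c (cbase q) by case: hA.
  by exists (cot_chart A c) => //; exists c.
- by move=> _ q q' [c Ac <-] cq cq'; exact: cot_chart_inj.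
- move=> _ [c Ac <-]; rewrite image_cot_chart//.
  apply: open_comp; last exact: (chart_open hA).
  by move=> x _; exact: continuous_lsubmx.
- move=> _ _ [c Ac <-] [c' Ac' <-].
  rewrite -[_ `&` _]/(@cbase R M d A @^-1` (cdom c `&` cdom c')) image_cot_chart//.
  apply: open_comp; first by move=> x _; exact: continuous_lsubmx.
  by have [_ _ /(_ _ _ Ac Ac')[]] := hA.
- move=> _ _ q [c Ac <-] [c' Ac' <-] cq c'q.
  have sG : smooth_at (cot_transition c c') (cot_chart A c q).
    by apply: (smooth_cot_transition Ac Ac' cq c'q); rewrite row_mxKl.
  apply: smooth_at_eq sG.
  have : nbhs (cot_chart A c q) (lsubmx @^-1` (c @` (cdom c `&` cdom c'))).
    have [_ _ /(_ _ _ Ac Ac')[oc _]] := hA.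
    apply: open_nbhs_nbhs; split.
      by apply: open_comp => // x _; exact: continuous_lsubmx.
    by exists (cbase q) => //=; rewrite row_mxKl.
  rewrite -image_cot_chart//; apply: filterS => _ [q' [cq' c'q'] <-].
  rewrite loc_inj ?cot_transitionE// => q2 cq2 E.
  exact: (cot_chart_inj Ac cq2 cq').
Qed.

Lemma cot_atlas_chart c : A c -> TA (cot_chart A c).
Proof. by move=> Ac; exists c. Qed.

Lemma smooth_cbase q : smooth_map_at TA A (@cbase R M d A) q.
Proof.
have [c Ac cq] : exists2 c, A c & cdom c (cbase q) by case: hA.
apply: (smooth_map_intro cot_compatible (c := cot_chart A c) (c' := c)
  (G := lsubmx)) => //.
- exact: cot_atlas_chart.
- apply: mnbhsS (mnbhs_chart cot_compatible (cot_atlas_chart Ac) cq) => q' cq'.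
  by split=> //=; rewrite row_mxKl.
- exact: smooth_at_lsubmx.
Qed.

Lemma tmap_cbase q c u : A c -> cdom c (cbase q) ->
  tmap A (@cbase R M d A) q (coordvec TA (cot_chart A c) q u) =
  coordvec A c (cbase q) (lsubmx u).
Proof.
move=> Ac cq; have TAc := cot_atlas_chart Ac.
rewrite (tmap_expression (G := lsubmx) cot_compatible hA u (smooth_cbase q) TAc
  cq Ac cq) ?derive_lsubmx//.
by apply: mnbhsS (mnbhs_chart cot_compatible TAc cq) => q' _ /=; rewrite row_mxKl.
Qed.

End cotangent_atlas.

(** * Lifted actions *)

Lemma sum_delta {R : realType} n (a : 'I_n -> R^o) k :
  \sum_l (l == k)%:R * a l = a k.
Proof.
rewrite (bigD1 k)//= eqxx mul1r big1 ?addr0// => l /negPf ->.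
by rewrite mul0r.
Qed.

Lemma sum_delta2_eq0 {R : realType} n (a b c : 'I_n -> R^o) j k :
  (forall l, c l = (l == k)%:R * a l + (l == j)%:R * b l) ->
  \sum_l c l = 0 -> a k = - b j.
Proof.
move=> cE; under eq_bigr do rewrite cE.
by rewrite big_split/= !sum_delta => /eqP; rewrite addr_eq0 => /eqP.
Qed.

(** [f] is row k of a matrix P and [g] column j of a matrix Q, both the identity at [x]. If the
    derivative of P Q vanishes, Leibniz leaves P' + Q' = 0 in entry (k, j). *)
Lemma derive_delta_product {R : realType} {V : normedModType R} n
    (f g : 'I_n -> V -> R^o) (x v : V) (j k : 'I_n) :
  (forall l, differentiable (f l) x) -> (forall l, differentiable (g l) x) ->
  (forall l, f l x = (l == k)%:R) -> (forall l, g l x = (l == j)%:R) ->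
  'D_v (fun y => \sum_l (f l y * g l y : R^o)) x = 0 ->
  'D_v (g k) x = - 'D_v (f j) x.
Proof.
move=> df dg fx gx; rewrite (derive_sumf _ (fun l => differentiable_mulf (df l) (dg l))).
apply: (@sum_delta2_eq0 _ _ (fun l => 'D_v (g l) x) (fun l => 'D_v (f l) x)) => l.
by rewrite (derive_mulf _ (df l) (dg l)) fx gx.
Qed.

Lemma derive_lincomb {R : realType} {V W : normedModType R} (f : V -> W) x n
    (a : 'I_n -> R) (v : 'I_n -> V) :
  differentiable f x ->
  'D_(\sum_i a i *: v i) f x = \sum_i a i *: 'D_(v i) f x.
Proof.
move=> df; rewrite deriveE// linear_sum.
by apply: eq_bigr => i _; rewrite linearZ deriveE.
Qed.

(* F and K are the coordinate expressions of (g, p) |-> g p and of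
   (g, p) |-> (g^-1, g p) near (1, p). *)
Section inverse_flow.
Context {R : realType} {e d : nat}.
Variables (F : 'rV[R]_(e + d) -> 'rV[R]_d) (I : 'rV[R]_e -> 'rV[R]_e).
Variables (s0 : 'rV[R]_e) (x0 : 'rV[R]_d).
Let w0 := row_mx s0 x0.
Let K (w : 'rV[R]_(e + d)) := row_mx (I (lsubmx w)) (F w).
Hypotheses (sF : smooth_at F w0) (sI : smooth_at I s0) (I0 : I s0 = s0).
Hypothesis F0 : \forall x \near x0, F (row_mx s0 x) = x.
Hypothesis FK : \forall w \near w0, F (K w) = rsubmx w.

Let v k : 'rV[R]_(e + d) := row_mx 0 (delta_mx 0 k).

Let Fw0 : F w0 = x0. Proof. exact: (nbhs_singleton F0). Qed.

Let Kw0 : K w0 = w0.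
Proof. by rewrite /K row_mxKl I0 Fw0. Qed.

Let sIw : smooth_at (I \o lsubmx) w0.
Proof.
by apply: smooth_at_comp; [exact: smooth_at_lsubmx|rewrite row_mxKl].
Qed.

Let sK : smooth_at K w0.
Proof. exact: smooth_at_row_mx sIw sF. Qed.

Let near_K (P : set 'rV[R]_(e + d)) : (\forall w \near w0, P w) ->
  \forall w \near w0, P (K w).
Proof. by move=> nP; apply: (smooth_at_continuous sK); rewrite Kw0. Qed.

Let deriv_K k : \forall w \near w0,
  'D_(v k) K w = row_mx 0 ('D_(v k) F w).
Proof.
have sIn : \forall w \near w0, smooth_at (I \o lsubmx) w.
  exact: smooth_at_near sIw.
have sIl : \forall w \near w0, smooth_at I (lsubmx w).
  apply: (@continuous_lsubmx _ _ _ _ w0 [set s | smooth_at I s]).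
  by rewrite row_mxKl; exact: (smooth_at_near sI).
apply: filterS3 (smooth_at_near sF) sIn sIl => w sFw sIw' sIlw.
rewrite (derive_row_mx _ sIw' sFw) derive_comp; last 2 first.
- exact: differentiable_lsubmx.
- exact: smooth_at_differentiable.
by rewrite derive_lsubmx row_mxKl derive0.
Qed.

Let D k w := 'D_(v k) F w.

(** Chain rule for [F (K w) = rsubmx w] along the directions of M, in which the group component of
    [K] is stationary. *)
Lemma flow_jacobian_inverse k : \forall w \near w0,
  \sum_l D k w 0 l *: D l (K w) = delta_mx 0 k.
Proof.
have H1 : \forall w \near w0, 'D_(v k) (F \o K) w = delta_mx 0 k.
  have : nbhs w0 (fun w => \forall w' \near w, F (K w') = rsubmx w').
    exact: nbhs_interior FK.
  apply: filterS => w Fw.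
  rewrite (near_eq_derive (g := rsubmx))// derive_rsubmx row_mxKr//.
apply: filterS3 (filterI H1 (deriv_K k)) (smooth_at_near sK)
  (near_K (smooth_at_near sF)) => w [Ew EK] sKw sFKw.
rewrite -Ew derive_comp; last 2 first.
- exact: smooth_at_differentiable.
- exact: smooth_at_differentiable.
have -> : 'D_(v k) K w = \sum_l D k w 0 l *: v l.
  rewrite EK; apply/rowP => i; rewrite summxE; case: (split_ordP i) => j ->.
    by rewrite row_mxEl mxE big1// => l _; rewrite mxE row_mxEl mxE mulr0.
  rewrite row_mxEr (bigD1 j)//= mxE row_mxEr mxE !eqxx mulr1 big1 ?addr0//.
  by move=> l /negPf lj; rewrite mxE row_mxEr mxE eqxx eq_sym lj mulr0.
by rewrite derive_lincomb//; exact: smooth_at_differentiable.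
Qed.

Let Dw0 k : D k w0 = delta_mx 0 k.
Proof.
rewrite /D -[RHS](@derive_id _ _ x0).
rewrite -(near_eq_derive (delta_mx 0 k) F0).
rewrite (@derive_comp _ _ _ _ (fun x => row_mx s0 x) F); last 2 first.
- apply/smooth_at_differentiable/smooth_at_row_mx.
    exact: smooth_at_cst.
  exact: smooth_at_id.
- exact: smooth_at_differentiable.
rewrite derive_row_mx; [|exact: smooth_at_cst|exact: smooth_at_id].
by rewrite derive_cst derive_id.
Qed.

(* [flow_jacobian_inverse] says D(rho_g) D(rho_(g^-1)) = 1; both factors are 1 at
   g = 1, so their derivatives in g are opposite. *)
Lemma derive_inverse_flow u k j :
  'D_(row_mx u 0) (fun w => D k (K w) 0 j : R^o) w0 =
  - 'D_(delta_mx 0 k) (fun x => 'D_(row_mx u 0) F (row_mx s0 x) 0 j : R^o) x0.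
Proof.
have sD l : smooth_at (D l) w0 by exact: smooth_at_derive.
have sDK l : smooth_at (D l \o K) w0.
  by apply: smooth_at_comp => //; rewrite Kw0.
have sDj l i : smooth_at (fun w => D l w 0 i : R^o) w0.
  exact: ((smooth_at_coord _ _).1 (sD l)).
have sDKj l i : smooth_at (fun w => D l (K w) 0 i : R^o) w0.
  exact: ((smooth_at_coord _ _).1 (sDK l)).
have H : 'D_(row_mx u 0) (fun w => \sum_l (D k w 0 l * D l (K w) 0 j : R^o)) w0 = 0.
  transitivity ('D_(row_mx u 0)
    (cst ((delta_mx 0 k : 'rV[R]_d) 0 j : R^o)) w0); last exact: derive_cst.
  apply: near_eq_derive.
  apply: filterS (flow_jacobian_inverse k) => w /rowP/(_ j) <-.
  by rewrite summxE; apply: eq_bigr => l _; rewrite mxE.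
rewrite (derive_delta_product (f := fun l w => D k w 0 l)
  (g := fun l w => D l (K w) 0 j) (k := k) (j := j) _ _ _ _ H); first last.
- by move=> l; rewrite Kw0 Dw0 mxE eqxx [j == l]eq_sym.
- by move=> l; rewrite Dw0 mxE eqxx.
- by move=> l; exact: smooth_at_differentiable.
- by move=> l; exact: smooth_at_differentiable.
apply: (congr1 -%R).
have sFj : smooth_at (fun w => F w 0 j : R^o) w0.
  exact: ((smooth_at_coord _ _).1 sF).
have Dj v' : \forall w \near w0, 'D_v' F w 0 j = 'D_v' (fun w => F w 0 j : R^o) w.
  apply: filterS (smooth_at_near sF) => w /smooth_at_differentiable dF.
  exact: (derive_coord _ _ dF).
(* Symmetry of second derivatives: the group derivative of the Jacobian becomes the Jacobian of the
   fundamental field. *)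
rewrite (near_eq_derive _ (Dj (v k))) (derive_swap _ _ sFj).
rewrite -(near_eq_derive _ (Dj (row_mx u 0))).
have sDu : smooth_at (fun w => 'D_(row_mx u 0) F w 0 j : R^o) w0.
  exact: ((smooth_at_coord _ _).1 (smooth_at_derive _ sF)).
have sr : smooth_at (fun x => row_mx s0 x) x0.
  by apply: smooth_at_row_mx; [exact: smooth_at_cst|exact: smooth_at_id].
rewrite (derive_comp (f := fun x => row_mx s0 x) (g := fun w => 'D_(row_mx u 0) F w 0 j : R^o) _
  (smooth_at_differentiable sr) (smooth_at_differentiable sDu)).
rewrite derive_row_mx; [|exact: smooth_at_cst|exact: smooth_at_id].
by rewrite derive_cst derive_id.
Qed.

End inverse_flow.

(** * The lifted action and its fundamental field in coordinates *)

Section lifted_actions.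
Context {R : realType} {M : Type} {d : nat} {A : atlas R M d}.
Context {G : groupType} {e : nat} {AG : atlas R G e}.
Hypotheses (hA : compatible A) (hG : compatible AG).
Variable rho : G -> M -> M.
Hypothesis rho1 : forall x, rho 1%g x = x.
Hypothesis rhoM : forall g h x, rho (g * h)%g x = rho g (rho h x).
Let GA := prod_atlas AG A.
Let TA := cot_atlas A.
Hypothesis srho : forall p, smooth_map_at GA A (fun p => rho p.1 p.2) p.
Hypothesis sinv : smooth_map_at AG AG (fun g => g^-1%g) 1%g.
Let hGA : compatible GA := prod_compatible hG hA.
Let hTA : compatible TA := cot_compatible hA.

Lemma actionK g x : rho g^-1%g (rho g x) = x.
Proof. by rewrite -rhoM mulVg rho1. Qed.

Lemma smooth_translate g x : smooth_map_at A GA (fun x => (g, x)) x.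
Proof.
apply: smooth_pair => //; first exact: smooth_map_at_cst.
exact: smooth_map_at_id.
Qed.

Lemma smooth_slice g x : smooth_map_at AG GA (fun g => (g, x)) g.
Proof.
apply: smooth_pair => //; first exact: smooth_map_at_id.
exact: smooth_map_at_cst.
Qed.

Lemma smooth_action_at g x : smooth_map_at A A (rho g) x.
Proof. exact: (smooth_map_at_comp hA hGA (smooth_translate g x) (srho (g, x))). Qed.

Lemma smooth_orbit x g : smooth_map_at AG A (fun g => rho g x) g.
Proof. exact: (smooth_map_at_comp hG hGA (smooth_slice g x) (srho (g, x))). Qed.

(** [mkcotangent] returns 0 unless its functional is linear on the tangent space; here it is a
    pullback along the smooth map [rho g^-1], which leads back to the base point of [q]. *)
Lemma cform_lift g (q : cotangent A) v : tangent A (rho g (cbase q)) v ->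
  cform (cot_lift rho g q) v =
  cform q (tmap A (rho g^-1%g) (rho g (cbase q)) v).
Proof.
move=> Tv; apply: cform_mkcotangent => //.
apply: (linear_on_tmap hA hA (smooth_action_at _ _)).
by rewrite actionK; exact: cform_linear.
Qed.

Lemma cot_lift1 (q : cotangent A) : cot_lift rho 1%g q = q.
Proof.
have E : rho 1%g = id by apply/funext => x; rewrite rho1.
apply: cot_ext => /=; first exact: rho1.
move=> v Tv; rewrite -[LHS]/(cform (cot_lift rho 1%g q) v) cform_lift//.
by rewrite invg1 E (tmap_id (A := A))//; rewrite E in Tv.
Qed.

Section local_expression.
Variables (cG : chart R G e) (c : chart R M d).
Hypotheses (AGcG : AG cG) (cG1 : cdom cG 1%g) (Ac : A c).

Definition action_loc : 'rV[R]_(e + d) -> 'rV[R]_d :=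
  loc (prod_chart cG c) (c \o (fun p => rho p.1 p.2)).

Definition inverse_loc : 'rV[R]_e -> 'rV[R]_e :=
  loc cG (cG \o (fun g => g^-1%g)).

Definition field_loc (u : 'rV[R]_e) (x : 'rV[R]_d) : 'rV[R]_d :=
  'D_(row_mx u 0) action_loc (row_mx (cG 1%g) x).

Definition lift_field_loc (u : 'rV[R]_e) (z : 'rV[R]_(d + d)) : 'rV[R]_(d + d) :=
  row_mx (field_loc u (lsubmx z))
    (\row_i - \sum_j 'D_(delta_mx 0 i) (fun x => field_loc u x 0 j : R^o) (lsubmx z) *
       rsubmx z 0 j).

Let F := action_loc.
Let I := inverse_loc.
Let K (w : 'rV[R]_(e + d)) := row_mx (I (lsubmx w)) (F w).

Let GAc : GA (prod_chart cG c).
Proof. exact: prod_atlas_chart. Qed.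

Let dom1 p : cdom c p -> cdom (prod_chart cG c) (1%g : G, p).
Proof. by []. Qed.

Let near_point p P : cdom c p -> mnbhs GA (1%g, p) P ->
  \forall w \near row_mx (cG 1%g) (c p),
    exists g m, [/\ cdom cG g, cdom c m, row_mx (cG g) (c m) = w & P (g, m)].
Proof.
move=> cp nP.
have d1 := dom1 cp.
have := (mnbhsP hGA _ GAc d1).1 nP.
have := open_nbhs_nbhs (conj (chart_open hGA GAc) (ex_intro2 _ _ (1%g, p) d1 erefl)).
apply: filterS2 => w [[g m] [/= dg dm] gmw] wP.
by exists g, m; split=> //; apply: wP.
Qed.

Lemma smooth_action_loc p : cdom c p ->
  smooth_at action_loc (row_mx (cG 1%g) (c p)).
Proof.
move=> cp; have cp' : cdom c (rho (1%g : G, p).1 (1%g : G, p).2) by rewrite /= rho1.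
have [_ s] := smooth_map_chart hGA hA (srho (1%g, p)) Ac cp'.
by have := (smooth_nearP hGA (@composable_row _ _) _ GAc (dom1 cp)).1 s.
Qed.

Let near_F p : cdom c p -> mnbhs GA (1%g, p)
  [set z | [/\ cdom (prod_chart cG c) z, cdom c (rho z.1 z.2) &
     F (row_mx (cG z.1) (c z.2)) = c (rho z.1 z.2)]].
Proof.
move=> cp; have cp' : cdom c (rho (1%g : G, p).1 (1%g : G, p).2) by rewrite /= rho1.
have [n _] := smooth_map_chart hGA hA (srho (1%g, p)) Ac cp'.
exact: (smooth_map_loc hGA Ac n GAc (dom1 cp)).
Qed.

Let cG1' : cdom cG 1^-1%g. Proof. by rewrite invg1. Qed.

Let sI : smooth_at I (cG 1%g).
Proof.
have [_ s] := smooth_map_chart hG hG sinv AGcG cG1'.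
by have := (smooth_nearP hG (@composable_row _ _) _ AGcG cG1).1 s.
Qed.

Let I1 : I (cG 1%g) = cG 1%g.
Proof. by rewrite /I /inverse_loc (loc_chart hG)//= invg1. Qed.

Let near_I p : mnbhs GA (1%g, p) [set z | I (cG z.1) = cG z.1^-1%g].
Proof.
have [n _] := smooth_map_chart hG hG sinv AGcG cG1'.
have H := smooth_map_loc hG AGcG n AGcG cG1.
have := smooth_map_nbhs hGA hG (smooth_fst hG hA (1%g, p)) H.
by apply: mnbhsS => z [].
Qed.

Let F1 p : cdom c p -> \forall x \near c p, F (row_mx (cG 1%g) x) = x.
Proof.
move=> cp; apply/(chart_near hA _ Ac cp); near=> x => q cq _ /=.
rewrite -[row_mx _ _]/(prod_chart cG c (1%g, q)).
by rewrite /F /action_loc (loc_chart hGA)//= rho1.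
Unshelve. all: by end_near. Qed.

Let smooth_swap p : smooth_map_at GA GA (fun z => (z.1^-1%g, rho z.1 z.2)) (1%g, p).
Proof.
apply: smooth_pair => //.
exact: (smooth_map_at_comp hGA hG (smooth_fst hG hA (1%g, p)) sinv).
Qed.

Let swap_nbhs p P : mnbhs GA (1%g, p) P ->
  mnbhs GA (1%g, p) [set z | P (z.1^-1%g, rho z.1 z.2)].
Proof.
move=> nP; apply: (smooth_map_nbhs hGA hGA (smooth_swap p)).
by rewrite /= invg1 rho1.
Qed.

(** This is [rho g^-1 (rho g x) = x] in coordinates. The swap (g, x) |-> (g^-1, g x) fixes (1, p),
    so all points involved stay in the charts. *)
Let FK p : cdom c p ->
  \forall w \near row_mx (cG 1%g) (c p), F (K w) = rsubmx w.
Proof.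
move=> cp.
have n := mnbhs_near hGA (mnbhs_near hGA (near_F cp) (swap_nbhs (near_F cp))) (near_I p).
apply: filterS (near_point cp n) => _ [g [m [_ _ <- [[[_ _ E1] [_ _ E2]] E3]]]].
rewrite /K row_mxKl row_mxKr E1 [I _]E3 [LHS]E2 /=.
by rewrite actionK.
Qed.

Lemma fundamental_coord p u : cdom c p ->
  fundamental A rho (coordvec AG cG 1%g u) p = coordvec A c p (field_loc u (c p)).
Proof.
move=> cp; have cp' : cdom c (rho 1%g p) by rewrite rho1.
have sF := smooth_action_loc cp.
have sr : smooth_at (fun s => row_mx s (c p)) (cG 1%g).
  by apply: smooth_at_row_mx; [exact: smooth_at_id|exact: smooth_at_cst].
rewrite /fundamental (tmap_expression (G := F \o (fun s => row_mx s (c p))) hG hA u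
  (smooth_orbit p 1%g) AGcG cG1 Ac cp'); last first.
  have := smooth_map_nbhs hG hGA (smooth_slice 1%g p) (near_F cp).
  by apply: mnbhsS => g [_ _ E] /=; rewrite [RHS]E.
rewrite rho1 derive_comp; [|exact: smooth_at_differentiable..].
rewrite derive_row_mx; [|exact: smooth_at_id|exact: smooth_at_cst].
by rewrite derive_id derive_cst.
Qed.

Let v k : 'rV[R]_(e + d) := row_mx 0 (delta_mx 0 k).

(** Coordinates of the lift by g of the covector (x0, y), as a function of the coordinates [s] of g.
    The point [K (row_mx s x0)] represents (g^-1, g x0), where the Jacobian of rho_(g^-1) has to be
    taken. *)
Let LG (x0 y : 'rV[R]_d) (s : 'rV[R]_e) : 'rV[R]_(d + d) :=
  row_mx (F (row_mx s x0)) (\row_i \sum_j 'D_(v i) F (K (row_mx s x0)) 0 j * y 0 j).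

Let near_smoothF p : cdom c p ->
  mnbhs GA (1%g, p) [set z | smooth_at F (row_mx (cG z.1) (c z.2))].
Proof.
move=> cp; have d1 := dom1 cp.
apply/(mnbhsP hGA _ GAc d1).
have := (chart_near hGA _ GAc d1).1 (smooth_at_near (smooth_action_loc cp)).
by apply.
Qed.

Let lift_near (q : cotangent A) : cdom c (cbase q) ->
  mnbhs AG 1%g [set g | cdom c (rho g (cbase q)) /\
    cot_chart A c (cot_lift rho g q) =
    LG (c (cbase q)) (rsubmx (cot_chart A c q)) (cG g)].
Proof.
move=> cq; set p := cbase q; set y := rsubmx _.
have nF := near_F cq.
have n1 := mnbhs_near hGA nF (near_I p).
have n2 := swap_nbhs (mnbhs_near hGA (mnbhs_mnbhs nF) (near_smoothF cq)).
have := smooth_map_nbhs hG hGA (smooth_slice 1%g p) (mnbhs_near hGA n1 n2).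
apply: mnbhsS => g [[[_ /= cgp E1] /= E2] [/= n3 sF]]; split=> //.
rewrite /LG /= E1; congr row_mx; apply/rowP => i; rewrite !mxE.
rewrite -[LHS]/(cform (cot_lift rho g q) (dcoord A c (rho g p) i)).
rewrite cform_lift; last exact: tangent_coordvec.
have cq' : cdom c (rho g^-1%g (rho g p)) by rewrite actionK.
have nE := smooth_map_nbhs hA hGA (smooth_translate g^-1%g (rho g p)) n3.
rewrite (tmap_expression (G := fun x => F (row_mx (cG g^-1%g) x)) hA hA _
  (smooth_action_at g^-1%g (rho g p)) Ac cgp Ac cq'); last first.
  by apply: mnbhsS nE => m [_ _ E] /=; rewrite [RHS]E.
rewrite actionK (cform_coordvec hA _ Ac cq).
have -> : K (row_mx (cG g) (c p)) = row_mx (cG g^-1%g) (c (rho g p)).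
  by rewrite /K row_mxKl [I _]E2 E1.
apply: eq_bigr => j _; apply: (congr1 (fun r : 'rV[R]_d => r 0 j * y 0 j)).
have sr : smooth_at (fun x => row_mx (cG g^-1%g) x) (c (rho g p)).
  by apply: smooth_at_row_mx; [exact: smooth_at_cst|exact: smooth_at_id].
rewrite (derive_comp (f := fun x => row_mx (cG g^-1%g) x) _
  (smooth_at_differentiable sr) (smooth_at_differentiable sF)).
rewrite derive_row_mx; [|exact: smooth_at_cst|exact: smooth_at_id].
by rewrite derive_cst derive_id.
Qed.

Let sr_slice (p : M) : smooth_at (fun s => row_mx s (c p)) (cG 1%g).
Proof.
by apply: smooth_at_row_mx; [exact: smooth_at_id|exact: smooth_at_cst].
Qed.

Let sDFK p i j : cdom c p ->
  smooth_at (fun w => 'D_(v i) F (K w) 0 j : R^o) (row_mx (cG 1%g) (c p)).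
Proof.
move=> cp; have sF := smooth_action_loc cp.
have sK : smooth_at K (row_mx (cG 1%g) (c p)).
  apply: smooth_at_row_mx => //; apply: smooth_at_comp.
    exact: smooth_at_lsubmx.
  by rewrite row_mxKl.
apply: ((smooth_at_coord ('D_(v i) F \o K) _).1 _ j).
apply: smooth_at_comp => //; rewrite /K row_mxKl I1 (nbhs_singleton (F1 cp)).
exact: smooth_at_derive.
Qed.

Let sLG_term p (y : 'rV[R]_d) i j : cdom c p -> smooth_at
  (fun s => ('D_(v i) F (K (row_mx s (c p))) 0 j : R^o) * (y 0 j : R^o) : R^o)
  (cG 1%g).
Proof.
move=> cp; apply: smooth_atM; last exact: smooth_at_cst.
exact: (composable_scalar (sr_slice p) (sDFK i j cp)).
Qed.

Let sLG_row p (y : 'rV[R]_d) : cdom c p -> smooth_at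
  (fun s => \row_i \sum_j 'D_(v i) F (K (row_mx s (c p))) 0 j * y 0 j : 'rV[R]_d)
  (cG 1%g).
Proof.
move=> cp; apply/smooth_at_coord => i.
apply: (@smooth_at_ext _ _ _ (fun s => \sum_j
  ('D_(v i) F (K (row_mx s (c p))) 0 j : R^o) * (y 0 j : R^o) : R^o)).
  by move=> s; rewrite mxE.
by apply: smooth_at_sum => j; exact: sLG_term.
Qed.

Let sLG p y : cdom c p -> smooth_at (LG (c p) y) (cG 1%g).
Proof.
move=> cp; apply: smooth_at_row_mx; last exact: sLG_row.
exact: (composable_row (sr_slice p) (smooth_action_loc cp)).
Qed.

Let derive_slice {W : normedModType R} (f : 'rV[R]_(e + d) -> W) p u :
  differentiable f (row_mx (cG 1%g) (c p)) ->
  'D_u (fun s => f (row_mx s (c p))) (cG 1%g) =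
  'D_(row_mx u 0) f (row_mx (cG 1%g) (c p)).
Proof.
move=> df; rewrite (derive_comp (f := fun s => row_mx s (c p)) _
  (smooth_at_differentiable (sr_slice p)) df).
rewrite derive_row_mx; [|exact: smooth_at_id|exact: smooth_at_cst].
by rewrite derive_id derive_cst.
Qed.

(** The position part is the field on M by definition; in the momentum part [y] is constant, and
    [derive_inverse_flow] supplies the minus sign and the Jacobian of the field. *)
Let derive_LG p y u : cdom c p ->
  'D_u (LG (c p) y) (cG 1%g) = lift_field_loc u (row_mx (c p) y).
Proof.
move=> cp; have sF := smooth_action_loc cp.
have sFs := composable_row (sr_slice p) sF.
rewrite (derive_row_mx _ sFs (sLG_row y cp)) /lift_field_loc row_mxKl row_mxKr.
rewrite (derive_slice _ (smooth_at_differentiable sF)).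
congr row_mx; apply/rowP => i.
rewrite derive_coord; last exact/smooth_at_differentiable/sLG_row.
rewrite (_ : _ \o _ = fun s => \sum_j
  ('D_(v i) F (K (row_mx s (c p))) 0 j : R^o) * (y 0 j : R^o) : R^o); last first.
  by apply/funext => s; rewrite /= /coordf mxE.
rewrite (derive_sumf _ (fun j => smooth_at_differentiable (sLG_term y i j cp))).
rewrite mxE; transitivity (\sum_j
  - ('D_(delta_mx 0 i) (fun x => field_loc u x 0 j : R^o) (c p) * (y 0 j : R^o))).
  apply: eq_bigr => j _.
  have sDFKs := composable_scalar (sr_slice p) (sDFK i j cp).
  rewrite (derive_mulf _ (smooth_at_differentiable sDFKs)
    (smooth_at_differentiable (smooth_at_cst (y 0 j : R^o) _))).
  rewrite (derive_cst (y 0 j : R^o)) mulr0 add0r mulrC.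
  rewrite (derive_slice _ (smooth_at_differentiable (sDFK i j cp))).
  rewrite (derive_inverse_flow sF sI I1 (F1 cp) (FK cp)).
  exact: mulNr.
exact: sumrN.
Qed.

Lemma smooth_lift_orbit (q : cotangent A) : cdom c (cbase q) ->
  smooth_map_at AG TA (fun g => cot_lift rho g q) 1%g.
Proof.
move=> cq; apply: (smooth_map_intro hG AGcG cG1 (cot_atlas_chart Ac) _
  (sLG (rsubmx (cot_chart A c q)) cq)).
by apply: mnbhsS (lift_near cq) => g [d1 E]; split; [exact: d1|rewrite E].
Qed.

Lemma fundamental_lift (q : cotangent A) u : cdom c (cbase q) ->
  fundamental TA (cot_lift rho) (coordvec AG cG 1%g u) q =
  coordvec TA (cot_chart A c) q (lift_field_loc u (cot_chart A c q)).
Proof.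
move=> cq; have cq' : cdom (cot_chart A c) (cot_lift rho 1%g q).
  by rewrite cot_lift1.
rewrite /fundamental (tmap_expression (G := LG (c (cbase q)) (rsubmx (cot_chart A c q)))
  hG hTA u (smooth_lift_orbit cq) AGcG cG1 (cot_atlas_chart Ac) cq'); last first.
  by apply: mnbhsS (lift_near cq) => g [].
by rewrite cot_lift1 (derive_LG _ _ cq) /= row_mxKr.
Qed.

Lemma smooth_field_loc u p : cdom c p -> smooth_at (field_loc u) (c p).
Proof.
move=> cp; apply: (@composable_row _ _ _ _ (fun x => row_mx (cG 1%g) x)
   ('D_(row_mx u 0) action_loc)).
  by apply: smooth_at_row_mx; [exact: smooth_at_cst|exact: smooth_at_id].
exact/smooth_at_derive/smooth_action_loc.
Qed.

Lemma smooth_lift_field_loc u (q : cotangent A) : cdom c (cbase q) ->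
  smooth_at (lift_field_loc u) (cot_chart A c q).
Proof.
move=> cq; have sX : smooth_at (field_loc u) (lsubmx (cot_chart A c q)).
  by rewrite /= row_mxKl; exact: smooth_field_loc.
apply: smooth_at_row_mx.
  by apply: smooth_at_comp => //; exact: smooth_at_lsubmx.
apply/smooth_at_coord => i.
apply: (@smooth_at_ext _ _ _ (fun z : 'rV[R]_(d + d) => \sum_j
  (-1 : R^o) * (('D_(delta_mx 0 i) (fun x => field_loc u x 0 j : R^o) (lsubmx z) : R^o) *
       (rsubmx z 0 j : R^o) : R^o) : R^o)).
  by move=> z; rewrite mxE -mulr_sumr mulN1r.
apply: smooth_at_sum => j; apply: smooth_atM; first exact: smooth_at_cst.
apply: smooth_atM; last first.
  exact: ((smooth_at_coord (@rsubmx R 1 d d) _).1 (smooth_at_rsubmx _) j).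
apply: (@composable_scalar _ _ _ (@lsubmx R 1 d d)
  ('D_(delta_mx 0 i) (fun x => field_loc u x 0 j : R^o))).
  exact: smooth_at_lsubmx.
exact/smooth_at_derive/((smooth_at_coord _ _).1 sX).
Qed.

End local_expression.
End lifted_actions.

(** * The twisted b-symplectic form *)

Lemma subr_add_cancel {V : zmodType} (x y z t : V) :
  z = t -> x + z - (y + t) = x - y.
Proof. by move=> ->; rewrite opprD addrACA subrr addr0. Qed.

(** * Chart independence of the exterior derivative of a one-form *)

Section exterior_derivative.
Context {R : realType} {M : Type} {d : nat} {A : atlas R M d}.
Hypothesis hA : compatible A.
Variables (alpha : M -> functional R M -> R^o) (q : M).

(** The expression alpha = sum a_i dx_i holds in a whole neighbourhood of [q], as it is going to be
    differentiated at [q]. Differentiability at the point, rather than smoothness, is all that is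
    recorded. *)
Definition coframe_coef (c : chart R M d) (a : 'I_d -> 'rV[R]_d -> R^o) : Prop :=
  (forall i, differentiable (a i) (c q)) /\
  mnbhs A q [set p | forall u,
    alpha p (coordvec A c p u) = \sum_i (a i (c p) * u 0 i : R^o)].

Lemma derive_form c a u u' : A c -> cdom c q -> coframe_coef c a ->
  'D_u (loc c (fun p => alpha p (coordvec A c p u'))) (c q) =
  \sum_i ('D_u (a i) (c q) * u' 0 i : R^o).
Proof.
move=> Ac cq [da na].
rewrite (derive_loc hA (G := fun x => \sum_i (a i x * u' 0 i : R^o)) _ Ac cq); last first.
  by apply: mnbhsS na => p; exact.
have dc i : differentiable (fun=> u' 0 i : R^o) (c q).
  exact/smooth_at_differentiable/smooth_at_cst.
rewrite (derive_sumf _ (fun i => differentiable_mulf (da i) (dc i))).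
apply: eq_bigr => i _; rewrite (derive_mulf _ (da i) (dc i)).
by rewrite (derive_cst (u' 0 i : R^o)) mulr0 add0r mulrC.
Qed.

Definition ext_coef (a : 'I_d -> 'rV[R]_d -> R^o) (x u u' : 'rV[R]_d) : R^o :=
  \sum_i ('D_u (a i) x * u' 0 i : R^o) - \sum_i ('D_u' (a i) x * u 0 i : R^o).

(** Leibniz splits the derivative into a first-order part, which is the pullback of the coefficient
    derivatives, and a part with the second derivatives of [f]. The latter is symmetric in [u] and
    [u'] and cancels after antisymmetrization. *)
Lemma derive_pullback n (f : 'rV[R]_n -> 'rV[R]_d) (a : 'I_d -> 'rV[R]_d -> R^o)
    (x u u' : 'rV[R]_n) :
  smooth_at f x -> (forall j, differentiable (a j) (f x)) ->
  'D_u (fun y => \sum_j (a j (f y) * 'D_u' f y 0 j : R^o)) x =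
  \sum_j ('D_('D_u f x) (a j) (f x) * 'D_u' f x 0 j : R^o) +
  \sum_j (a j (f x) * 'D_u ('D_u' (fun y => f y 0 j : R^o)) x : R^o).
Proof.
move=> sf da; have df := smooth_at_differentiable sf.
have daf j : differentiable (a j \o f) x by exact: differentiable_comp.
have sDf j : smooth_at (fun y => 'D_u' f y 0 j : R^o) x.
  exact: ((smooth_at_coord _ _).1 (smooth_at_derive u' sf)).
have dDf j := smooth_at_differentiable (sDf j).
rewrite (derive_sumf _ (fun j => differentiable_mulf (daf j) (dDf j))) -big_split/=.
apply: eq_bigr => j _; rewrite (derive_mulf _ (daf j) (dDf j)) addrC.
rewrite (derive_comp _ df (da j)).
apply: (congr2 +%R); last exact: mulrC.
apply: (congr1 (fun r : R^o => a j (f x) * r)).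
apply: near_eq_derive; apply: filterS (smooth_at_near sf) => y sfy.
exact: (derive_coord _ _ (smooth_at_differentiable sfy)).
Qed.

Lemma ext_coef_change c c' a a' u u' : A c -> A c' -> cdom c q -> cdom c' q ->
  coframe_coef c a -> coframe_coef c' a' ->
  ext_coef a (c q) u u' =
  ext_coef a' (c' q) ('D_u (loc c c') (c q)) ('D_u' (loc c c') (c q)).
Proof.
move=> Ac Ac' cq c'q Ha Ha'; pose f := loc c c'.
have sf : smooth_at f (c q) := transition_smooth hA Ac Ac' cq c'q.
have fq : f (c q) = c' q by rewrite /f (loc_chart hA).
have [da na] := Ha; have [da' na'] := Ha'.
have da'f j : differentiable (a' j) (f (c q)) by rewrite fq.
have E (w : 'rV[R]_d) : \forall x \near c q,
    \sum_i (a i x * w 0 i : R^o) = \sum_j (a' j (f x) * 'D_w f x 0 j : R^o).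
  apply/(chart_near hA _ Ac cq).
  have n := mnbhs_near hA (mnbhs_near hA na na')
    (mnbhs_near hA (mnbhs_chart hA Ac cq) (mnbhs_chart hA Ac' c'q)).
  apply: filterS ((mnbhsP hA _ Ac cq).1 n) => x xP p cp px.
  have [[Ea Ea'] [_ c'p]] := xP p cp px.
  by rewrite -Ea (coordvec_change hA _ Ac' Ac c'p cp) Ea' /f (loc_chart hA).
have D (w w' : 'rV[R]_d) : \sum_i ('D_w (a i) (c q) * w' 0 i : R^o) =
    'D_w (fun x => \sum_j (a' j (f x) * 'D_w' f x 0 j : R^o)) (c q).
  rewrite -(near_eq_derive _ (E w')).
  have dc i : differentiable (fun=> w' 0 i : R^o) (c q).
    exact/smooth_at_differentiable/smooth_at_cst.
  rewrite (derive_sumf _ (fun i => differentiable_mulf (da i) (dc i))).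
  apply: eq_bigr => i _; rewrite (derive_mulf _ (da i) (dc i)).
  by rewrite (derive_cst (w' 0 i : R^o)) mulr0 add0r mulrC.
have E1 := etrans (D u u') (derive_pullback u u' sf da'f).
have E2 := etrans (D u' u) (derive_pullback u' u sf da'f).
rewrite -fq; apply: etrans (congr2 (fun r t : R^o => r - t) E1 E2) _.
apply: subr_add_cancel; apply: eq_bigr => j _.
apply: (congr1 (fun r : R^o => a' j (f (c q)) * r)).
exact: derive_swap ((smooth_at_coord _ _).1 sf j).
Qed.

(** [ext_d] picks a value through an unspecified chart. The hypothesis provides coefficients in
    every chart, and [ext_coef_change] shows that all candidates coincide. *)
Lemma ext_d_coord c a u u' :
  (forall c', A c' -> cdom c' q -> exists a', coframe_coef c' a') ->
  A c -> cdom c q -> coframe_coef c a ->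
  ext_d A alpha q (coordvec A c q u) (coordvec A c q u') = ext_coef a (c q) u u'.
Proof.
move=> hex Ac cq Ha; have extE k (w w' : 'rV[R]_d) b (Ak : A k) (kq : cdom k q) (Hb : coframe_coef k b) :
  'D_w (loc k (fun p => alpha p (coordvec A k p w'))) (k q)
  - 'D_w' (loc k (fun p => alpha p (coordvec A k p w))) (k q) =
  ext_coef b (k q) w w'.
  exact: (congr2 (fun r t : R^o => r - t) (derive_form w w' Ak kq Hb)
    (derive_form w' w Ak kq Hb)).
rewrite /ext_d; case: xgetP => [r _|nex]; last first.
  case: (nex (ext_coef a (c q) u u')); exists c, u, u'; split=> //.
  exact/esym/extE.
move=> [c' [w [w' [Ac' c'q uw uw' ->]]]]; have [a' Ha'] := hex _ Ac' c'q.
apply: etrans (extE _ w w' a' Ac' c'q Ha') _.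
have -> : w = 'D_u (loc c c') (c q).
  apply: (coordvec_inj hA Ac' c'q).
  by rewrite -uw -(coordvec_change hA u Ac' Ac c'q cq).
have -> : w' = 'D_u' (loc c c') (c q).
  apply: (coordvec_inj hA Ac' c'q).
  by rewrite -uw' -(coordvec_change hA u' Ac' Ac c'q cq).
exact/esym/ext_coef_change.
Qed.

End exterior_derivative.

Section atlas_supplements.
Context {R : realType} {M : Type} {d : nat} {A : atlas R M d}.
Hypothesis hA : compatible A.

Lemma coordvecZ c p a u : A c -> cdom c p ->
  coordvec A c p (a *: u) = a *: coordvec A c p u.
Proof.
move=> Ac cp; have := coordvec_linear hA a u 0 Ac cp.
by rewrite (coordvec0 hA Ac cp) !addr0.
Qed.

Lemma linear_on_coordvec c p (phi : functional R M -> R^o) : A c -> cdom c p ->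
  (forall a u w, phi (coordvec A c p (a *: u + w)) =
     a * phi (coordvec A c p u) + phi (coordvec A c p w)) ->
  linear_on A p phi.
Proof.
move=> Ac cp lphi a _ _ /(tangentP hA _ Ac cp)[u ->] /(tangentP hA _ Ac cp)[w ->] _.
by rewrite -(coordvec_linear hA a u w Ac cp); exact: lphi.
Qed.

Lemma coordvec_expression c p u (g : M -> R^o) (G : 'rV[R]_d -> R^o) :
  A c -> cdom c p -> mnbhs A p [set q | g q = G (c q)] -> smooth_at G (c p) ->
  coordvec A c p u g = 'D_u G (c p).
Proof.
move=> Ac cp ng sG; rewrite coordvecE; first exact: derive_loc ng.
exact: (smooth_near_expression hA composable_scalar Ac cp ng sG).
Qed.

End atlas_supplements.

Section product_inclusions.
Context {R : realType} {M M' : Type} {d e : nat}.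
Context {A : atlas R M d} {B : atlas R M' e}.
Hypotheses (hA : compatible A) (hB : compatible B).
Let AB := prod_atlas A B.
Let hAB : compatible AB := prod_compatible hA hB.

Lemma smooth_incl1 x y : smooth_map_at A AB (fun z => (z, y)) x.
Proof.
by apply: smooth_pair => //; [exact: smooth_map_at_id|exact: smooth_map_at_cst].
Qed.

Lemma smooth_incl2 x y : smooth_map_at B AB (fun z => (x, z)) y.
Proof.
by apply: smooth_pair => //; [exact: smooth_map_at_cst|exact: smooth_map_at_id].
Qed.

Lemma tmap_incl1 a b x y u : A a -> B b -> cdom a x -> cdom b y ->
  tmap AB (fun z => (z, y)) x (coordvec A a x u) =
  coordvec AB (prod_chart a b) (x, y) (row_mx u 0).
Proof.
move=> Aa Bb ax bby; have ABc := prod_atlas_chart Aa Bb.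
have cxy : cdom (prod_chart a b) (x, y) by [].
rewrite (tmap_expression (G := fun s => row_mx s (b y)) hA hAB u (smooth_incl1 x y)
  Aa ax ABc cxy); last exact: mnbhsS (mnbhs_chart hA Aa ax).
rewrite derive_row_mx; [|exact: smooth_at_id|exact: smooth_at_cst].
by rewrite derive_id derive_cst.
Qed.

Lemma tmap_incl2 a b x y u : A a -> B b -> cdom a x -> cdom b y ->
  tmap AB (fun z => (x, z)) y (coordvec B b y u) =
  coordvec AB (prod_chart a b) (x, y) (row_mx 0 u).
Proof.
move=> Aa Bb ax bby; have ABc := prod_atlas_chart Aa Bb.
have cxy : cdom (prod_chart a b) (x, y) by [].
rewrite (tmap_expression (G := fun s => row_mx (a x) s) hB hAB u (smooth_incl2 x y)
  Bb bby ABc cxy); last exact: mnbhsS (mnbhs_chart hB Bb bby).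
rewrite derive_row_mx; [|exact: smooth_at_cst|exact: smooth_at_id].
by rewrite derive_id derive_cst.
Qed.

Lemma linear_cot_fst (q : cotangent AB) : linear_on A (cbase q).1
  (fun v => cform q (tmap AB (fun z => (z, (cbase q).2)) (cbase q).1 v)).
Proof.
apply: (linear_on_tmap hA hAB (smooth_incl1 _ _)).
by rewrite -surjective_pairing; exact: cform_linear.
Qed.

Lemma linear_cot_snd (q : cotangent AB) : linear_on B (cbase q).2
  (fun v => cform q (tmap AB (fun z => ((cbase q).1, z)) (cbase q).2 v)).
Proof.
apply: (linear_on_tmap hB hAB (smooth_incl2 _ _)).
by rewrite -surjective_pairing; exact: cform_linear.
Qed.

Lemma cform_fst (q : cotangent AB) v : tangent A (cbase q).1 v ->
  cform (cot_fst q) v = cform q (tmap AB (fun z => (z, (cbase q).2)) (cbase q).1 v).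
Proof. by move=> Tv; apply: cform_mkcotangent => //; exact: linear_cot_fst. Qed.

Lemma cform_snd (q : cotangent AB) v : tangent B (cbase q).2 v ->
  cform (cot_snd q) v = cform q (tmap AB (fun z => ((cbase q).1, z)) (cbase q).2 v).
Proof. by move=> Tv; apply: cform_mkcotangent => //; exact: linear_cot_snd. Qed.

Section coordinates.
Variables (a : chart R M d) (b : chart R M' e) (q : cotangent AB).
Hypotheses (Aa : A a) (Bb : B b).
Hypotheses (aq : cdom a (cbase q).1) (bq : cdom b (cbase q).2).
Let y := rsubmx (cot_chart AB (prod_chart a b) q).

Lemma cform_fst_coord u : cform (cot_fst q) (coordvec A a (cbase q).1 u) =
  \sum_i u 0 i * y 0 (lshift e i).
Proof.
rewrite cform_fst; last exact: tangent_coordvec.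
rewrite (tmap_incl1 u Aa Bb aq bq) -surjective_pairing.
rewrite (cform_coordvec hAB _ (prod_atlas_chart Aa Bb))// big_split_ord/=.
rewrite [X in _ + X]big1 ?addr0 => [|i _]; last by rewrite row_mxEr mxE mul0r.
by apply: eq_bigr => i _; rewrite row_mxEl.
Qed.

Lemma cform_snd_coord u : cform (cot_snd q) (coordvec B b (cbase q).2 u) =
  \sum_i u 0 i * y 0 (rshift d i).
Proof.
rewrite cform_snd; last exact: tangent_coordvec.
rewrite (tmap_incl2 u Aa Bb aq bq) -surjective_pairing.
rewrite (cform_coordvec hAB _ (prod_atlas_chart Aa Bb))// big_split_ord/=.
rewrite [X in X + _]big1 ?add0r => [|i _]; last by rewrite row_mxEl mxE mul0r.
by apply: eq_bigr => i _; rewrite row_mxEr.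
Qed.

End coordinates.
End product_inclusions.

Lemma derive_real_comp {R : realType} {V : normedModType R} (h : R^o -> R^o)
    (f : V -> R^o) x u (dh : R^o) :
  differentiable f x -> is_derive (f x) (1 : R^o) h dh ->
  differentiable (h \o f) x /\ 'D_u (h \o f) x = dh * 'D_u f x.
Proof.
move=> df hdh; have dh' : differentiable h (f x).
  by apply/derivable1_diffP; case: hdh.
split; first exact: differentiable_comp.
rewrite (deriveE _ (differentiable_comp df dh')) (diff_comp df dh') (deriveE _ df) /=.
have -> : dh = 'd h (f x) 1 by rewrite -deriveE//; case: hdh.
rewrite -[in LHS](mulr1 ('d f x u)) -[_ * 1]/(_ *: 1) linearZ.
exact: mulrC.
Qed.

Lemma is_derive_ln_norm {R : realType} (t : R) : t != 0 ->
  is_derive (t : R^o) (1 : R^o) (fun t : R^o => ln `|t| : R^o) (t^-1).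
Proof.
rewrite neq_lt => /orP[t0|t0].
  have : is_derive (t : R) (1 : R) (fun s : R => ln (- s)) (t^-1).
    have h1 : is_derive (- t) (1 : R) (@ln R) (- t)^-1.
      by apply: is_derive1_ln; rewrite oppr_gt0.
    have h2 := is_derive1_comp h1 (is_deriveNid t 1).
    by apply: is_derive_eq h2 _; rewrite invrN mulrNN mulr1.
  apply: near_eq_is_derive.
  have : \forall s \near (t : R), s < 0 by exact: lt_nbhsl.
  by apply: filterS => s s0; rewrite ltr0_norm.
have : is_derive (t : R) (1 : R) (@ln R) (t^-1) by exact: is_derive1_ln.
apply: near_eq_is_derive.
have : \forall s \near (t : R), 0 < s by exact: lt_nbhsr.
by apply: filterS => s s0; rewrite gtr0_norm.
Qed.

Lemma smooth_at_neq0 {R : realType} {V W : normedModType R} (f : V -> W) x :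
  smooth_at f x -> f x != 0 -> \forall y \near x, f y != 0.
Proof. by move=> /smooth_at_continuous cf; exact: cvgr_neq0. Qed.

Lemma split_lshiftE m n (i : 'I_m) : fintype.split (lshift n i) = inl i.
Proof. exact: unsplitK (inl i). Qed.

Lemma split_rshiftE m n (i : 'I_n) : fintype.split (rshift m i) = inr i.
Proof. exact: unsplitK (inr i). Qed.

Section twisted_form.
Context {R : realType} {N : Type} {m : nat} {AN : atlas R N m}.
Hypothesis hN : compatible AN.
Let C := circle_atlas R.
Let AM := prod_atlas C AN.
Let TM := cot_atlas AM.
Let hC : compatible C := @circle_compatible R.
Let hM : compatible AM := prod_compatible hC hN.
Let hT : compatible TM := cot_compatible hM.
Implicit Types (q : cotangent AM).

(** Both sides are the tangent map of one composite, [cbase \o cot_snd = snd \o cbase], split at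
    different places; [tmap_comp] asks for smoothness of the outer factor, [cbase] or [snd]. *)
Lemma liouville_sndE q v :
  liouville (cot_snd q) (tmap (cot_atlas AN) (fun q => cot_snd q) q v) =
  cform (cot_snd q) (tmap AN snd (cbase q) (tmap AM (@cbase _ _ _ AM) q v)).
Proof.
rewrite /liouville -(tmap_comp hM hN v (smooth_snd hC hN (cbase q))).
by rewrite -(tmap_comp (cot_compatible hN) hN (f := fun q => cot_snd q) v
  (smooth_cbase hN (cot_snd q))).
Qed.

Lemma dtheta_fstE q v :
  dtheta (cbase (cot_fst q)) (tmap C (fun q => cbase (cot_fst q)) q v) =
  tmap C fst (cbase q) (tmap AM (@cbase _ _ _ AM) q v) (angle (cbase q).1).
Proof. by rewrite -(tmap_comp hM hC v (smooth_fst hC hN (cbase q))). Qed.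

Lemma twisted_liouvilleE q v :
  twisted_liouville q v =
  (lne `|a_coord q|%:E *
     (tmap C fst (cbase q) (tmap AM (@cbase _ _ _ AM) q v)
        (angle (cbase q).1))%:E +
   (cform (cot_snd q)
      (tmap AN snd (cbase q) (tmap AM (@cbase _ _ _ AM) q v)))%:E)%E.
Proof. by rewrite /twisted_liouville dtheta_fstE liouville_sndE. Qed.

Section coordinates.
Variables (z0 : circle R) (b : chart R N m).
Hypothesis ANb : AN b.
Let c := prod_chart (angle_chart z0) b.
Let X := cot_chart AM c.

Lemma angle_chart_atlas : C (angle_chart z0). Proof. by exists z0. Qed.

Lemma adapted_atlas : AM c.
Proof. exact: prod_atlas_chart angle_chart_atlas ANb. Qed.

Lemma cot_adapted_atlas : TM X.
Proof. exact: cot_atlas_chart adapted_atlas. Qed.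

Section at_point.
Variable q : cotangent AM.
Hypothesis cq : cdom c (cbase q).
Let y := rsubmx (X q).

Lemma a_coordE : a_coord q = y 0 (lshift m 0).
Proof.
have [d1 d2] := cq.
rewrite /a_coord /fiber_a -[cbase (cot_fst q)]/((cbase q).1) /dcoord.
rewrite (circle_coordvec _ d1 (angle_chart_self _)).
rewrite (cform_fst_coord hC hN angle_chart_atlas ANb d1 d2) big_ord1.
by rewrite mxE mul1r.
Qed.

Lemma twisted_liouville_coord w :
  twisted_liouville q (coordvec TM X q w) =
  (lne `|y 0 (lshift m 0)|%:E * (w 0 (lshift _ (lshift m 0)))%:E +
   (\sum_i w 0 (lshift _ (rshift 1 i)) * y 0 (rshift 1 i))%:E)%E.
Proof.
have [d1 d2] := cq.
rewrite twisted_liouvilleE a_coordE (tmap_cbase hM w adapted_atlas cq).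
rewrite (tmap_fst hC hN _ angle_chart_atlas ANb d1 d2).
rewrite (circle_coordvec_angle _ d1).
rewrite (tmap_snd hC hN _ angle_chart_atlas ANb d1 d2).
rewrite (cform_snd_coord hC hN angle_chart_atlas ANb d1 d2) !mxE.
congr (_ * _ + _%:E)%E.
by apply: eq_bigr => i _; rewrite !mxE.
Qed.

End at_point.

(* Coordinates on T*M are ordered (x_0 = theta, x_i, y_0 = a, y_i), so that the
   index of a is [rshift (1 + m) (lshift m 0)]. *)
Definition liouville_coef (k : 'I_((1 + m) + (1 + m)))
    (x : 'rV[R]_((1 + m) + (1 + m))) : R^o :=
  match fintype.split k with
  | inl i => match fintype.split i with
             | inl _ => ln `|rsubmx x 0 i|
             | inr _ => rsubmx x 0 i
             end
  | inr _ => 0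
  end.

(** The derivative of the i-th coefficient of lambda in its own variable y_i, hence the coefficient
    of dx_i /\ dy_i in omega: 1/a for the angle, 1 otherwise. *)
Definition liouville_dcoef (i : 'I_(1 + m)) (t : R^o) : R^o :=
  match fintype.split i with inl _ => t^-1 | inr _ => 1 end.

(** Off Z the logarithm is finite, so the extended-real expression is an ordinary real sum. *)
Lemma fine_twisted_liouville q w : cdom c (cbase q) -> a_coord q != 0 ->
  fine (twisted_liouville q (coordvec TM X q w)) =
  \sum_k (liouville_coef k (X q) * w 0 k : R^o).
Proof.
move=> cq a0; rewrite (twisted_liouville_coord cq).
rewrite (a_coordE cq) in a0.
rewrite lne_EFin ?normr_gt0// -EFinM -EFinD /=.
rewrite big_split_ord /= [X in _ = _ + X]big1 ?addr0; last first.
  by move=> i _; rewrite /liouville_coef split_rshiftE mul0r.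
rewrite big_split_ord /= big_ord1 /liouville_coef !split_lshiftE.
congr (_ + _); apply: eq_bigr => i _.
by rewrite split_lshiftE split_rshiftE mulrC.
Qed.

(** Each coefficient depends on a single momentum coordinate, and those of the dy_i are 0; hence one
    term survives in each derivative. *)
Lemma derive_liouville_coef k (x u : 'rV[R]_((1 + m) + (1 + m))) :
  rsubmx x 0 (lshift m 0) != 0 ->
  differentiable (liouville_coef k) x /\
  'D_u (liouville_coef k) x =
    match fintype.split k with
    | inl i => liouville_dcoef i (rsubmx x 0 i) * rsubmx u 0 i
    | inr _ => 0
    end.
Proof.
move=> x0; case: (split_ordP k) => i ->; rewrite ?split_lshiftE ?split_rshiftE.
  have sr : smooth_at (fun x : 'rV[R]_((1 + m) + (1 + m)) => rsubmx x 0 i : R^o) x.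
    exact: ((smooth_at_coord (@rsubmx R 1 _ _) x).1 (smooth_at_rsubmx x) i).
  have dr := smooth_at_differentiable sr.
  have Dr : 'D_u (fun x : 'rV[R]_((1 + m) + (1 + m)) => rsubmx x 0 i : R^o) x =
      rsubmx u 0 i.
    rewrite -(derive_rsubmx x u).
    exact/esym/derive_coord/smooth_at_differentiable/smooth_at_rsubmx.
  rewrite -Dr; case: (split_ordP i) => j iE; last first.
    have -> : liouville_coef (lshift (1 + m) i) =
        (fun x : 'rV[R]_((1 + m) + (1 + m)) => rsubmx x 0 i : R^o).
      apply/funext => z; rewrite /liouville_coef split_lshiftE iE.
      by rewrite split_rshiftE.
    by rewrite /liouville_dcoef iE split_rshiftE mul1r -iE.
  have -> : liouville_coef (lshift (1 + m) i) = (fun t : R^o => ln `|t| : R^o) \o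
      (fun x : 'rV[R]_((1 + m) + (1 + m)) => rsubmx x 0 i : R^o).
    apply/funext => z; rewrite /liouville_coef split_lshiftE iE.
    by rewrite split_lshiftE.
  have -> : liouville_dcoef i (rsubmx x 0 i) = (rsubmx x 0 i)^-1.
    by rewrite /liouville_dcoef iE split_lshiftE.
  apply: derive_real_comp => //; apply: is_derive_ln_norm.
  by rewrite iE (ord1 j).
have -> : liouville_coef (rshift (1 + m) i) = fun=> 0.
  by apply/funext => z; rewrite /liouville_coef split_rshiftE.
split; first exact/smooth_at_differentiable/smooth_at_cst.
exact: (derive_cst (0 : R^o)).
Qed.

Lemma near_nonzero_momentum q : cdom c (cbase q) -> a_coord q != 0 ->
  mnbhs TM q [set q' | cdom c (cbase q') /\ a_coord q' != 0].
Proof.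
move=> cq a0; apply/(mnbhsP hT _ cot_adapted_atlas cq).
have sr : smooth_at (fun x : 'rV[R]_((1 + m) + (1 + m)) =>
    rsubmx x 0 (lshift m 0) : R^o) (X q).
  exact: ((smooth_at_coord (@rsubmx R 1 _ _) _).1 (smooth_at_rsubmx _) _).
have n0 : \forall x \near X q, (rsubmx x 0 (lshift m 0) : R^o) != 0.
  by apply: (smooth_at_neq0 sr); rewrite -(a_coordE cq).
by apply: filterS n0 => x x0 q' cq' Xx; rewrite /mkset (a_coordE cq') Xx.
Qed.

Lemma liouville_coframe q : cdom c (cbase q) -> a_coord q != 0 ->
  coframe_coef (A := TM) (fun q v => fine (twisted_liouville q v)) q X liouville_coef.
Proof.
move=> cq a0; split.
  by move=> k; apply: (derive_liouville_coef k 0 _).1; rewrite -(a_coordE cq).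
apply: mnbhsS (near_nonzero_momentum cq a0) => q' [cq' a0'] w.
exact: fine_twisted_liouville.
Qed.

End coordinates.

Lemma cot_atlasE X : TM X <-> exists z0 b,
  AN b /\ X = cot_chart AM (prod_chart (angle_chart z0) b).
Proof.
split=> [[_ [_ [b [[z0 _ <-] ANb ->]]] <-]|[z0 [b [ANb ->]]]]; first by exists z0, b.
exact: cot_adapted_atlas.
Qed.

Lemma cot_chart_at q : exists z0 b,
  AN b /\ cdom (prod_chart (angle_chart z0) b) (cbase q).
Proof.
have [b ANb bq] : exists2 b, AN b & cdom b (cbase q).2 by case: hN.
by exists (cbase q).1, b; split=> //; split=> //; exact: angle_chart_self.
Qed.

(* Value of the twisted form on vectors w and w' at a point with coordinates x. *)
Definition symplectic_sum (x w w' : 'rV[R]_((1 + m) + (1 + m))) : R^o :=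
  \sum_i (liouville_dcoef i (rsubmx x 0 i) *
    (lsubmx w 0 i * rsubmx w' 0 i - rsubmx w 0 i * lsubmx w' 0 i) : R^o).

Lemma ext_coef_liouville (x w w' : 'rV[R]_((1 + m) + (1 + m))) :
  rsubmx x 0 (lshift m 0) != 0 ->
  ext_coef liouville_coef x w w' = - symplectic_sum x w w'.
Proof.
move=> x0; have E (u u' : 'rV[R]_((1 + m) + (1 + m))) : \sum_k ('D_u (liouville_coef k) x * u' 0 k : R^o) =
    \sum_i (liouville_dcoef i (rsubmx x 0 i) * rsubmx u 0 i * lsubmx u' 0 i : R^o).
  rewrite big_split_ord /= [X in _ + X]big1 ?addr0.
    apply: eq_bigr => i _; rewrite (derive_liouville_coef _ _ x0).2 split_lshiftE.
    by rewrite [lsubmx u' 0 i]mxE.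
  move=> i _; rewrite (derive_liouville_coef _ _ x0).2 split_rshiftE.
  exact: mul0r.
rewrite /ext_coef; apply: etrans (congr2 (fun r t : R^o => r - t) (E w w') (E w' w)) _.
rewrite /symplectic_sum -sumrB -sumrN; apply: eq_bigr => i _.
by ring.
Qed.

Lemma twisted_form_coord z0 b q w w' : AN b ->
  cdom (prod_chart (angle_chart z0) b) (cbase q) -> a_coord q != 0 ->
  let X := cot_chart AM (prod_chart (angle_chart z0) b) in
  twisted_form AN q (coordvec TM X q w) (coordvec TM X q w') =
  symplectic_sum (X q) w w'.
Proof.
move=> ANb cq a0 X; rewrite /twisted_form.
(* Every chart of the cotangent atlas comes from an angle chart and a chart of [N], so lambda has
   the same coefficient functions in all of them. *)
have hex X' : TM X' -> cdom X' q -> exists a', coframe_coef (A := TM)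
    (fun q v => fine (twisted_liouville q v)) q X' a'.
  move=> /cot_atlasE[z1 [b' [ANb' ->]]] cq'.
  by exists liouville_coef; exact: liouville_coframe.
rewrite (ext_d_coord hT w w' hex (cot_adapted_atlas z0 ANb) cq
  (liouville_coframe ANb cq a0)).
by rewrite ext_coef_liouville ?opprK// -(a_coordE ANb cq).
Qed.

End twisted_form.

(** * The twisted form is b-symplectic *)

Section b_symplectic.
Context {R : realType} {N : Type} {m : nat} {AN : atlas R N m}.
Hypothesis hN : compatible AN.
Let AM := prod_atlas (circle_atlas R) AN.
Let TM := cot_atlas AM.
Let hM : compatible AM := prod_compatible circle_compatible hN.
Let hT : compatible TM := cot_compatible hM.
Let Z := critical_hypersurface AN.
Local Notation rowT := 'rV[R]_((1 + m) + (1 + m)).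

Lemma symplectic_sum_linear (x w : rowT) a (u v : rowT) :
  symplectic_sum x w (a *: u + v) =
  a * symplectic_sum x w u + symplectic_sum x w v.
Proof.
rewrite /symplectic_sum mulr_sumr -big_split/=; apply: eq_bigr => i _.
by rewrite !linearP/= !mxE; ring.
Qed.

Lemma symplectic_sum_antisym (x w w' : rowT) :
  symplectic_sum x w' w = - symplectic_sum x w w'.
Proof.
by rewrite /symplectic_sum -sumrN; apply: eq_bigr => i _; ring.
Qed.

Lemma symplectic_sum_diag (x w : rowT) : symplectic_sum x w w = 0.
Proof.
by rewrite /symplectic_sum big1// => i _; ring.
Qed.

Lemma notZ_neq0 (q : cotangent AM) : (~` Z) q -> a_coord q != 0.
Proof. by move=> nZ; apply/eqP. Qed.

Lemma twisted_alternating : alternating2_on TM (~` Z) (twisted_form AN).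
Proof.
move=> q /notZ_neq0 a0; have [z0 [b [ANb cq]]] := cot_chart_at hN q.
pose X := cot_chart AM (prod_chart (angle_chart z0) b).
have TMX : TM X := cot_adapted_atlas z0 ANb.
have E := twisted_form_coord hN _ _ ANb cq a0.
split.
- move=> v /(tangentP hT _ TMX cq)[w ->].
  apply: (linear_on_coordvec hT TMX cq) => a u u'.
  exact: (etrans (E _ _) (etrans (symplectic_sum_linear _ _ _ _ _)
    (congr2 (fun r s : R => a * r + s) (esym (E _ _)) (esym (E _ _))))).
- move=> v /(tangentP hT _ TMX cq)[w ->].
  apply: (linear_on_coordvec hT TMX cq) => a u u'.
  have L : symplectic_sum (X q) (a *: u + u') w =
      a * symplectic_sum (X q) u w + symplectic_sum (X q) u' w.
    by rewrite !(symplectic_sum_antisym _ w) symplectic_sum_linear opprD mulrN.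
  exact: (etrans (E _ _) (etrans L
    (congr2 (fun r s : R => a * r + s) (esym (E _ _)) (esym (E _ _))))).
- by move=> v /(tangentP hT _ TMX cq)[w ->]; rewrite E symplectic_sum_diag.
Qed.

Lemma is_derive_liouville_dcoef (i : 'I_(1 + m)) (t : R^o) :
  (i = lshift m 0 -> t != 0) ->
  exists dt : R^o, is_derive t (1 : R^o) (liouville_dcoef i) dt.
Proof.
case: (split_ordP i) => j -> t0.
  exists ('D_1 (liouville_dcoef (lshift m j)) t); apply: derivableP.
  have -> : liouville_dcoef (lshift m j) = (fun t : R^o => t^-1).
    by apply/funext => s; rewrite /liouville_dcoef split_lshiftE.
  by apply: (derivableV (f := id)); [rewrite t0// (ord1 j)|exact: derivable_id].
exists 0; have -> : liouville_dcoef (rshift 1 j) = cst (1 : R^o).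
  by apply/funext => s; rewrite /liouville_dcoef split_rshiftE.
exact: is_derive_cst.
Qed.

(** The i-th coefficient is a function of y_i alone, so its differential is a multiple [h i] of
    dy_i. *)
Lemma derive_symplectic_sum (x : rowT) : rsubmx x 0 (lshift m 0) != 0 ->
  exists h : 'I_(1 + m) -> R^o, forall u w w' : rowT,
    'D_u (fun x => symplectic_sum x w w') x =
    \sum_i (h i * rsubmx u 0 i *
      (lsubmx w 0 i * rsubmx w' 0 i - rsubmx w 0 i * lsubmx w' 0 i) : R^o).
Proof.
move=> x0.
have /choice[h hP] : forall i, exists dt : R^o,
    is_derive (rsubmx x 0 i : R^o) (1 : R^o) (liouville_dcoef i) dt.
  by move=> i; apply: is_derive_liouville_dcoef => ->.
exists h => u w w'.
have sr i : smooth_at (fun x : rowT => rsubmx x 0 i : R^o) x.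
  exact: ((smooth_at_coord (@rsubmx R 1 _ _) x).1 (smooth_at_rsubmx x) i).
have Dr i : 'D_u (fun x : rowT => rsubmx x 0 i : R^o) x = rsubmx u 0 i.
  rewrite -(derive_rsubmx x u).
  exact/esym/derive_coord/smooth_at_differentiable/smooth_at_rsubmx.
have D i := derive_real_comp u (smooth_at_differentiable (sr i)) (hP i).
have dc i : differentiable (fun=> lsubmx w 0 i * rsubmx w' 0 i -
    rsubmx w 0 i * lsubmx w' 0 i : R^o) x.
  exact/smooth_at_differentiable/smooth_at_cst.
rewrite (derive_sumf _ (fun i => differentiable_mulf (D i).1 (dc i))).
apply: eq_bigr => i _; rewrite (derive_mulf _ (D i).1 (dc i)).
rewrite (derive_cst (lsubmx w 0 i * rsubmx w' 0 i -
  rsubmx w 0 i * lsubmx w' 0 i : R^o)) mulr0 add0r (D i).2 Dr.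
exact: mulrC.
Qed.

Lemma twisted_closed : closed2_on TM (~` Z) (twisted_form AN).
Proof.
move=> _ q /cot_atlasE[z0 [b [ANb ->]]] cq /notZ_neq0 a0 i j k D.
pose X := cot_chart AM (prod_chart (angle_chart z0) b).
have TMX : TM X := cot_adapted_atlas z0 ANb.
have x0 : rsubmx (X q) 0 (lshift m 0) != 0 by rewrite -(a_coordE hN ANb cq).
have [h hE] := derive_symplectic_sum x0.
have DE r s t : D r s t = \sum_i (h i * rsubmx (delta_mx 0 r : rowT) 0 i *
    (lsubmx (delta_mx 0 s : rowT) 0 i * rsubmx (delta_mx 0 t : rowT) 0 i -
     rsubmx (delta_mx 0 s : rowT) 0 i * lsubmx (delta_mx 0 t : rowT) 0 i) : R^o).
  rewrite -hE; apply: (derive_loc hT _ TMX cq).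
  apply: mnbhsS (near_nonzero_momentum hN ANb cq a0) => q' [cq' a0'].
  exact: (twisted_form_coord hN _ _ ANb cq' a0').
(* Each term of the cyclic sum is [h l] times the value of dy_l /\ dx_l /\ dy_l, which is 0 because
   of the repeated factor. *)
rewrite !DE -!big_split/= big1// => l _.
by ring.
Qed.

Let i0 : 'I_((1 + m) + (1 + m)) := rshift (1 + m) (lshift m 0).

Definition symplectic_mx : 'M[R]_((1 + m) + (1 + m)) :=
  block_mx 0 1%:M (- 1%:M) 0.

Lemma symplectic_mx_unit : symplectic_mx \in unitmx.
Proof.
have : symplectic_mx *m block_mx 0 (- 1%:M) 1%:M 0 = 1%:M.
  rewrite mulmx_block !mul0mx !mulmx0 !add0r !addr0 mulNmx !mul1mx.
  by rewrite opprK -scalar_mx_block.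
by case/mulmx1_unit.
Qed.

Definition frame_scale (x : rowT) j : R := if j == i0 then x 0 i0 else 1.

Lemma symplectic_sum_frame (x : rowT) j k : rsubmx x 0 (lshift m 0) != 0 ->
  symplectic_sum x (frame_scale x j *: delta_mx 0 j)
    (frame_scale x k *: delta_mx 0 k) = symplectic_mx j k.
Proof.
move=> x0; rewrite mxE in x0.
have scl p : frame_scale x (lshift _ p) = 1.
  by rewrite /frame_scale /i0 eq_lrshift.
(* The pole cancels here: 1/a meets the factor a of the frame vector a d/da, and for the other
   momenta both factors are 1. *)
have scr p : liouville_dcoef p (rsubmx x 0 p) * frame_scale x (rshift _ p) = 1.
  rewrite /frame_scale /i0 eq_rshift mxE; case: (split_ordP p) => l ->.
    by rewrite (ord1 l) eqxx /liouville_dcoef split_lshiftE mulVf.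
  by rewrite eq_rlshift /liouville_dcoef split_rshiftE mulr1.
have ll s (p i : 'I_(1 + m)) : lsubmx (s *: delta_mx 0 (lshift _ p) : rowT) 0 i =
    s * (i == p)%:R by rewrite !mxE eqxx eq_lshift.
have lr s (p i : 'I_(1 + m)) : lsubmx (s *: delta_mx 0 (rshift _ p) : rowT) 0 i = 0.
  by rewrite !mxE eqxx eq_lrshift mulr0.
have rl s (p i : 'I_(1 + m)) : rsubmx (s *: delta_mx 0 (lshift _ p) : rowT) 0 i = 0.
  by rewrite !mxE eqxx eq_rlshift mulr0.
have rr s (p i : 'I_(1 + m)) : rsubmx (s *: delta_mx 0 (rshift _ p) : rowT) 0 i =
    s * (i == p)%:R by rewrite !mxE eqxx eq_rshift.
rewrite /symplectic_sum /symplectic_mx.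
case: (split_ordP j) => p ->; case: (split_ordP k) => p' ->.
- rewrite block_mxEul mxE big1// => i _.
  by rewrite !rl mulr0 mul0r subrr mulr0.
- rewrite block_mxEur mxE (bigD1 p)//= big1 ?addr0; last first.
    by move=> i /negPf ip; rewrite ll ip rl lr mulr0 !mul0r subrr mulr0.
  rewrite ll rl rr scl eqxx !mul1r mul0r subr0.
  case: eqVneq => [->|_]; last by rewrite !mulr0.
  by rewrite mulr1 scr.
- rewrite block_mxEdl mxE [1%:M p p']mxE (bigD1 p)//= big1 ?addr0; last first.
    by move=> i /negPf ip; rewrite rr ip lr mulr0; ring.
  rewrite ll lr rr rl scl eqxx mulr1; move: (scr p) ((p == p')%:R : R) => S t.
  rewrite -[RHS]mul1r -[1 in RHS]S; ring.
- rewrite block_mxEdr mxE big1// => i _.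
  by rewrite !lr mulr0 mul0r subrr mulr0.
Qed.

Lemma twisted_adapted z0 b : AN b ->
  adapted TM Z (cot_chart AM (prod_chart (angle_chart z0) b)) i0.
Proof.
move=> ANb; split; first exact: cot_adapted_atlas.
move=> q cq; rewrite /Z /critical_hypersurface /= (a_coordE hN ANb cq).
by rewrite mxE.
Qed.

Lemma bframe_coordvec z0 b (q : cotangent AM) j : AN b ->
  cdom (prod_chart (angle_chart z0) b) (cbase q) ->
  let X := cot_chart AM (prod_chart (angle_chart z0) b) in
  bframe TM X i0 q j = coordvec TM X q (frame_scale (X q) j *: delta_mx 0 j).
Proof.
move=> ANb cq X; rewrite (coordvecZ hT _ _ (cot_adapted_atlas z0 ANb) cq).
by [].
Qed.

(** The coefficients off Z do not depend on the point, so the constant matrix is itself the smooth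
    extension across Z. *)
Lemma twisted_bform2_coef z0 b : AN b ->
  bform2_coef TM Z (twisted_form AN)
    (cot_chart AM (prod_chart (angle_chart z0) b)) i0 (fun=> symplectic_mx).
Proof.
move=> ANb q cq; split; first exact: smooth_near_cst.
move=> /notZ_neq0 a0 j k; rewrite !(bframe_coordvec _ ANb cq).
rewrite (twisted_form_coord hN _ _ ANb cq a0).
by rewrite symplectic_sum_frame// -(a_coordE hN ANb cq).
Qed.

Lemma twisted_b_symplectic : b_symplectic TM Z (twisted_form AN).
Proof.
split; [exact: twisted_alternating|exact: twisted_closed|] => q.
have [z0 [b [ANb cq]]] := cot_chart_at hN q.
exists (cot_chart AM (prod_chart (angle_chart z0) b)), i0, (fun=> symplectic_mx).
split=> //; [exact: twisted_adapted|exact: twisted_bform2_coef|].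
exact: symplectic_mx_unit.
Qed.

End b_symplectic.

(** * The moment map *)

Section circle_translation.
Context {R : realType}.
Let C := circle_atlas R.

Lemma smooth_circle_translate (z s : circle R) :
  smooth_map_at C C (fun s => s * z)%g s.
Proof.
have hC := @circle_compatible R.
have sp : smooth_map_at C (prod_atlas C C) (fun s => (s, z)) s.
  by apply: smooth_pair => //; [exact: smooth_map_at_id|exact: smooth_map_at_cst].
exact: (smooth_map_at_comp hC (prod_compatible hC hC) sp (smooth_circle_mul (s, z))).
Qed.

(** Rotations preserve d/dtheta: by commutativity [cexp t * z] is [z * cexp t], so both angles grow
    at the same rate. *)
Lemma tmap_circle_translate (z : circle R) u :
  tmap C (fun s => s * z)%g 1%g (coordvec C (angle_chart 1%g) 1%g u) =
  coordvec C (angle_chart z) z u.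
Proof.
have hC := @circle_compatible R.
have C1 : C (angle_chart 1%g) by exists 1%g.
have Cz : C (angle_chart z) by exists z.
have dz : cdom (angle_chart z) (1 * z)%g by rewrite mul1g; exact: angle_chart_self.
have sz := smooth_circle_translate z 1%g.
pose G (x : 'rV[R]_1) := x + const_mx (angle z z - angle 1%g (1%g : circle R)).
rewrite (tmap_expression (G := G) hC hC u sz C1 (angle_chart_self _) Cz dz); last first.
  have n : \forall s \near (0 : R),
     (cdom (angle_chart 1%g) (1 * cexp s)%g /\
      angle 1%g (1 * cexp s)%g = angle 1%g (1%g : circle R) + s) /\
     (cdom (angle_chart z) (z * cexp s)%g /\
      angle z (z * cexp s)%g = angle z z + s).
    exact: filterI (angle_near (angle_chart_self _)) (angle_near (angle_chart_self _)).
  apply: mnbhsS (mnbhs_circle 1%g n) => s [t st [[_ E1] [_ E2]]].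
  apply/rowP => i; rewrite !mxE st E1.
  have -> : (1 * cexp t * z = z * cexp t)%g.
    by rewrite mul1g; apply: val_inj; rewrite /= mulrC.
  rewrite E2; ring.
by rewrite mul1g derive_addcst ?derive_id.
Qed.

End circle_translation.

(** [tmap] takes its base point as an argument, and points such as [rho 1 p] and [p] are equal only
    by a proof; this form of functoriality absorbs that equation. *)
Lemma tmap_comp_at {R : realType} {M M' M'' : Type} {d d' d'' : nat}
    {A : atlas R M d} {B : atlas R M' d'} {C : atlas R M'' d''}
    (f : M -> M') (g : M' -> M'') p p' v :
  compatible B -> compatible C -> f p = p' -> smooth_map_at B C g p' ->
  tmap C g p' (tmap B f p v) = tmap C (g \o f) p v.
Proof. by move=> hB hC <- sg; rewrite (tmap_comp hB hC). Qed.

Section hamiltonian.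
Context {R : realType} {N : Type} {m : nat} {AN : atlas R N m}.
Context {K : groupType} {k : nat} {AK : atlas R K k} {act : K -> N -> N}.
Hypotheses (hN : compatible AN) (hK : compatible AK).
Hypothesis hact : smooth_action AK AN act.
Hypothesis hinv : smooth_map AK AK (fun g => g^-1%g).
Let C := circle_atlas R.
Let AM := prod_atlas C AN.
Let AG := prod_atlas C AK.
Let TM := cot_atlas AM.
Let hC : compatible C := @circle_compatible R.
Let hM : compatible AM := prod_compatible hC hN.
Let hG : compatible AG := prod_compatible hC hK.
Let hT : compatible TM := cot_compatible hM.
Let rho := component_action (R := R) act.
Let lift := lifted_action AN act.
Implicit Types (q : cotangent AM) (p : circle R * N).

Lemma component_action1 p : rho 1%g p = p.
Proof.
have [act1 _ _] := hact.
by case: p => z x; rewrite /rho /component_action mul1g act1.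
Qed.

Lemma component_actionM g h p : rho (g * h)%g p = rho g (rho h p).
Proof.
have [_ actM _] := hact.
by case: p => z x; rewrite /rho /component_action /= -mulgA actM.
Qed.

Lemma smooth_component_action w :
  smooth_map_at (prod_atlas AG AM) AM (fun w => rho w.1 w.2) w.
Proof.
have [_ _ sact] := hact; have hGM := prod_compatible hG hM.
have s1 := smooth_fst hG hM w; have s2 := smooth_snd hG hM w.
have s11 := smooth_map_at_comp hGM hG s1 (smooth_fst hC hK w.1).
have s12 := smooth_map_at_comp hGM hG s1 (smooth_snd hC hK w.1).
have s21 := smooth_map_at_comp hGM hM s2 (smooth_fst hC hN w.2).
have s22 := smooth_map_at_comp hGM hM s2 (smooth_snd hC hN w.2).
have t1 := smooth_map_at_comp hGM (prod_compatible hC hC)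
  (smooth_pair hGM s11 s21) (smooth_circle_mul _).
have t2 := smooth_map_at_comp hGM (prod_compatible hK hN)
  (smooth_pair hGM s12 s22) (sact _).
exact: (smooth_pair hGM t1 t2).
Qed.

Lemma smooth_group_inv g : smooth_map_at AG AG (fun g => g^-1%g) g.
Proof.
have t1 := smooth_map_at_comp hG hC (smooth_fst hC hK g) (smooth_circle_inv _).
have t2 := smooth_map_at_comp hG hK (smooth_snd hC hK g) (hinv _).
exact: (smooth_pair hG t1 t2).
Qed.

Lemma smooth_act2 p g : smooth_map_at AG AN (fun g => act g.2 p.2) g.
Proof.
have [_ _ sact] := hact.
have s := smooth_map_at_cst hG hN p.2 g.
exact: (smooth_map_at_comp hG (prod_compatible hK hN)
  (smooth_pair hG (smooth_snd hC hK g) s) (sact _)).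
Qed.

(** The projection to the circle intertwines the component-wise action with rotation, so both sides
    are tangent maps at 1 of the same orbit map. *)
Lemma tmap_fst_fundamental p X :
  tmap C fst p (fundamental AM rho X p) =
  tmap C (fun s => s * p.1)%g 1%g (tmap C fst 1%g X).
Proof.
rewrite /fundamental (tmap_comp_at (A := AG) X hM hC (component_action1 p)
  (smooth_fst hC hN p)).
by rewrite (tmap_comp_at (A := AG) (f := fst) (p := 1%g) (p' := 1%g) X hC hC erefl
  (smooth_circle_translate p.1 1%g)).
Qed.

Lemma tmap_snd_fundamental p X :
  tmap AN snd p (fundamental AM rho X p) = tmap AN (fun g => act g.2 p.2) 1%g X.
Proof.
by rewrite /fundamental (tmap_comp_at (A := AG) X hM hN (component_action1 p)
  (smooth_snd hC hN p)).
Qed.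

(** The base point of a lifted covector is the moved base point by construction, so the lifted field
    projects to the field on M. This suffices for the moment map, as lambda sees a vector only
    through its projection. *)
Lemma tmap_cbase_fundamental q X :
  tmap AM (@cbase _ _ _ AM) q (fundamental TM lift X q) =
  fundamental AM rho X (cbase q).
Proof.
have E : lift 1%g q = q.
  exact: (cot_lift1 hM hG component_action1 component_actionM smooth_component_action).
by rewrite /fundamental (tmap_comp_at (A := AG) X hT hM E (smooth_cbase hM q)).
Qed.

(** The value of dtheta on the circle component of [X]; it becomes the coefficient of log |a|, the
    same at all points of T*M. *)
Definition circle_part (X : functional R (circle R * K)) : R :=
  tmap C fst 1%g X (angle 1%g).

(** The ordinary cotangent moment map of the action of [K] on T*N, which supplies the smooth part of
    the b-function. *)
Definition orbit_part (X : functional R (circle R * K)) q : R^o :=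
  cform (cot_snd q) (tmap AN (fun g => act g.2 (cbase q).2) 1%g X).

Lemma tangent_fst X : tangent AG 1%g X ->
  exists u, tmap C fst 1%g X = coordvec C (angle_chart 1%g) 1%g u.
Proof.
move=> TX; have C1 : C (angle_chart 1%g) by exists 1%g.
apply/(tangentP hC _ C1 (angle_chart_self _)).
exact: (tangent_tmap hG hC (smooth_fst hC hK 1%g) TX).
Qed.

(** The decomposition into k log |a| and a smooth part, free of charts on M and valid on Z too. Both
    the Hamiltonian property and equivariance start from it. *)
Lemma moment_mapE q X : tangent AG 1%g X ->
  moment_map AN act q X =
  (lne `|a_coord q|%:E * (circle_part X)%:E + (orbit_part X q)%:E)%E.
Proof.
move=> TX; rewrite /moment_map (twisted_liouvilleE hN) tmap_cbase_fundamental.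
rewrite tmap_fst_fundamental tmap_snd_fundamental /circle_part.
have [u ->] := tangent_fst TX.
rewrite tmap_circle_translate !circle_coordvec_angle//; exact: angle_chart_self.
Qed.

(** * Equivariance of the moment map *)

Section equivariance.
Hypothesis hmul : smooth_map (prod_atlas AK AK) AK (fun w => (w.1 * w.2)%g).

Let conj (g h : circle R * K) := (g * h * g^-1)%g.

Let conj1 g : conj g 1%g = 1%g.
Proof. by rewrite /conj mulg1 mulgV. Qed.

Let conj_fst g h : (conj g h).1 = h.1.
Proof. by apply: val_inj; rewrite /= mulrAC mulfV ?mul1r// circle_neq0. Qed.

Let smooth_conj g h : smooth_map_at AG AG (conj g) h.
Proof.
have hKK := prod_compatible hK hK.
have s2 := smooth_snd hC hK h.
have c1 := smooth_map_at_cst hG hK g.2 h.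
have c2 := smooth_map_at_cst hG hK g^-1.2%g h.
have t1 := smooth_map_at_comp hG hKK (smooth_pair hG c1 s2) (hmul _).
have t2 := smooth_map_at_comp hG hKK (smooth_pair hG t1 c2) (hmul _).
have -> : conj g = fun h => (h.1, (g.2 * h.2 * (g^-1).2)%g).
  by apply/funext => h'; rewrite [LHS]surjective_pairing conj_fst.
exact: (smooth_pair hG (smooth_fst hC hK h) t2).
Qed.

Let tangent_Ad g X : tangent AG 1%g X -> tangent AG 1%g (Ad AG g X).
Proof.
move=> TX; have := tangent_tmap hG hG (smooth_conj g 1%g) TX.
by rewrite conj1.
Qed.

Let circle_part_Ad g X : circle_part (Ad AG g X) = circle_part X.
Proof.
rewrite /circle_part /Ad (tmap_comp_at (A := AG) (f := conj g) X hG hC (conj1 g)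
  (smooth_fst hC hK 1%g)).
by congr (tmap _ _ _ _ _); apply/funext => h; exact: conj_fst.
Qed.

Let smooth_act (g : K) x : smooth_map_at AN AN (act g) x.
Proof.
have [_ _ sact] := hact.
have s := smooth_pair hN (smooth_map_at_cst hN hK g x) (smooth_map_at_id hN x).
exact: (smooth_map_at_comp hN (prod_compatible hK hN) s (sact _)).
Qed.

Let smooth_left_translate (z s : circle R) : smooth_map_at C C (fun s => z * s)%g s.
Proof.
have -> : (fun s => z * s)%g = (fun s : circle R => s * z)%g.
  by apply/funext => t; apply: val_inj; rewrite /= mulrC.
exact: smooth_circle_translate.
Qed.

Let actK (g : K) x : act g^-1%g (act g x) = x.
Proof. by have [act1 actM _] := hact; rewrite -actM mulVg act1. Qed.

Let smooth_rho g p : smooth_map_at AM AM (rho g) p.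
Proof. exact: (smooth_action_at hM hG smooth_component_action). Qed.

Let cform_liftE g q v : tangent AM (rho g (cbase q)) v ->
  cform (lift g q) v = cform q (tmap AM (rho g^-1%g) (rho g (cbase q)) v).
Proof.
exact: (cform_lift hM hG component_action1 component_actionM smooth_component_action).
Qed.

(** The inclusion of the circle at height [act g.2 x], followed by [rho g^-1], is a rotation
    followed by the inclusion at height [x]. So the circle component of the lift is the lift by the
    rotation alone. *)
Lemma cform_fst_lift g q v : tangent C (g.1 * (cbase q).1)%g v ->
  cform (cot_fst (lift g q)) v =
  cform (cot_fst q) (tmap C (fun s => g.1^-1 * s)%g (g.1 * (cbase q).1)%g v).
Proof.
move=> Tv; rewrite (cform_fst hC hN (q := lift g q) Tv).
have Ti := tangent_tmap hC hM
  (smooth_incl1 hC hN (g.1 * (cbase q).1)%g (act g.2 (cbase q).2)) Tv.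
rewrite (cform_liftE (g := g) Ti).
rewrite (tmap_comp_at (A := C) (p := (g.1 * (cbase q).1)%g) v hM hM erefl
  (smooth_rho g^-1%g _)).
have E : (g.1^-1 * (g.1 * (cbase q).1))%g = (cbase q).1 by rewrite mulKg.
rewrite (cform_fst hC hN); last first.
  by have := tangent_tmap hC hC (smooth_left_translate g.1^-1%g _) Tv; rewrite E.
rewrite (tmap_comp_at (A := C) v hC hM E (smooth_incl1 hC hN _ _)).
congr (cform q (tmap _ _ _ _)); apply/funext => s.
by rewrite /rho /component_action /= actK.
Qed.

Lemma cform_snd_lift g q v : tangent AN (act g.2 (cbase q).2) v ->
  cform (cot_snd (lift g q)) v =
  cform (cot_snd q) (tmap AN (act g.2^-1%g) (act g.2 (cbase q).2) v).
Proof.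
move=> Tv; rewrite (cform_snd hC hN (q := lift g q) Tv).
have Ti := tangent_tmap hN hM
  (smooth_incl2 hC hN (g.1 * (cbase q).1)%g (act g.2 (cbase q).2)) Tv.
rewrite (cform_liftE (g := g) Ti).
rewrite (tmap_comp_at (A := AN) (p := act g.2 (cbase q).2) v hM hM erefl
  (smooth_rho g^-1%g _)).
have E := actK g.2 (cbase q).2.
rewrite (cform_snd hC hN); last first.
  by have := tangent_tmap hN hN (smooth_act g.2^-1%g _) Tv; rewrite E.
rewrite (tmap_comp_at (A := AN) v hN hM E (smooth_incl2 hC hN _ _)).
congr (cform q (tmap _ _ _ _)); apply/funext => s.
by rewrite /rho /component_action /= mulKg.
Qed.

(** The vectors d/dtheta at the old and at the new base point are both translates of the one at 1,
    so the rotation back by [g.1^-1] carries one to the other. *)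
Lemma a_coord_lift g q : a_coord (lift g q) = a_coord q.
Proof.
have Cz (z : circle R) : C (angle_chart z) by exists z.
rewrite /a_coord /fiber_a -[cbase (cot_fst (lift g q))]/(g.1 * (cbase q).1)%g.
rewrite -[cbase (cot_fst q)]/((cbase q).1) /dcoord.
rewrite cform_fst_lift; last exact: (tangent_coordvec _ (Cz _) (angle_chart_self _)).
rewrite -(tmap_circle_translate (g.1 * (cbase q).1)%g).
rewrite -[in RHS](tmap_circle_translate (cbase q).1).
rewrite (tmap_comp_at (A := C) (f := (fun s => s * (g.1 * (cbase q).1))%g) (p := 1%g)
  _ hC hC (mul1g _) (smooth_left_translate _ _)).
congr (cform _ (tmap _ _ _ _)); apply/funext => s.
by apply: val_inj; rewrite /= mulrCA mulKf ?circle_neq0.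
Qed.

Lemma moment_map_equivariant : equivariant AG lift (moment_map AN act).
Proof.
move=> g q X TX; rewrite moment_mapE// moment_mapE ?circle_part_Ad ?a_coord_lift;
  last exact: tangent_Ad.
have [act1 actM _] := hact.
congr (_ + _%:E)%E; rewrite /orbit_part.
rewrite -[(cbase (lift g q)).2]/(act g.2 (cbase q).2).
have E1 : act (1%g : circle R * K).2 (act g.2 (cbase q).2) = act g.2 (cbase q).2.
  exact: act1.
have := tangent_tmap hG hN (smooth_act2 (rho g (cbase q)) 1%g) TX.
rewrite [act _ _]E1 => T1; rewrite cform_snd_lift//.
rewrite (tmap_comp_at (A := AG) X hN hN E1 (smooth_act _ _)) /Ad.
rewrite (tmap_comp_at (A := AG) X hG hN (conj1 _) (smooth_act2 (cbase q) 1%g)).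
congr (cform _ (tmap _ _ _ _)); apply/funext => h.
(* Both sides are now tangent maps at 1 of h |-> g^-1 h g x in [N]; on the right the last factor
   arises as the inverse of g^-1. *)
rewrite [RHS](_ : _ = act (g.2^-1 * h.2 * g.2)%g (cbase q).2); last first.
  exact: (congr1 (fun t => act (g.2^-1 * h.2 * t)%g (cbase q).2) (invgK g.2)).
by rewrite !actM.
Qed.

End equivariance.

End hamiltonian.

Arguments orbit_part {R N m AN K} act X q.

Lemma lsub_coord {R : realType} m n (x : 'rV[R]_(m + n)) i :
  lsubmx x 0 i = x 0 (lshift n i).
Proof. by rewrite mxE. Qed.

Lemma rsub_coord {R : realType} m n (x : 'rV[R]_(m + n)) i :
  rsubmx x 0 i = x 0 (rshift m i).
Proof. by rewrite mxE. Qed.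

Section delta_blocks.
Context {R : realType} (m n : nat).

Lemma lsub_delta_lshift (i : 'I_m) :
  lsubmx (delta_mx 0 (lshift n i) : 'rV[R]_(m + n)) = delta_mx 0 i.
Proof. by apply/rowP => j; rewrite !mxE eq_lshift. Qed.

Lemma rsub_delta_lshift (i : 'I_m) :
  rsubmx (delta_mx 0 (lshift n i) : 'rV[R]_(m + n)) = 0.
Proof. by apply/rowP => j; rewrite !mxE eq_rlshift andbF. Qed.

Lemma lsub_delta_rshift (i : 'I_n) :
  lsubmx (delta_mx 0 (rshift m i) : 'rV[R]_(m + n)) = 0.
Proof. by apply/rowP => j; rewrite !mxE eq_lrshift andbF. Qed.

Lemma rsub_delta_rshift (i : 'I_n) :
  rsubmx (delta_mx 0 (rshift m i) : 'rV[R]_(m + n)) = delta_mx 0 i.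
Proof. by apply/rowP => j; rewrite !mxE eq_rshift. Qed.

Lemma coord0 (j : 'I_n) : (0 : 'rV[R]_n) 0 j = 0.
Proof. by rewrite mxE. Qed.

Lemma coord_delta (i j : 'I_n) : (delta_mx 0 i : 'rV[R]_n) 0 j = (j == i)%:R.
Proof. by rewrite mxE eqxx. Qed.

Lemma coordZ (a : R) (x : 'rV[R]_n) j : (a *: x) 0 j = a * x 0 j.
Proof. by rewrite mxE. Qed.

Lemma coordN (x : 'rV[R]_n) j : (- x) 0 j = - x 0 j.
Proof. by rewrite mxE. Qed.

End delta_blocks.

(** * The contraction identity, in cotangent charts *)

Section b_hamiltonian.
Context {R : realType} {N : Type} {m : nat} {AN : atlas R N m}.
Context {K : groupType} {k : nat} {AK : atlas R K k} {act : K -> N -> N}.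
Hypotheses (hN : compatible AN) (hK : compatible AK).
Hypothesis hact : smooth_action AK AN act.
Hypothesis hinv : smooth_map AK AK (fun g => g^-1%g).
Let C := circle_atlas R.
Let AM := prod_atlas C AN.
Let AG := prod_atlas C AK.
Let TM := cot_atlas AM.
Let hC : compatible C := @circle_compatible R.
Let hM : compatible AM := prod_compatible hC hN.
Let hG : compatible AG := prod_compatible hC hK.
Let hT : compatible TM := cot_compatible hM.
Let Z := critical_hypersurface AN.
Let rho := component_action (R := R) act.
Let lift := lifted_action AN act.
Let rho1 := component_action1 (R := R) hact.
Let rhoM := component_actionM (R := R) hact.
Let srho := smooth_component_action (R := R) hN hK hact.
Let sinv := smooth_group_inv (R := R) hK hinv 1%g.
Local Notation rowT := 'rV[R]_((1 + m) + (1 + m)).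

Section local_chart.
Variables (z0 : circle R) (b : chart R N m) (cK : chart R K k).
Hypotheses (ANb : AN b) (AKcK : AK cK) (cK1 : cdom cK 1%g).
Variable u : 'rV[R]_(1 + k).
Let c := prod_chart (angle_chart z0) b.
Let cG := prod_chart (angle_chart (1%g : circle R)) cK.
Let X := coordvec AG cG 1%g u.
Let F := field_loc rho cG c u.
Let LF := lift_field_loc rho cG c u.
Let Xc := cot_chart AM c.
Implicit Types (p : circle R * N) (q : cotangent AM).

Let AMc : AM c. Proof. exact: adapted_atlas. Qed.
Let AGcG : AG cG. Proof. exact: prod_atlas_chart (angle_chart_atlas _) AKcK. Qed.
Let cG1 : cdom cG 1%g. Proof. by split=> //; exact: angle_chart_self. Qed.
Let TMX : TM Xc. Proof. exact: cot_adapted_atlas. Qed.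

Let fundamentalE p : cdom c p ->
  fundamental AM rho X p = coordvec AM c p (F (c p)).
Proof. by move=> cp; exact: (fundamental_coord hM hG rho1 srho AGcG cG1 AMc). Qed.

Let fst_X : tmap C fst 1%g X = coordvec C (angle_chart 1%g) 1%g (lsubmx u).
Proof.
have [d1 d2] := cG1.
exact: (tmap_fst hC hK u (angle_chart_atlas _) AKcK d1 d2).
Qed.

Lemma circle_partE : circle_part X = u 0 (lshift k 0).
Proof.
rewrite /circle_part fst_X circle_coordvec_angle; last exact: angle_chart_self.
by rewrite mxE.
Qed.

(** Compares the circle components of the fundamental field at [p] and of [X]: by invariance of
    d/dtheta they are the same number. *)
Lemma field_circle p : cdom c p -> F (c p) 0 (lshift m 0) = u 0 (lshift k 0).
Proof.
move=> cp; have [d1 d2] := cp.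
have := tmap_fst_fundamental hN hact p X.
rewrite (fundamentalE cp) (tmap_fst hC hN _ (angle_chart_atlas _) ANb d1 d2).
rewrite fst_X tmap_circle_translate.
rewrite (circle_coordvec _ d1 (angle_chart_self _)).
move=> /(coordvec_inj hC (angle_chart_atlas _) d1)/rowP/(_ 0).
by rewrite !lsub_coord.
Qed.

(** The left side involves [p] only through [p.2]; this is the source of the independence of the
    angle. *)
Lemma field_orbit p : cdom c p ->
  tmap AN (fun g => act g.2 p.2) 1%g X =
  coordvec AN b p.2 (rsubmx (F (c p))).
Proof.
move=> cp; have [d1 d2] := cp.
rewrite -(tmap_snd_fundamental hN hact p X) (fundamentalE cp).
by rewrite (tmap_snd hC hN _ (angle_chart_atlas _) ANb d1 d2).
Qed.

Lemma orbit_partE q : cdom c (cbase q) -> orbit_part act X q =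
  \sum_i F (c (cbase q)) 0 (rshift 1 i) * rsubmx (Xc q) 0 (rshift 1 i).
Proof.
move=> cq; have [d1 d2] := cq; rewrite /orbit_part (field_orbit cq).
rewrite (cform_snd_coord hC hN (angle_chart_atlas _) ANb d1 d2).
by apply: eq_bigr => i _; rewrite rsub_coord.
Qed.

Let sF p : cdom c p -> smooth_at F (c p).
Proof. by move=> cp; exact: (smooth_field_loc hM hG rho1 srho AGcG cG1 AMc). Qed.

Let sFj p j : cdom c p -> smooth_at (fun x => F x 0 j : R^o) (c p).
Proof. by move=> cp; exact: ((smooth_at_coord _ _).1 (sF cp)). Qed.

Lemma derive_field_circle p w : cdom c p ->
  'D_w (fun x => F x 0 (lshift m 0) : R^o) (c p) = 0.
Proof.
move=> cp; rewrite -[RHS](derive_cst (u 0 (lshift k 0) : R^o) (c p) w).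
apply: near_eq_derive; apply/(chart_near hM _ AMc cp); near=> x => p' cp' _.
exact: field_circle.
Unshelve. all: by end_near. Qed.

(* The projection to N intertwines the actions, so the N-component of the field
   at (z, x) is the fundamental field at x, whatever z. *)
Lemma derive_field_angle p j : cdom c p ->
  'D_(delta_mx 0 (lshift m 0)) (fun x => F x 0 j : R^o) (c p) = 0.
Proof.
move=> cp; have [d1 d2] := cp.
case: (split_ordP j) => i ->; first by rewrite (ord1 i) derive_field_circle.
pose incl (y : 'rV[R]_m) := row_mx (angle_chart z0 p.1) y.
pose H y : R^o := F (incl y) 0 (rshift 1 i).
have sincl : smooth_at incl (b p.2).
  by apply: smooth_at_row_mx; [exact: smooth_at_cst|exact: smooth_at_id].
have sH : smooth_at H (b p.2).
  exact: (@composable_scalar _ _ _ incl (fun x => F x 0 (rshift 1 i) : R^o) _ sincl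
    (sFj _ cp)).
have -> : 'D_(delta_mx 0 (lshift m 0)) (fun x => F x 0 (rshift 1 i) : R^o) (c p) =
    'D_(delta_mx 0 (lshift m 0)) (H \o rsubmx) (c p).
  apply: near_eq_derive; apply/(chart_near hM _ AMc cp); near=> x => p' cp' _.
  have [d1' d2'] := cp'.
  have cp'' : cdom c (p.1, p'.2) by [].
  have E : coordvec AN b p'.2 (rsubmx (F (c p'))) =
      coordvec AN b p'.2 (rsubmx (F (c (p.1, p'.2)))).
    exact: etrans (esym (field_orbit cp')) (field_orbit cp'').
  have V := coordvec_inj hN ANb d2' E.
  apply: etrans (esym (rsub_coord (F (c p')) i)) _.
  rewrite V.
  apply: etrans (rsub_coord _ i) _.
  rewrite /H /incl.
  rewrite /comp.
  by rewrite row_mxKr.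
rewrite derive_comp; last 2 first.
- exact: differentiable_rsubmx.
- by rewrite /= row_mxKr; exact: smooth_at_differentiable.
rewrite derive_rsubmx (_ : rsubmx (delta_mx _ _) = 0) ?derive0//.
by apply/rowP => l; rewrite !mxE eq_rlshift andbF.
Unshelve. all: by end_near. Qed.

Lemma fundamental_liftE q : cdom c (cbase q) ->
  fundamental TM lift X q = coordvec TM Xc q (LF (Xc q)).
Proof.
by move=> cq; exact: (fundamental_lift hM hG rho1 rhoM srho sinv AGcG cG1 AMc).
Qed.

Let sLF q : cdom c (cbase q) -> smooth_at LF (Xc q).
Proof.
by move=> cq; exact: (smooth_lift_field_loc hM hG rho1 srho AGcG cG1 AMc).
Qed.

Lemma lift_field_position q i : cdom c (cbase q) ->
  LF (Xc q) 0 (lshift _ i) = F (c (cbase q)) 0 i.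
Proof. by move=> cq; rewrite /LF /lift_field_loc row_mxEl /= row_mxKl. Qed.

Lemma lift_field_momentum q i : cdom c (cbase q) ->
  LF (Xc q) 0 (rshift _ i) =
  - \sum_j 'D_(delta_mx 0 i) (fun x => F x 0 j : R^o) (c (cbase q)) *
      rsubmx (Xc q) 0 j.
Proof. by move=> cq; rewrite /LF /lift_field_loc row_mxEr mxE /= row_mxKl. Qed.

Let i0 : 'I_((1 + m) + (1 + m)) := rshift (1 + m) (lshift m 0).

Lemma lift_field_angular_momentum q : cdom c (cbase q) -> LF (Xc q) 0 i0 = 0.
Proof.
move=> cq; rewrite lift_field_momentum// big1 ?oppr0// => j _.
by rewrite derive_field_angle ?mul0r.
Qed.

Definition orbit_loc (z : rowT) : R^o :=
  \sum_i (F (lsubmx z) 0 (rshift 1 i) * rsubmx z 0 (rshift 1 i) : R^o).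

Let srsub (z : rowT) j : smooth_at (fun z : rowT => rsubmx z 0 j : R^o) z.
Proof.
exact: ((smooth_at_coord (@rsubmx R 1 _ _) z).1 (smooth_at_rsubmx z) j).
Qed.

Let derive_rsub (z w : rowT) j :
  'D_w (fun z : rowT => rsubmx z 0 j : R^o) z = rsubmx w 0 j.
Proof.
rewrite -(derive_rsubmx z w).
exact/esym/derive_coord/smooth_at_differentiable/smooth_at_rsubmx.
Qed.

Let sFlsub q j : cdom c (cbase q) ->
  smooth_at (fun z : rowT => F (lsubmx z) 0 j : R^o) (Xc q).
Proof.
move=> cq; apply: (@composable_scalar _ _ _ (@lsubmx R 1 _ _)
  (fun x => F x 0 j : R^o)); first exact: smooth_at_lsubmx.
by rewrite /= row_mxKl; exact: sFj.
Qed.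

Let derive_Flsub q w j : cdom c (cbase q) ->
  'D_w (fun z : rowT => F (lsubmx z) 0 j : R^o) (Xc q) =
  'D_(lsubmx w) (fun x => F x 0 j : R^o) (c (cbase q)).
Proof.
move=> cq; have E : lsubmx (Xc q) = c (cbase q) by rewrite /= row_mxKl.
have dF : differentiable (fun x => F x 0 j : R^o) (lsubmx (Xc q)).
  by rewrite E; exact: (smooth_at_differentiable (sFj j cq)).
rewrite (derive_comp (g := fun x => F x 0 j : R^o) _
  (smooth_at_differentiable (smooth_at_lsubmx _)) dF).
by rewrite derive_lsubmx E.
Qed.

Lemma smooth_orbit_loc q : cdom c (cbase q) -> smooth_at orbit_loc (Xc q).
Proof.
move=> cq; apply: smooth_at_sum => i; apply: smooth_atM; last exact: srsub.
exact: sFlsub.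
Qed.

Lemma derive_orbit_loc q w : cdom c (cbase q) ->
  'D_w orbit_loc (Xc q) =
  \sum_i (F (c (cbase q)) 0 (rshift 1 i) * rsubmx w 0 (rshift 1 i) +
    rsubmx (Xc q) 0 (rshift 1 i) *
    'D_(lsubmx w) (fun x => F x 0 (rshift 1 i) : R^o) (c (cbase q)) : R^o).
Proof.
move=> cq; have E : lsubmx (Xc q) = c (cbase q) by rewrite /= row_mxKl.
have dF i := smooth_at_differentiable (sFlsub (rshift 1 i) cq).
have dr i := smooth_at_differentiable (srsub (Xc q) (rshift 1 i)).
rewrite (derive_sumf _ (fun i => differentiable_mulf (dF i) (dr i))).
apply: eq_bigr => i _; rewrite (derive_mulf _ (dF i) (dr i)).
by rewrite (derive_rsub (Xc q) w (rshift 1 i)) (derive_Flsub w (rshift 1 i) cq) E.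
Qed.

Lemma mnbhs_orbit_loc q : cdom c (cbase q) ->
  mnbhs TM q [set q' | orbit_part act X q' = orbit_loc (Xc q')].
Proof.
move=> cq; apply: mnbhsS (mnbhs_chart hT TMX cq) => q' cq'.
have E : lsubmx (Xc q') = c (cbase q') by rewrite row_mxKl.
by apply: etrans (orbit_partE cq') _; rewrite /orbit_loc E.
Qed.

Lemma mnbhs_a_coord q : cdom c (cbase q) ->
  mnbhs TM q [set q' | a_coord q' = rsubmx (Xc q') 0 (lshift m 0)].
Proof.
move=> cq; apply: mnbhsS (mnbhs_chart hT TMX cq) => q' cq'.
exact: (a_coordE hN ANb cq').
Qed.

Lemma smooth_near_a_coord q : cdom c (cbase q) ->
  smooth_near TM q (fun q => a_coord q : R^o).
Proof.
move=> cq.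
exact: (smooth_near_expression hT composable_scalar
  (G := fun z : rowT => rsubmx z 0 (lshift m 0) : R^o) TMX cq
  (mnbhs_a_coord cq) (srsub _ _)).
Qed.

Lemma smooth_near_orbit_part q : cdom c (cbase q) ->
  smooth_near TM q (orbit_part act X).
Proof.
move=> cq; exact: (smooth_near_expression hT composable_scalar TMX cq
  (mnbhs_orbit_loc cq) (smooth_orbit_loc cq)).
Qed.

Lemma coordvec_a_coord q w : cdom c (cbase q) ->
  coordvec TM Xc q w (fun q => a_coord q : R^o) = w 0 i0.
Proof.
move=> cq; rewrite (coordvec_expression hT w
  (G := fun z : rowT => rsubmx z 0 (lshift m 0) : R^o) TMX cq
  (mnbhs_a_coord cq) (srsub _ _)).
exact: etrans (derive_rsub _ _ _) (rsub_coord _ _).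
Qed.

Lemma derive_orbit_loc_position q i : cdom c (cbase q) ->
  'D_(delta_mx 0 (lshift (1 + m) i)) orbit_loc (Xc q) = - LF (Xc q) 0 (rshift _ i).
Proof.
move=> cq; rewrite (derive_orbit_loc _ cq) (lift_field_momentum _ cq) opprK.
rewrite lsub_delta_lshift rsub_delta_lshift [RHS]big_split_ord /= big_ord1.
(* The momentum of the lifted field sums over all position components, whereas [orbit_loc] omits the
   angular one; the extra term is the derivative of the constant angular component. *)
rewrite (derive_field_circle _ cq) mul0r add0r; apply: eq_bigr => l _.
by rewrite coord0 mulr0 add0r mulrC.
Qed.

Lemma derive_orbit_loc_momentum q s i : cdom c (cbase q) ->
  'D_(s *: delta_mx 0 (rshift (1 + m) i)) orbit_loc (Xc q) =
  \sum_l (F (c (cbase q)) 0 (rshift 1 l) * (s * (rshift 1 l == i)%:R) : R^o).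
Proof.
move=> cq; rewrite (derive_orbit_loc _ cq); apply: eq_bigr => l _.
rewrite !linearZ /= lsub_delta_rshift rsub_delta_rshift scaler0 derive0 mulr0 addr0.
by rewrite coordZ coord_delta.
Qed.

(** Hamilton's equations in the b-frame: position derivatives give minus the momentum components of
    the field, momentum derivatives give its position components. *)
Lemma b_differential_frame q j : cdom c (cbase q) -> a_coord q != 0 ->
  b_differential (circle_part X) (fun q => a_coord q : R^o) (orbit_part act X) q
    (bframe TM Xc i0 q j) =
  row_mx (- rsubmx (LF (Xc q))) (lsubmx (LF (Xc q))) 0 j.
Proof.
move=> cq a0; rewrite /b_differential (bframe_coordvec hN _ ANb cq).
rewrite (coordvec_a_coord _ cq).
rewrite (coordvec_expression hT _ TMX cq (mnbhs_orbit_loc cq) (smooth_orbit_loc cq)).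
rewrite circle_partE /frame_scale -/i0 coordZ coord_delta.
case: (split_ordP j) => i ->.
  rewrite row_mxEl coordN rsub_coord /i0 eq_lrshift eq_rlshift scale1r.
  rewrite (derive_orbit_loc_position _ cq).
  by rewrite mulr0 mul0r mulr0 add0r.
rewrite row_mxEr lsub_coord (lift_field_position _ cq).
rewrite (derive_orbit_loc_momentum _ _ cq) /i0 !eq_rshift.
case: (split_ordP i) => l ->.
  (* Along a d/da the logarithmic term gives k a / a = k, which is the angular component of the
     field; the orbit part does not involve a. *)
  rewrite (ord1 l) eqxx mulr1 (field_circle cq).
  have -> : Xc q 0 (rshift (1 + m) (lshift m 0)) = a_coord q.
    by rewrite (a_coordE hN ANb cq) rsub_coord.
  rewrite divff// mulr1 big1 ?addr0// => l' _.
  by rewrite eq_rlshift mulr0 mulr0.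
rewrite eq_rlshift eq_lrshift mulr0 mul0r mulr0 add0r.
rewrite (bigD1 l)//= eqxx !mulr1 big1 ?addr0// => l' l'l.
by rewrite eq_rshift (negPf l'l) mulr0 mulr0.
Qed.

Lemma lift_field_frame q : cdom c (cbase q) ->
  fundamental TM lift X q = \sum_j LF (Xc q) 0 j *: bframe TM Xc i0 q j.
Proof.
move=> cq; rewrite fundamental_liftE// (coordvec_sum hT _ TMX cq).
(* The frame vector a d/da degenerates on Z, so a nonzero component along d/da would have to be
   divided by a; that component is 0, and the coordinates of the field serve unchanged as frame
   coefficients. *)
apply: eq_bigr => j _; rewrite /bframe; case: eqVneq => [->|_].
  by rewrite lift_field_angular_momentum// !scale0r.
by rewrite scale1r.
Qed.

Lemma smooth_near_lift_field q : cdom c (cbase q) ->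
  smooth_near TM q (fun q => LF (Xc q)).
Proof.
move=> cq; apply: (smooth_near_expression hT (@composable_row _ _) (G := LF) TMX cq).
  exact: mnbhsS (mnbhs_chart hT TMX cq).
exact: sLF.
Qed.

Lemma smooth_near_contraction q : cdom c (cbase q) ->
  smooth_near TM q (fun q => row_mx (- rsubmx (LF (Xc q))) (lsubmx (LF (Xc q)))).
Proof.
move=> cq; apply: (smooth_near_expression hT (@composable_row _ _)
  (G := fun z => row_mx (- rsubmx (LF z)) (lsubmx (LF z))) TMX cq).
  exact: mnbhsS (mnbhs_chart hT TMX cq).
have s := sLF cq; apply: smooth_at_row_mx.
  apply: (@composable_row _ _ _ _ (rsubmx \o LF) (@GRing.opp 'rV[R]_(1 + m))).
    exact: (composable_row s (smooth_at_rsubmx _)).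
  by apply: (@smooth_at_linear _ _ _ (@GRing.opp 'rV[R]_(1 + m))); exact: opp_continuous.
exact: (composable_row s (smooth_at_lsubmx _)).
Qed.

(** The row built from the lifted field equals the b-differential off Z and is smooth on the whole
    chart, so it is the extension of that differential. The required identity is then a block
    multiplication, valid on Z as elsewhere. *)
Lemma contract_at q : cdom c (cbase q) ->
  exists X i xi B D, [/\ adapted TM Z X i /\ cdom X q,
    bfield_coef TM (fundamental TM lift (coordvec AG cG 1%g u)) X i xi,
    bform2_coef TM Z (twisted_form AN) X i B,
    bform1_coef TM Z (b_differential (circle_part (coordvec AG cG 1%g u))
      (fun q => a_coord q : R^o) (orbit_part act (coordvec AG cG 1%g u))) X i D &
    xi q *m B q = D q].
Proof.
move=> cq; exists Xc, i0, (fun q => LF (Xc q)), (fun=> symplectic_mx),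
  (fun q => row_mx (- rsubmx (LF (Xc q))) (lsubmx (LF (Xc q)))); split.
- by split=> //; exact: twisted_adapted.
- move=> q' cq'; split; first exact: smooth_near_lift_field.
  exact: lift_field_frame.
- exact: twisted_bform2_coef.
- move=> q' cq'; split; first exact: smooth_near_contraction.
  by move=> /notZ_neq0 a0 j; rewrite b_differential_frame.
- rewrite -[LF (Xc q)]hsubmxK /symplectic_mx mul_row_block !mulmx0 add0r addr0.
  by rewrite mulmxN !mulmx1 hsubmxK.
Qed.

End local_chart.

Lemma twisted_hamiltonian :
  b_hamiltonian TM Z AG lift (twisted_form AN) (moment_map AN act).
Proof.
split=> [q /notZ_neq0 a0 a v w Tv Tw Tavw|X TX].
  (* Off Z the factor log |a| is finite, which turns the claim into real linearity of [circle_part]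
     and [orbit_part]. *)
  rewrite !(moment_mapE hN hK hact)// lne_EFin ?normr_gt0//.
  rewrite -!EFinM -!EFinD /=.
  have -> : circle_part (a *: v + w) = a * circle_part v + circle_part w.
    by rewrite /circle_part tmap_linear.
  have -> : orbit_part act (a *: v + w) q =
      a * orbit_part act v q + orbit_part act w q.
    have [act1 _ _] := hact.
    have s := smooth_act2 (R := R) hN hK hact (cbase q) 1%g.
    have l : linear_on AN (act (1%g : circle R * K).2 (cbase q).2) (cform (cot_snd q)).
      by rewrite [act _ _]act1; exact: (@cform_linear _ _ _ _ (cot_snd q)).
    exact: (linear_on_tmap hG hN s l Tv Tw Tavw).
  rewrite -[a *: _]/(a * _); ring.
have [cK AKcK cK1] : exists2 cK, AK cK & cdom cK 1%g by case: hK.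
have AGcG := prod_atlas_chart (angle_chart_atlas (1%g : circle R)) AKcK.
have cG1 : cdom (prod_chart (angle_chart (1%g : circle R)) cK) 1%g.
  by split=> //; exact: angle_chart_self.
have [u XE] := (tangentP hG X AGcG cG1).1 TX.
(* The data are read off from [moment_mapE], with a as defining function. That Z is its zero set
   holds by definition, and da is nonzero on Z because d/da takes a to 1. *)
exists (circle_part X), (fun q => a_coord q : R^o), (orbit_part act X); split.
  split.
  - split=> [q||q Zq].
    + have [z0 [b [ANb cq]]] := cot_chart_at hN q.
      exact: (smooth_near_a_coord ANb cq).
    + by [].
    + have [z0 [b [ANb cq]]] := cot_chart_at hN q.
      have TMX := cot_adapted_atlas z0 ANb.
      exists (coordvec TM (cot_chart AM (prod_chart (angle_chart z0) b)) q
        (delta_mx 0 (rshift (1 + m) (lshift m 0)))).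
        exact: tangent_coordvec.
      by rewrite (coordvec_a_coord ANb _ cq) mxE !eqxx oner_neq0.
  - move=> q; have [z0 [b [ANb cq]]] := cot_chart_at hN q.
    by rewrite XE; exact: (smooth_near_orbit_part ANb AKcK cK1 u cq).
  - by move=> q; rewrite (moment_mapE hN hK hact)// muleC.
move=> q; have [z0 [b [ANb cq]]] := cot_chart_at hN q.
by rewrite XE; exact: (contract_at ANb AKcK cK1 u cq).
Qed.

End b_hamiltonian.

Theorem proposition22 (R : realType)
    (N : Type) (m : nat) (AN : atlas R N m) (hN : is_manifold AN)
    (K : groupType) (k : nat) (AK : atlas R K k) (hK : lie_group AK)
    (act : K -> N -> N) (hact : smooth_action AK AN act) :
  let AM := prod_atlas (circle_atlas R) AN in
  let AG := prod_atlas (circle_atlas R) AK in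
  let Z := critical_hypersurface AN in
  let omega := twisted_form AN in
  let rho := lifted_action AN act in
  let mu := moment_map AN act in
  [/\ b_symplectic (cot_atlas AM) Z omega,
      b_hamiltonian (cot_atlas AM) Z AG rho omega mu &
      equivariant AG rho mu].
Proof.
have cN := manifold_compatible hN.
have [/manifold_compatible cK hmul hinv] := hK.
split; first exact: twisted_b_symplectic.
  exact: (twisted_hamiltonian cN cK hact hinv).
exact: (moment_map_equivariant cN cK hact hmul).
Qed.
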